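(* Let $G$ be a non-nested circle graph. Then its independence simplicial complex $I_G$ is homotopy equivalent to a wedge of spheres.
   Context: A chord diagram is a circle together with a finite set of chords with pairwise disjoint boundary points; its circle graph has one vertex per chord, two vertices being adjacent exactly when the chords intersect. A chord diagram is bipartite if its circle graph is bipartite; then its chords can be partitioned into two parts, one drawn inside the circle and the other drawn (as arcs) outside the circle, so that no two chords intersect in the drawing. A bipartite chord diagram is non-nested if it admits such a partition for which one of the two regions (inner or outer) contains no nested chords. Here having no nested chords in a region means that the chords placed in that region all border one common face of it; equivalently, no chord of that part separates two other chords of that part. (When drawn as arcs outside the circle, this means they can be drawn so that no arc encloses another.) A non-nested circle graph is the circle graph of a non-nested chord diagram. The independence complex $I_G$ of a loopless graph $G$ is the simplicial complex whose simplices are the independent sets of vertices of $G$ (the empty set included); it is identified with its geometric realization. The independence complex of the empty graph is $\{\emptyset\}$, denoted $S^{-1}$. A ''wedge of spheres'' means a finite wedge of spheres $S^{k}$ with $k\ge 0$, formed by successive one-point identifications at arbitrarily chosen base points ($S^0$ is two points, so the result may be disconnected); the empty wedge is a point, so contractible complexes count as (empty) wedges of spheres; the empty complex $S^{-1}$ is also allowed. *)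

(* Defs.v *)
From HB Require Import structures.
From mathcomp Require Import all_boot all_order all_algebra.
From mathcomp Require Import all_classical all_reals topology normedtype wedge_sigT.

Set Implicit Arguments.
Unset Strict Implicit.
Unset Printing Implicit Defensive.

Import Order.TTheory GRing.Theory Num.Theory.
Import numFieldNormedType.Exports.

Local Open Scope classical_set_scope.
Local Open Scope ring_scope.

Definition unit_sphere (R : realType) (n : nat) : set 'rV[R]_n :=
  [set x | \sum_(i < n) x ord0 i ^+ 2 = 1].
Arguments unit_sphere : clear implicits.

Definition open_disk (R : realType) : set 'rV[R]_2 :=
  [set x | \sum_(i < 2) x ord0 i ^+ 2 < 1].
Arguments open_disk : clear implicits.

(* The finite set of chords is indexed by [V]; the chord [v] joins the points
   [chord_end (v, false)] and [chord_end (v, true)] of the circle.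
   Injectivity says that chords have distinct ends and disjoint boundaries. *)
Record chord_diagram (R : realType) (V : finType) := ChordDiagram {
  chord_end : V * bool -> 'rV[R]_2;
  chord_end_circle : forall p, unit_sphere R 2 (chord_end p);
  chord_end_inj : injective chord_end }.

Definition chord (R : realType) (V : finType) (D : chord_diagram R V) (v : V) :
    set 'rV[R]_2 :=
  [set (1 - t) *: chord_end D (v, false) + t *: chord_end D (v, true)
     | t in `[0, 1] ].

Definition circle_graph (R : realType) (V : finType) (D : chord_diagram R V) :
    rel V :=
  fun u v => (u != v) && `[< chord D u `&` chord D v !=set0 >].

Definition bipartition (V : finType) (e : rel V) (P : {set V}) : Prop :=
  forall u v : V, e u v -> (u \in P) != (v \in P).

Definition chords_complement (R : realType) (V : finType)
    (D : chord_diagram R V) (P : {set V}) : set 'rV[R]_2 :=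
  open_disk R `\` \bigcup_(v in [set v | v \in P]) chord D v.

(* All chords in [P] border one common face. Chords placed outside the circle
   are represented by their mirror images inside: inversion in the circle
   carries one drawing to the other, and preserves faces and bordering. *)
Definition no_nested_chords (R : realType) (V : finType)
    (D : chord_diagram R V) (P : {set V}) : Prop :=
  exists2 x : 'rV[R]_2, chords_complement D P x &
    forall v : V, v \in P ->
      chord D v `<=` closure (connected_component (chords_complement D P) x).

(* The chords in [P] are drawn inside the circle, the others outside. *)
Definition non_nested (R : realType) (V : finType) (D : chord_diagram R V) :
    Prop :=
  exists2 P : {set V}, bipartition (circle_graph D) P &
    no_nested_chords D P \/ no_nested_chords D (~: P)%SET.

Definition non_nested_circle_graph (R : realType) (V : finType) (e : rel V) :
    Prop :=
  exists2 D : chord_diagram R V, non_nested D & e =2 circle_graph D.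

Definition independence_complex (V : finType) (e : rel V) : {set {set V}} :=
  [set S : {set V} | [forall u in S, forall v in S, ~~ e u v]]%SET.

(* Geometric realization, in barycentric coordinates. The complex with [set0]
   as only simplex is realized by the empty space. *)
Definition realization (R : realType) (V : finType) (K : {set {set V}}) :
    topologicalType :=
  set_type [set x : {ptws V -> R} | [/\ forall v, 0 <= x v, \sum_v x v = 1
                                         & [set v | x v != 0]%SET \in K] ].
Arguments realization R {V} K.

Definition homotopic (R : realType) (X Y : topologicalType) (f g : X -> Y) :
    Prop :=
  exists H : X * R -> Y,
    [/\ {within [set: X] `*` `[0, 1], continuous H},
        forall x, H (x, 0) = f x & forall x, H (x, 1) = g x].

Definition homotopy_equivalent (R : realType) (X Y : topologicalType) : Prop :=
  exists (f : X -> Y) (g : Y -> X),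
    [/\ continuous f, continuous g,
        homotopic R (g \o f) id & homotopic R (f \o g) id].

Definition sphere (R : realType) (k : nat) : topologicalType :=
  set_type (unit_sphere R k.+1).

(* Summands and base points of the wedge of [X] and [Y] at [x] and [y]. *)
Definition two_spaces (X Y : topologicalType) (b : bool) : topologicalType :=
  if b then X else Y.

Definition two_points (X Y : topologicalType) (x : X) (y : Y) (b : bool) :
    two_spaces X Y b :=
  if b return two_spaces X Y b then x else y.

(* The one-point space is 'rV[R]_0, and S^{-1} is the unit sphere of 'rV[R]_0,
   which is empty. *)
Inductive wedge_of_spheres (R : realType) : topologicalType -> Prop :=
| wedge_none : wedge_of_spheres R 'rV[R]_0
| wedge_attach (X : topologicalType) (k : nat) (x : X) (y : sphere R k) :
    wedge_of_spheres R X -> wedge_of_spheres R (wedge (two_points x y))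
| wedge_sphereN1 : wedge_of_spheres R (set_type (unit_sphere R 0)).

(* Main.v *)
Require Import Defs.
From mathcomp Require Import all_boot all_order all_algebra.
From mathcomp Require Import all_classical all_reals topology normedtype wedge_sigT realfun.
From mathcomp Require Import ring lra zify.

(** Let P be the part of the chords that border one common face. These chords cut pairwise
    disjoint arcs off the circle, and another chord meets a chord p of P only if exactly one
    of its ends lies on the arc of p. So every chord outside P has at most two neighbours,
    all in P, and, since the chords outside P do not cross each other, the circle graph is
    the incidence graph between the vertices and the edges of an outerplanar graph with
    vertex set P ([neighbour_degree], [no_crossing]); some of its edges may have one end only,
    or none.

    Two operations simplify a simplicial complex. Removing the open star of a simplex whose
    link is a cone is a deformation retraction ([star_apex_deformation]); in an independence
    complex it deletes a vertex whose neighbourhood contains that of another vertex not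
    adjacent to it. And if the link of a vertex v lies in a collapsible subcomplex of the
    deletion of v, the link is null-homotopic there, so that the complex is the wedge of the
    deletion with the suspension of the link. The complexes obtained in this way from cones
    and from the empty complex are called [decomposable].

    The combinatorial half of the proof shows that the independence complex of an incidence
    graph as above is decomposable ([decomposable_outerplanar]), by induction over induced
    subgraphs. Isolated vertices give cones, leaves and dominated vertices are removed. If
    there are none, the outerplanar graph is simple with all degrees at least two, and an
    edge spanning as few vertices as possible bounds a face in which only the two ends of
    that edge may have degree larger than two. This face is a cycle of the circle graph.
    Along it domination propagates with period three, and in each residue class of its length
    one of the two operations applies ([decomposable_cycle]).

    The topological half shows that decomposable complexes are wedges of spheres
    ([spherical_decomposable]). Its core is [spherical_attach_decomposable], which carries a
    simplex along through the induction and so reduces everything to the attachment of one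
    facet along a null-homotopic boundary ([spherical_attach]). The realization is then a
    mapping cone over the rest of the complex. A mapping cone depends only on the homotopy
    class of the attaching map ([slide_hequiv]) and on the base up to homotopy equivalence
    ([mcone_base_change]), and the cone of a constant map defined on the boundary of a simplex
    is the wedge with a sphere ([wedge_mcone], [pol_suspends]). *)

Set Implicit Arguments.
Unset Strict Implicit.
Unset Printing Implicit Defensive.

Import Order.TTheory GRing.Theory Num.Theory.
Import numFieldNormedType.Exports.

Local Open Scope classical_set_scope.
Local Open Scope ring_scope.

(** * Continuous maps and homotopies *)

Section continuity.
Variable R : realType.
Implicit Types X Y Z T : topologicalType.

Lemma cont_comp X Y Z (f : X -> Y) (g : Y -> Z) :
  continuous f -> continuous g -> continuous (fun x => g (f x)).
Proof. by move=> cf cg x; apply: continuous_comp; [exact: cf|exact: cg]. Qed.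

Lemma cont_pair X Y Z (f : X -> Y) (g : X -> Z) :
  continuous f -> continuous g -> continuous (fun x => (f x, g x)).
Proof. by move=> cf cg x; apply: cvg_pair; [exact: cf|exact: cg]. Qed.

Lemma cont_fst X Y : continuous (@fst X Y).
Proof. by move=> x; exact: cvg_fst. Qed.

Lemma cont_snd X Y : continuous (@snd X Y).
Proof. by move=> x; exact: cvg_snd. Qed.

Lemma cont_id X : continuous (fun x : X => x).
Proof. by move=> x; exact: cvg_id. Qed.

Lemma cont_cst X Y (y : Y) : continuous (fun _ : X => y).
Proof. exact: cst_continuous. Qed.

Lemma contD X (f g : X -> R) :
  continuous f -> continuous g -> continuous (fun x => f x + g x).
Proof. by move=> cf cg x; apply: cvgD; [exact: cf|exact: cg]. Qed.

Lemma contB X (f g : X -> R) :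
  continuous f -> continuous g -> continuous (fun x => f x - g x).
Proof. by move=> cf cg x; apply: cvgB; [exact: cf|exact: cg]. Qed.

Lemma contM X (f g : X -> R) :
  continuous f -> continuous g -> continuous (fun x => f x * g x).
Proof. by move=> cf cg x; apply: cvgM; [exact: cf|exact: cg]. Qed.

Lemma cont_min X (f g : X -> R) :
  continuous f -> continuous g -> continuous (fun x => Num.min (f x) (g x)).
Proof. by move=> cf cg x; apply: (@continuous_min R X); [exact: cf|exact: cg]. Qed.

Lemma cont_max X (f g : X -> R) :
  continuous f -> continuous g -> continuous (fun x => Num.max (f x) (g x)).
Proof. by move=> cf cg x; apply: (@continuous_max R X); [exact: cf|exact: cg]. Qed.

Lemma cont_sum X (I : finType) (P : pred I) (f : I -> X -> R) :
  (forall i, P i -> continuous (f i)) -> continuous (fun x => \sum_(i | P i) f i x).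
Proof.
move=> cf; rewrite unlock; elim: (index_enum I) => [|i s IH] /=; first exact: cont_cst.
by have [Pi|_] := boolP (P i); [apply: contD => //; exact: cf|exact: IH].
Qed.

Lemma cont_bigmin X (I : finType) (P : pred I) (f : I -> X -> R) :
  (forall i, P i -> continuous (f i)) ->
  continuous (fun x => \big[Num.min/1]_(i | P i) f i x).
Proof.
move=> cf; rewrite unlock; elim: (index_enum I) => [|i s IH] /=; first exact: cont_cst.
by have [Pi|_] := boolP (P i); [apply: cont_min => //; exact: cf|exact: IH].
Qed.

Lemma within_cont X Y (A : set X) (f : X -> Y) : continuous f -> {within A, continuous f}.
Proof. exact: continuous_subspaceT. Qed.

Lemma cont_setT X Y (f : X -> Y) : {within [set: X], continuous f} -> continuous f.
Proof. exact: (continuous_subspace_setT f).2. Qed.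

Lemma cont_if X Y (p : X -> R) (f g : X -> Y) :
  continuous p -> continuous f -> continuous g -> (forall x, p x = 0 -> f x = g x) ->
  continuous (fun x => if p x <= 0 then f x else g x).
Proof.
move=> cp cf cg fg; apply: cont_setT.
have -> : [set: X] = [set x | p x <= 0] `|` [set x | 0 <= p x].
  by apply/seteqP; split=> // x _ /=; have [|/ltW] := leP (p x) 0; [left|right].
apply: withinU_continuous.
- exact: ((continuous_closedP p).1 cp [set x | x <= 0] (@closed_le R 0)).
- exact: ((continuous_closedP p).1 cp [set x | x >= 0] (@closed_ge R 0)).
- have : {within [set x | p x <= 0], continuous f} by apply: within_cont.
  apply: subspace_eq_continuous => x; rewrite inE /= => px.
  by rewrite /from_subspace /= px.
- have : {within [set x | 0 <= p x], continuous g} by apply: within_cont.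
  apply: subspace_eq_continuous => x; rewrite inE /= => px.
  by rewrite /from_subspace /=; have [px0|//] := leP (p x) 0; apply/esym/fg/le_anti; rewrite px px0.
Qed.

(** Clamping the parameter turns homotopies on [0, 1] into maps on the whole line, so that
    continuity never has to be restricted to a subspace. *)
Definition clamp (t : R) : R := Num.max 0 (Num.min 1 t).

Lemma cont_clamp : continuous clamp.
Proof. by apply: cont_max; [exact: cont_cst|apply: cont_min; [exact: cont_cst|exact: cont_id]]. Qed.

Lemma clamp_ge0 t : 0 <= clamp t. Proof. by rewrite le_max lexx. Qed.
Lemma clamp_le1 t : clamp t <= 1. Proof. by rewrite ge_max ler01 ge_min lexx. Qed.
Lemma clamp_id t : 0 <= t -> t <= 1 -> clamp t = t.
Proof. by move=> t0 t1; rewrite /clamp min_r // max_r. Qed.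
Lemma clamp0 : clamp 0 = 0. Proof. by rewrite clamp_id. Qed.
Lemma clamp1 : clamp 1 = 1. Proof. by rewrite clamp_id. Qed.

Lemma cont_clamped X Y (H : X * R -> Y) : {within [set: X] `*` `[0, 1], continuous H} ->
  continuous (fun p => H (p.1, clamp p.2)).
Proof.
move=> cH.
pose k (p : X * R) := (p.1, clamp p.2).
have ck : continuous k.
  by apply: cont_pair; [exact: cont_fst|apply: cont_comp; [exact: cont_snd|exact: cont_clamp]].
move=> p; move/subspace_continuousP : cH => /(_ (k p)) cH.
have kI q : ([set: X] `*` `[0, 1]) (k q) by split => //=; rewrite in_itv /= clamp_ge0 clamp_le1.
apply: cvg_trans (cH (kI p)) => U /= HU.
have := ck p _ HU; rewrite /= nbhs_simpl /=.
by apply: filterS => q /=; apply; exact: kI.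
Qed.

Definition htpy X Y (f g : X -> Y) :=
  exists H : X * R -> Y, [/\ continuous H, forall x, H (x, 0) = f x & forall x, H (x, 1) = g x].

Lemma htpyP X Y (f g : X -> Y) : htpy f g <-> homotopic R f g.
Proof.
split=> -[H [cH H0 H1]]; first by exists H; split=> //; exact: within_cont.
exists (fun p => H (p.1, clamp p.2)); split=> [|x|x] /=; rewrite ?clamp0 ?clamp1 //.
exact: cont_clamped.
Qed.

Lemma htpy_refl X Y (f : X -> Y) : continuous f -> htpy f f.
Proof. by move=> cf; exists (fun p => f p.1); split=> //; apply: cont_comp; [exact: cont_fst|]. Qed.

Lemma htpy_sym X Y (f g : X -> Y) : htpy f g -> htpy g f.
Proof.
move=> [H [cH H0 H1]]; exists (fun p => H (p.1, 1 - p.2)); split=> [|x|x] /=.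
- apply: cont_comp cH; apply: cont_pair; first exact: cont_fst.
  by apply: contB; [exact: cont_cst|exact: cont_snd].
- by rewrite subr0.
- by rewrite subrr.
Qed.

Lemma htpy_trans X Y (g f h : X -> Y) : htpy f g -> htpy g h -> htpy f h.
Proof.
move=> [H [cH H0 H1]] [K [cK K0 K1]].
exists (fun p => if 2 * p.2 - 1 <= 0 then H (p.1, 2 * p.2) else K (p.1, 2 * p.2 - 1)).
have c2 : continuous (fun p : X * R => 2 * p.2).
  by apply: contM; [exact: cont_cst|exact: cont_snd].
have c21 : continuous (fun p : X * R => 2 * p.2 - 1) by apply: contB => //; exact: cont_cst.
split=> [|x|x] /=.
- apply: cont_if => //; last first.
    by move=> p p0; rewrite p0 K0; rewrite (_ : 2 * p.2 = 1) ?H1//; move: p0; lra.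
  + by apply: cont_comp cK; apply: cont_pair => //; exact: cont_fst.
  + by apply: cont_comp cH; apply: cont_pair => //; exact: cont_fst.
- by rewrite mulr0 sub0r oppr_le0 ler01 H0.
- have -> : 2 * 1 - 1 = 1 :> R by lra.
  by rewrite leNgt ltr01 K1.
Qed.

Lemma htpy_comp X Y Z (f f' : X -> Y) (g g' : Y -> Z) :
  continuous f -> continuous g' -> htpy f f' -> htpy g g' -> htpy (g \o f) (g' \o f').
Proof.
move=> cf cg [H [cH H0 H1]] [K [cK K0 K1]].
apply: (@htpy_trans _ _ (g' \o f)).
  exists (fun p => K (f p.1, p.2)); split=> //=.
  apply: cont_comp cK; apply: cont_pair; last exact: cont_snd.
  by apply: cont_comp cf; exact: cont_fst.
exists (fun p => g' (H p)); split=> [|x|x] /=; rewrite ?H0 ?H1 //.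
exact: cont_comp cg.
Qed.

Lemma htpy_eq X Y (f g f' g' : X -> Y) : f =1 f' -> g =1 g' -> htpy f g -> htpy f' g'.
Proof. by move=> /funext -> /funext ->. Qed.

Definition hequiv X Y := homotopy_equivalent R X Y.

Lemma hequivI X Y (f : X -> Y) (g : Y -> X) : continuous f -> continuous g ->
  htpy (g \o f) id -> htpy (f \o g) id -> hequiv X Y.
Proof. by move=> cf cg /htpyP gf /htpyP fg; exists f, g. Qed.

Lemma hequivE X Y : hequiv X Y -> exists (f : X -> Y) (g : Y -> X),
  [/\ continuous f, continuous g, htpy (g \o f) id & htpy (f \o g) id].
Proof. by move=> [f [g [cf cg /htpyP gf /htpyP fg]]]; exists f, g. Qed.

Lemma hequiv_sym X Y : hequiv X Y -> hequiv Y X.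
Proof. by move=> /hequivE [f [g [cf cg gf fg]]]; exact: hequivI fg gf. Qed.

(** If l and r are a left and a right homotopy inverse of f, then r is homotopic to
    l f r and hence to l. *)
Lemma hequivLR X Y (f : X -> Y) (l r : Y -> X) : continuous f -> continuous l -> continuous r ->
  htpy (l \o f) id -> htpy (f \o r) id -> hequiv X Y.
Proof.
move=> cf cl cr lf fr; apply: (@hequivI _ _ f r) => //.
have rl : htpy r l.
  apply: (@htpy_trans _ _ (l \o (f \o r))).
    exact/htpy_sym/(htpy_comp cr (@cont_id _) (htpy_refl cr) lf).
  apply: (htpy_comp _ cl fr (htpy_refl cl)); exact: cont_comp.
apply: htpy_trans lf; apply: (htpy_comp cf cl (htpy_refl cf) rl).
Qed.

Lemma hequiv_trans Y X Z : hequiv X Y -> hequiv Y Z -> hequiv X Z.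
Proof.
move=> /hequivE [f [g [cf cg gf fg]]] /hequivE [f' [g' [cf' cg' gf' fg']]].
apply: (@hequivI _ _ (f' \o f) (g \o g')); [exact: cont_comp|exact: cont_comp| |].
- apply: htpy_trans gf.
  apply: (@htpy_comp _ _ _ ((g' \o f') \o f) (id \o f) g g) => //; last exact: htpy_refl.
    by do 2! apply: cont_comp => //.
  by apply: (@htpy_comp _ _ _ f f) => //; [exact: cont_id|exact: htpy_refl].
- apply: htpy_trans fg'.
  apply: (@htpy_comp _ _ _ ((f \o g) \o g') (id \o g') f' f') => //; last exact: htpy_refl.
    by do 2! apply: cont_comp => //.
  by apply: (@htpy_comp _ _ _ g' g') => //; [exact: cont_id|exact: htpy_refl].
Qed.

End continuity.

(** * Mapping cones *)

Section mapping_cones.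
Variable R : realType.
Implicit Types (X Y Z T S : topologicalType) (r t : R).

Lemma hausdorff_prod X Y : hausdorff_space X -> hausdorff_space Y -> hausdorff_space (X * Y)%type.
Proof.
move=> hX hY [x y] [x' y'] cl; congr pair.
- apply: hX => U V nU nV.
  have [||[a b] [/= [Ua _] [Va _]]] := cl (U `*` setT) (V `*` setT); last by exists a.
  + by exists (U, setT) => //=; split=> //; exact: filterT.
  + by exists (V, setT) => //=; split=> //; exact: filterT.
- apply: hY => U V nU nV.
  have [||[a b] [/= [_ Ua] [_ Va]]] := cl (setT `*` U) (setT `*` V); last by exists b.
  + by exists (setT, U) => //=; split=> //; exact: filterT.
  + by exists (setT, V) => //=; split=> //; exact: filterT.
Qed.

(** A map from a compact set to a Hausdorff space is closed, hence a quotient map onto its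
    image: continuity on the image can be tested upstairs. *)
Lemma within_image_compact X Z T (K : set X) (q : X -> Z) (g : X -> T) (F : Z -> T) :
  compact K -> hausdorff_space Z -> continuous q -> continuous g ->
  (forall x, K x -> F (q x) = g x) -> {within q @` K, continuous F}.
Proof.
move=> cK hZ cq cg Fq; apply/continuous_closedP => C cC.
apply/closed_subspaceP; exists (q @` (K `&` g @^-1` C)).
  apply: compact_closed => //; apply: continuous_compact; first exact: within_cont.
  by apply: compact_closedI => //; move/continuous_closedP : cg; apply.
apply/seteqP; split=> z /=.
  by move=> [[x [Kx Cx] <-] _]; split; [rewrite /from_subspace /= Fq|exists x].
move=> [+ [x Kx xz]]; rewrite -xz /from_subspace /= Fq // => Cx.
by split; exists x.
Qed.

Lemma closed_image_compact X Z (K : set X) (q : X -> Z) :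
  compact K -> hausdorff_space Z -> continuous q -> closed (q @` K).
Proof.
move=> cK hZ cq; apply: compact_closed => //.
by apply: continuous_compact => //; exact: within_cont.
Qed.

(** [Z] is the mapping cone of [phi]: [i] comes from the base, [p] is the cylinder, glued to
    the base at height 1 and crushed to the apex [c] at height 0. The last field is the
    universal property of the cone times the interval; it is all that the homotopies below
    use, and it allows one to work with realizations and wedges as they are instead of with
    a quotient. The apex is a separate datum because [S] may be empty. *)
Record mcone S X Z (phi : S -> X) (i : X -> Z) (p : S * R -> Z) (c : Z) : Prop := MCone {
  mc_base : continuous i;
  mc_cyl : continuous p;
  mc_end1 : forall y, p (y, 1) = i (phi y);
  mc_end0 : forall y, p (y, 0) = c;
  mc_surj : forall z,
    [\/ exists x, z = i x, exists y r, [/\ 0 <= r, r <= 1 & z = p (y, r)] | z = c];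
  mc_glue : forall T (a : X * R -> T) (b : (S * R) * R -> T) (d : R -> T),
    continuous a -> continuous b -> continuous d ->
    (forall y t, 0 <= t -> t <= 1 -> b ((y, 1), t) = a (phi y, t)) ->
    (forall y t, 0 <= t -> t <= 1 -> b ((y, 0), t) = d t) ->
    exists2 F : Z * R -> T, continuous F &
      forall t, 0 <= t -> t <= 1 ->
        [/\ forall x, F (i x, t) = a (x, t),
            forall y r, 0 <= r -> r <= 1 -> F (p (y, r), t) = b ((y, r), t) &
            F (c, t) = d t] }.

(** When all spaces are compact and [Z] is Hausdorff, the universal property amounts to the
    set-theoretic description of the identifications made in the cone. *)
Lemma mcone_compact S X Z (phi : S -> X) (i : X -> Z) (p : S * R -> Z) (c : Z) :
  compact [set: S] -> compact [set: X] -> hausdorff_space Z ->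
  continuous i -> continuous p -> injective i ->
  (forall y, p (y, 1) = i (phi y)) -> (forall y, p (y, 0) = c) ->
  (forall x, c <> i x) ->
  (forall x y r, 0 <= r -> r < 1 -> p (y, r) <> i x) ->
  (forall y y' r r', 0 <= r -> r < 1 -> 0 <= r' -> r' < 1 -> p (y, r) = p (y', r') ->
    r = r' /\ (0 < r -> y = y')) ->
  (forall z,
    [\/ exists x, z = i x, exists y r, [/\ 0 <= r, r <= 1 & z = p (y, r)] | z = c]) ->
  mcone phi i p c.
Proof.
move=> cS cX hZ ci cp iinj p1 p0 ic pi pp surj; split=> // T a b d ca cb cd ba star_bd.
pose F (w : Z * R) : T :=
  if pselect (exists x, w.1 = i x) is left e then a (projT1 (cid e), w.2) else
  if pselect (exists yr : S * R, [/\ 0 <= yr.2, yr.2 <= 1 & w.1 = p yr]) is left e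
  then b (projT1 (cid e), w.2) else d w.2.
have Fi x t : F (i x, t) = a (x, t).
  rewrite /F /=; case: pselect => [e|[]]; last by exists x.
  by case: cid => x' /= /iinj ->.
have Fp y r t : 0 <= r -> r <= 1 -> 0 <= t -> t <= 1 -> F (p (y, r), t) = b ((y, r), t).
  move=> r0; rewrite le_eqVlt => /predU1P[->|r1] t0 t1; first by rewrite p1 Fi ba.
  rewrite /F /=; case: pselect => [[x /(pi _ _ _ r0 r1)]//|_].
  case: pselect => [e|[]]; last by exists (y, r); split=> //=; exact: ltW.
  case: cid => -[y' r'] [/= r0' r1' pE].
  have {}r1' : r' < 1.
    rewrite lt_neqAle r1' andbT; apply/eqP => r'1.
    by move: pE; rewrite r'1 p1 => /(pi _ _ _ r0 r1).
  have [rr yy] := pp _ _ _ _ r0 r1 r0' r1' pE.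
  rewrite -rr; have := r0; rewrite le_eqVlt => /predU1P[<-|/yy -> //].
  by rewrite !star_bd.
have Fc t : 0 <= t -> t <= 1 -> F (c, t) = d t.
  move=> t0 t1; have [[y _]|Sn] := pselect (exists y : S, True).
    by rewrite -(p0 y) Fp // star_bd.
  rewrite /F /=; case: pselect => [[x /ic]//|_].
  case: pselect => [e|//]; exfalso; apply: Sn.
  by case: e => yr _; exists yr.1.
have compI : compact `[0, 1 : R] by exact: segment_compact.
have hZR : hausdorff_space (Z * R)%type by apply: hausdorff_prod => //; exact: Rhausdorff.
exists (fun w => F (w.1, clamp w.2)); last first.
  by move=> t t0 t1; rewrite /= !(clamp_id t0 t1); split=> [//|y r r0 r1|]; rewrite ?Fp ?Fc.
apply: cont_clamped.
pose K1 : set (X * R) := setT `*` `[0, 1].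
pose q1 (w : X * R) := (i w.1, w.2).
pose K2 : set ((S * R) * R) := (setT `*` `[0, 1]) `*` `[0, 1].
pose q2 (w : (S * R) * R) := (p w.1, w.2).
pose K3 : set R := [set` `[0, 1]].
pose q3 (t : R) := (c, t).
have cK1 : compact K1 by exact: compact_setX.
have cK2 : compact K2 by apply: compact_setX => //; exact: compact_setX.
have cq1 : continuous q1.
  by apply: cont_pair; [apply: cont_comp ci; exact: cont_fst|exact: cont_snd].
have cq2 : continuous q2.
  by apply: cont_pair; [apply: cont_comp cp; exact: cont_fst|exact: cont_snd].
have cq3 : continuous q3 by apply: cont_pair; [exact: cont_cst|exact: cont_id].
have -> : [set: Z] `*` `[0, 1] = q1 @` K1 `|` q2 @` K2 `|` q3 @` K3.
  apply/seteqP; split=> [[z t] [_ /= tI]|].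
    have [[x ->]|[y [r [r0 r1 ->]]]|->] := surj z.
    - by left; left; exists (x, t).
    - by left; right; exists ((y, r), t) => //; split=> //=; split=> //=; rewrite in_itv /= r0.
    - by right; exists t.
  by move=> w [[[v [_ vI] <-]|[v [_ vI] <-]]|[v vI <-]]; split=> //; exact: vI.
have inI (t : R) : t \in `[0, 1] -> 0 <= t /\ t <= 1 by rewrite in_itv /= => /andP.
apply: withinU_continuous.
- by apply: closedU; exact: closed_image_compact.
- exact: closed_image_compact.
- apply: withinU_continuous; [exact: closed_image_compact|exact: closed_image_compact| |].
    by apply: (within_image_compact cK1 hZR cq1 ca) => -[x t] _; exact: Fi.
  apply: (within_image_compact cK2 hZR cq2 cb) => -[[y r] t] [[_ /= /inI[r0 r1]] /inI[t0 t1]].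
  exact: Fp.
- by apply: (within_image_compact compI hZR cq3 cd) => t /inI[t0 t1]; exact: Fc.
Qed.

Lemma mcone_map S X Z (phi : S -> X) i p c T (a : X -> T) (b : S * R -> T) (d : T) :
  @mcone S X Z phi i p c -> continuous a -> continuous b ->
  (forall y, b (y, 1) = a (phi y)) -> (forall y, b (y, 0) = d) ->
  exists F : Z -> T, [/\ continuous F, forall x, F (i x) = a x,
    forall y r, 0 <= r -> r <= 1 -> F (p (y, r)) = b (y, r) & F c = d].
Proof.
move=> mc ca cb ba star_bd.
have [||||F cF FE] := mc_glue mc (a := a \o fst) (b := b \o fst) (d := fun _ => d)
  _ _ (@cont_cst _ _ d).
- exact: (cont_comp (@cont_fst _ _) ca).
- exact: (cont_comp (@cont_fst _ _) cb).
- by move=> y t _ _ /=; exact: ba.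
- by move=> y t _ _ /=; exact: star_bd.
exists (fun z => F (z, 0)); have [Fi Fp Fc] := FE 0 (lexx _) ler01; split=> //.
by apply: cont_comp cF; apply: cont_pair; [exact: cont_id|exact: cont_cst].
Qed.

Lemma mcone_htpy S X Z (phi : S -> X) i p c T (f g : Z -> T)
    (a : X * R -> T) (b : (S * R) * R -> T) (d : R -> T) :
  @mcone S X Z phi i p c -> continuous a -> continuous b -> continuous d ->
  (forall y t, 0 <= t -> t <= 1 -> b ((y, 1), t) = a (phi y, t)) ->
  (forall y t, 0 <= t -> t <= 1 -> b ((y, 0), t) = d t) ->
  (forall x, a (x, 0) = f (i x)) -> (forall x, a (x, 1) = g (i x)) ->
  (forall y r, 0 <= r -> r <= 1 -> b ((y, r), 0) = f (p (y, r))) ->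
  (forall y r, 0 <= r -> r <= 1 -> b ((y, r), 1) = g (p (y, r))) ->
  d 0 = f c -> d 1 = g c -> htpy R f g.
Proof.
move=> mc ca cb cd ba star_bd a0 a1 b0 b1 d0 d1.
have [F cF FE] := mc_glue mc ca cb cd ba star_bd.
have [Fi0 Fp0 Fc0] := FE 0 (lexx _) ler01; have [Fi1 Fp1 Fc1] := FE 1 ler01 (lexx _).
exists F; split=> // z.
- have [[x ->]|[y [r [r0 r1 ->]]]|->] := mc_surj mc z.
  + by rewrite Fi0.
  + by rewrite Fp0 // b0.
  + by rewrite Fc0.
- have [[x ->]|[y [r [r0 r1 ->]]]|->] := mc_surj mc z.
  + by rewrite Fi1.
  + by rewrite Fp1 // b1.
  + by rewrite Fc1.
Qed.

End mapping_cones.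

(** * Invariance of mapping cones under homotopy *)

Section cone_maps.
Variable R : realType.
Implicit Types (X Y Z T S : topologicalType) (r s t u : R).

(** The cylinder of the cone, prolonged beyond the base along the homotopy [Psi] inside the
    base: heights in [0, 1] run through the cylinder, heights in [1, 2] through [Psi]. *)
Definition slide S X Z (i : X -> Z) (p : S * R -> Z) (Psi : S * R -> X) (w : S * R) : Z :=
  if w.2 - 1 <= 0 then p w else i (Psi (w.1, w.2 - 1)).

(** The map between the cones of the two ends of a homotopy [Psi]: the inner half of the
    cone is stretched over the whole cone, the outer half follows [Psi]. *)
Definition is_slide S X Z Z' (i : X -> Z) (p : S * R -> Z) (c : Z)
    (i' : X -> Z') (p' : S * R -> Z') (c' : Z') (Psi : S * R -> X) (E : Z -> Z') :=
  [/\ continuous E, forall x, E (i x) = i' x,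
      forall y r, 0 <= r -> r <= 1 -> E (p (y, r)) = slide i' p' Psi (y, 2 * r) & E c = c'].

Definition is_push S X X' Z Z' (f : X -> X') (i : X -> Z) (p : S * R -> Z) (c : Z)
    (i' : X' -> Z') (p' : S * R -> Z') (c' : Z') (F : Z -> Z') :=
  [/\ continuous F, forall x, F (i x) = i' (f x),
      forall y r, 0 <= r -> r <= 1 -> F (p (y, r)) = p' (y, r) & F c = c'].

Lemma slide_low S X Z (i : X -> Z) (p : S * R -> Z) (Psi : S * R -> X) y s :
  s <= 1 -> slide i p Psi (y, s) = p (y, s).
Proof. by move=> s1; rewrite /slide /= subr_le0 s1. Qed.

Lemma slide_high S X Z (phi : S -> X) (i : X -> Z) p c (Psi : S * R -> X) y s :
  @mcone R S X Z phi i p c -> (forall y, Psi (y, 0) = phi y) ->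
  1 <= s -> slide i p Psi (y, s) = i (Psi (y, s - 1)).
Proof.
move=> mc Psi0; rewrite le_eqVlt => /predU1P[<-|s1].
  by rewrite slide_low // subrr Psi0 (mc_end1 mc).
by rewrite /slide /= subr_le0 leNgt s1.
Qed.

Lemma slide_cont S X Z (phi : S -> X) (i : X -> Z) p c (Psi : S * R -> X) :
  @mcone R S X Z phi i p c -> continuous Psi -> (forall y, Psi (y, 0) = phi y) ->
  continuous (slide i p Psi).
Proof.
move=> mc cPsi Psi0.
have c1 : continuous (fun w : S * R => w.2 - 1).
  by apply: contB; [exact: cont_snd|exact: cont_cst].
apply: cont_if => //; first exact: mc_cyl mc.
  apply: cont_comp (mc_base mc); apply: cont_comp cPsi.
  by apply: cont_pair => //; exact: cont_fst.
move=> [y s] /= s1; rewrite s1 Psi0 -(mc_end1 mc); congr (p (_, _)); lra.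
Qed.

Lemma exists_slide S X Z Z' (phi phi' : S -> X) (i : X -> Z) (p : S * R -> Z) c
    (i' : X -> Z') (p' : S * R -> Z') c' (Psi : S * R -> X) :
  @mcone R S X Z phi i p c -> mcone phi' i' p' c' -> continuous Psi ->
  (forall y, Psi (y, 0) = phi' y) -> (forall y, Psi (y, 1) = phi y) ->
  exists E, is_slide i p c i' p' c' Psi E.
Proof.
move=> mc mc' cPsi Psi0 Psi1.
have [||||E [cE Ei Ep Ec]] := mcone_map (a := i') (d := c')
  (b := fun w => slide i' p' Psi (w.1, 2 * w.2)) mc.
- exact: mc_base mc'.
- apply: cont_comp (slide_cont mc' cPsi Psi0); apply: cont_pair; first exact: cont_fst.
  by apply: contM; [exact: cont_cst|exact: cont_snd].
- move=> y /=; rewrite (slide_high _ mc') //; last lra.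
  by rewrite -Psi1; congr (i' (Psi (_, _))); lra.
- by move=> y /=; rewrite mulr0 slide_low // (mc_end0 mc').
by exists E.
Qed.

Lemma slide_inv S X Z Z' (phi phi' : S -> X) (i : X -> Z) (p : S * R -> Z) c
    (i' : X -> Z') (p' : S * R -> Z') c' (Psi Psi' : S * R -> X) E E' :
  @mcone R S X Z phi i p c -> mcone phi' i' p' c' -> continuous Psi -> 
  (forall y, Psi (y, 0) = phi' y) -> (forall y, Psi (y, 1) = phi y) ->
  (forall y u, Psi' (y, u) = Psi (y, 1 - u)) ->
  is_slide i p c i' p' c' Psi E -> is_slide i' p' c' i p c Psi' E' ->
  htpy R (E' \o E) id.
Proof.
move=> mc mc' cPsi Psi0 Psi1 PP [cE Ei Ep Ec] [cE' Ei' Ep' Ec'].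
have Psi'0 y : Psi' (y, 0) = phi y by rewrite PP subr0.
have cPsi' : continuous Psi'.
  have -> : Psi' = fun w => Psi (w.1, 1 - w.2) by apply/funext => -[y u]; exact: PP.
  apply: cont_comp cPsi; apply: cont_pair; first exact: cont_fst.
  by apply: contB; [exact: cont_cst|exact: cont_snd].
(* The composite sends the point of height r to the point of height min(4r, 3 - 2r) on
   the cone prolonged along Psi', which a straight line joins to r. *)
apply: (mcone_htpy (a := fun w => i w.1) (d := fun=> c)
  (b := fun w => slide i p Psi' (w.1.1,
     (1 - w.2) * Num.min (4 * w.1.2) (3 - 2 * w.1.2) + w.2 * w.1.2)) mc) => /=.
- by apply: cont_comp (mc_base mc); exact: cont_fst.
- apply: cont_comp (slide_cont mc cPsi' Psi'0).
  have c12 : continuous (fun w : (S * R) * R => w.1.2).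
    exact: (cont_comp (@cont_fst _ _) (@cont_snd _ _)).
  apply: cont_pair; first exact: (cont_comp (@cont_fst _ _) (@cont_fst _ _)).
  apply: contD; last by apply: contM => //; exact: cont_snd.
  apply: contM; first by apply: contB; [exact: cont_cst|exact: cont_snd].
  apply: cont_min; first by apply: contM => //; exact: cont_cst.
  apply: contB; first exact: cont_cst.
  by apply: contM => //; exact: cont_cst.
- exact: cont_cst.
- move=> y t t0 t1; rewrite -(mc_end1 mc) min_r; last lra.
  by rewrite slide_low; [congr (p (_, _)); lra|lra].
- move=> y t t0 t1; rewrite -(mc_end0 mc y) min_l; last lra.
  by rewrite slide_low; [congr (p (_, _)); lra|lra].
- by move=> x; rewrite Ei Ei'.
- by [].
- move=> y r r0 r1; rewrite subr0 mul1r mul0r addr0 Ep //.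
  have [r2|r2] := leP (2 * r) 1.
    rewrite (slide_low _ _ _ _ r2) Ep' //; last lra.
    by rewrite min_l; [congr (slide _ _ _ (_, _)); lra|lra].
  rewrite (slide_high _ mc') // ?(ltW r2) // Ei' min_r; last lra.
  rewrite (slide_high _ mc) //; last lra.
  by rewrite PP; congr (i (Psi (_, _))); lra.
- by move=> y r r0 r1; rewrite subrr mul0r add0r mul1r slide_low.
- by rewrite Ec Ec'.
- by [].
Qed.

(** Homotopic attaching maps have homotopy equivalent mapping cones. *)
Lemma slide_hequiv S X Z Z' (phi phi' : S -> X) (i : X -> Z) (p : S * R -> Z) c
    (i' : X -> Z') (p' : S * R -> Z') c' (Phi : S * R -> X) :
  @mcone R S X Z phi i p c -> mcone phi' i' p' c' -> continuous Phi ->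
  (forall y, Phi (y, 0) = phi y) -> (forall y, Phi (y, 1) = phi' y) ->
  exists E E', [/\ is_slide i p c i' p' c' (fun w => Phi (w.1, 1 - w.2)) E,
    is_slide i' p' c' i p c Phi E', htpy R (E' \o E) id & htpy R (E \o E') id].
Proof.
move=> mc mc' cPhi Phi0 Phi1.
have cPhi' : continuous (fun w : S * R => Phi (w.1, 1 - w.2)).
  apply: cont_comp cPhi; apply: cont_pair; first exact: cont_fst.
  by apply: contB; [exact: cont_cst|exact: cont_snd].
have P0 y : Phi (y, 1 - 0) = phi' y by rewrite subr0.
have P1 y : Phi (y, 1 - 1) = phi y by rewrite subrr.
have [E HE] := exists_slide mc mc' cPhi' P0 P1.
have [E' HE'] := exists_slide mc' mc cPhi Phi0 Phi1.
exists E, E'; split=> //.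
- by apply: (slide_inv mc mc' cPhi' P0 P1 _ HE HE') => y u; rewrite /= subKr.
- by apply: (slide_inv mc' mc cPhi Phi0 Phi1 _ HE' HE) => y u.
Qed.

Lemma exists_push S X X' Z Z' (phi : S -> X) (f : X -> X') (i : X -> Z) (p : S * R -> Z) c
    (i' : X' -> Z') (p' : S * R -> Z') c' :
  @mcone R S X Z phi i p c -> mcone (f \o phi) i' p' c' -> continuous f ->
  exists F, is_push f i p c i' p' c' F.
Proof.
move=> mc mc' cf.
have [||||F [cF Fi Fp Fc]] := mcone_map (a := i' \o f) (b := p') (d := c') mc; last by exists F.
- exact: cont_comp (mc_base mc').
- exact: mc_cyl mc'.
- by move=> y; rewrite (mc_end1 mc').
- by move=> y; rewrite (mc_end0 mc').
Qed.

(** Pushing a cone forward along homotopic maps gives the same result up to sliding along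
    the homotopy. For f0 = g f and f1 = id this inverts one composite of the maps
    induced by g and f. *)
Lemma push_htpy S X Y Z Z0 Z1 (phi : S -> X) (i : X -> Z) p c (f0 f1 : X -> Y)
    (i0 : Y -> Z0) p0 c0 (i1 : Y -> Z1) p1 c1 (h : X * R -> Y) F0 F1 E :
  @mcone R S X Z phi i p c -> mcone (f0 \o phi) i0 p0 c0 -> mcone (f1 \o phi) i1 p1 c1 ->
  continuous h -> (forall x, h (x, 0) = f0 x) -> (forall x, h (x, 1) = f1 x) ->
  is_push f0 i p c i0 p0 c0 F0 -> is_push f1 i p c i1 p1 c1 F1 ->
  is_slide i0 p0 c0 i1 p1 c1 (fun w => h (phi w.1, 1 - w.2)) E ->
  continuous phi ->
  htpy R (E \o F0) F1.
Proof.
move=> mc mc0 mc1 ch h0 h1 [cF0 F0i F0p F0c] [cF1 F1i F1p F1c] [cE Ei Ep Ec] cphi.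
pose Psi (w : S * R) := h (phi w.1, 1 - w.2).
have Psi0 y : Psi (y, 0) = (f1 \o phi) y by rewrite /Psi /= subr0 h1.
have cPsi : continuous Psi.
  apply: cont_comp ch; apply: cont_pair; first by apply: cont_comp cphi; exact: cont_fst.
  by apply: contB; [exact: cont_cst|exact: cont_snd].
apply: (mcone_htpy (a := fun w => i1 (h w)) (d := fun=> c1)
  (b := fun w => slide i1 p1 Psi (w.1.1, (2 - w.2) * w.1.2)) mc) => /=.
- exact: cont_comp (mc_base mc1).
- apply: cont_comp (slide_cont mc1 cPsi Psi0).
  apply: cont_pair; first exact: (cont_comp (@cont_fst _ _) (@cont_fst _ _)).
  apply: contM; first by apply: contB; [exact: cont_cst|exact: cont_snd].
  exact: (cont_comp (@cont_fst _ _) (@cont_snd _ _)).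
- exact: cont_cst.
- move=> y t t0 t1; rewrite mulr1 (slide_high _ mc1) //; last lra.
  by rewrite /Psi /=; congr (i1 (h (_, _))); lra.
- by move=> y t t0 t1; rewrite mulr0 slide_low ?(mc_end0 mc1).
- by move=> x; rewrite F0i Ei h0.
- by move=> x; rewrite F1i h1.
- by move=> y r r0 r1; rewrite F0p // Ep // subr0.
- move=> y r r0 r1; rewrite F1p // (_ : 2 - 1 = 1 :> R); last lra.
  by rewrite mul1r slide_low.
- by rewrite F0c Ec.
- by rewrite F1c.
Qed.

(** The cone of f phi is homotopy equivalent to the cone of phi when f is a homotopy
    equivalence. Up to homotopy, slides invert both composites of the maps induced by f and
    g, so that the map induced by g has inverses on both sides. *)
Lemma mcone_base_change S X (W : topologicalType) (f : X -> W) (g : W -> X) (phi : S -> X)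
   Z (i : X -> Z) (p : S * R -> Z) c
   (ZW : topologicalType) (iW : W -> ZW) (pW : S * R -> ZW) cW
   Z1 (i1 : X -> Z1) (p1 : S * R -> Z1) c1
   (ZW1 : topologicalType) (iW1 : W -> ZW1) (pW1 : S * R -> ZW1) cW1 :
  continuous f -> continuous g -> htpy R (g \o f) id -> htpy R (f \o g) id -> continuous phi ->
  @mcone R S X Z phi i p c -> mcone (f \o phi) iW pW cW ->
  mcone (g \o (f \o phi)) i1 p1 c1 -> mcone (f \o (g \o (f \o phi))) iW1 pW1 cW1 ->
  hequiv R ZW Z.
Proof.
move=> cf cg [h [ch h0 h1]] [k [ck k0 k1]] cphi mc mcW mc1 mcW1.
have [F1 HF1] := exists_push mc mcW cf.
have [G HG] := exists_push mcW mc1 cg.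
have [F2 HF2] := exists_push mc1 mcW1 cf.
have cfphi : continuous (f \o phi) by exact: cont_comp.
have [E [E' [HE HE' E'E EE']]] := slide_hequiv mc1 mc
  (cont_comp (cont_pair (cont_comp (@cont_fst _ _) cphi) (@cont_snd _ _)) ch)
  (fun y => h0 _) (fun y => h1 _).
have [E2 [_ [HE2 _ _ _]]] := slide_hequiv mcW1 mcW
  (cont_comp (cont_pair (cont_comp (@cont_fst _ _) cfphi) (@cont_snd _ _)) ck)
  (fun y => k0 _) (fun y => k1 _).
have [cE _ _ _] := HE; have [cE' _ _ _] := HE'; have [cE2 _ _ _] := HE2.
have [cF1 F1i F1p F1c] := HF1; have [cG Gi Gp Gc] := HG; have [cF2 F2i F2p F2c] := HF2.
have push_id : is_push id i p c i p c id by split=> //; exact: cont_id.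
have push_idW : is_push id iW pW cW iW pW cW id by split=> //; exact: cont_id.
have push_GF : is_push (g \o f) i p c i1 p1 c1 (G \o F1).
  split=> [|x|y r r0 r1|] /=; first exact: cont_comp.
  - by rewrite F1i Gi.
  - by rewrite F1p ?Gp.
  - by rewrite F1c.
have push_FG : is_push (f \o g) iW pW cW iW1 pW1 cW1 (F2 \o G).
  split=> [|x|y r r0 r1|] /=; first exact: cont_comp.
  - by rewrite Gi F2i.
  - by rewrite Gp ?F2p.
  - by rewrite Gc.
(* g is a homotopy inverse of f only up to a loop at the base point, so the map G
   induced by g gets a left and a right homotopy inverse, not a common one. *)
have EGF := push_htpy mc mc1 mc ch h0 h1 push_GF push_id HE cphi.
have EFG := push_htpy mcW mcW1 mcW ck k0 k1 push_FG push_idW HE2 cfphi.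
apply: (@hequiv_trans _ Z1); last exact: (hequivI cE cE').
apply: (@hequivLR _ _ _ G (E2 \o F2) (F1 \o E)) => //; [exact: cont_comp|exact: cont_comp|].
have cGFE : continuous (G \o (F1 \o E)) by do 2! apply: cont_comp => //.
apply: (htpy_trans (g := (E' \o E) \o (G \o (F1 \o E)))).
  exact/htpy_sym/(htpy_comp cGFE (@cont_id _) (htpy_refl R cGFE) E'E).
apply: htpy_trans E'E.
apply: (@htpy_comp R _ _ _ (E \o (G \o (F1 \o E))) E E' E') => //; last exact: htpy_refl.
  by apply: cont_comp.
exact: (@htpy_comp R _ _ _ E E (E \o (G \o F1)) id cE (@cont_id _) (htpy_refl R cE) EGF).
Qed.

End cone_maps.

(** * Geometric realizations *)

Section subtypes.
Implicit Types X Y : topologicalType.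

Lemma cont_val X (A : set X) : continuous (set_val : A -> X).
Proof. exact: initial_continuous. Qed.

Lemma cont_sub X Y (A : set X) (f : Y -> A) :
  continuous (fun y => set_val (f y)) -> continuous f.
Proof. exact: (@continuous_comp_initial (A : Type) Y X set_val f). Qed.

Lemma inj_hausdorff X Y (f : X -> Y) :
  continuous f -> injective f -> hausdorff_space Y -> hausdorff_space X.
Proof.
move=> cf finj hY x y cl; apply: finj; apply: hY => U V nU nV.
have [z [Uz Vz]] := cl _ _ (cf _ _ nU) (cf _ _ nV).
by exists (f z).
Qed.

Lemma hausdorff_set_type X (A : set X) : hausdorff_space X -> hausdorff_space A.
Proof. by apply: inj_hausdorff; [exact: cont_val|exact: val_inj]. Qed.

Lemma compact_set_type X (A : set X) : compact A -> compact [set: A].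
Proof.
move=> cA F PF _.
have [p [Ap clp]] : A `&` cluster (set_val @ F) !=set0.
  apply: cA; rewrite /= nbhs_simpl /=.
  have -> : set_val @^-1` A = [set: A] by apply/seteqP; split=> // x _; exact: set_valP.
  exact: filterT.
exists (@exist _ _ p (mem_set Ap)); split=> // B C FB [_ [[W oW <-] /= Wp] WC].
have [|z [[b Bb <-] Wz]] := clp (set_val @` B) W _ (open_nbhs_nbhs (conj oW Wp)).
  rewrite /= nbhs_simpl /=.
  by apply: (@filterS _ F _ B) FB => x Bx /=; exists x.
by exists b; split=> //; exact: WC.
Qed.

Lemma cont_ptws X (I : eqType) (T : I -> topologicalType) (f : X -> prod_topology T) :
  (forall i, continuous (fun x => f x i)) -> continuous f.
Proof.
move=> cf x; apply/cvg_sup => i.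
apply: (@continuous_comp_initial _ X (T i) (fun g : prod_topology T => g i) f _ x).
exact: cf.
Qed.

Lemma cont_coord X (I : eqType) (T : I -> topologicalType) (f : X -> prod_topology T) i :
  continuous f -> continuous (fun x => f x i).
Proof.
move=> cf.
exact: (@cont_comp X (prod_topology T) (T i) f (fun g => g i) cf (@proj_continuous I T i)).
Qed.

End subtypes.

Section realizations.
Variables (R : realType) (V : finType).
Implicit Types (K L : {set {set V}}) (X : topologicalType).
Local Notation rz := (realization R).

(** Barycentric coordinates. *)
Definition co K (x : rz K) (v : V) : R := set_val x v.
Definition supp (x : V -> R) : {set V} := [set v | x v != 0]%SET.

Lemma co_ge0 K (x : rz K) v : 0 <= co x v.
Proof. by have [h _ _] := set_valP x; exact: h. Qed.

Lemma co_sum K (x : rz K) : \sum_v co x v = 1.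
Proof. by have [_ h _] := set_valP x. Qed.

Lemma co_supp K (x : rz K) : supp (co x) \in K.
Proof. by have [_ _ h] := set_valP x. Qed.

Lemma co_le1 K (x : rz K) v : co x v <= 1.
Proof.
rewrite -(co_sum x) (bigD1 v) //= lerDl; apply: sumr_ge0 => w _; exact: co_ge0.
Qed.

Lemma co_inj K (x y : rz K) : co x =1 co y -> x = y.
Proof. by move=> xy; apply/val_inj/funext. Qed.

Definition bary K (x : V -> R) := [/\ forall v, 0 <= x v, \sum_v x v = 1 & supp x \in K].

Definition mkpt K (x : V -> R) (Kx : bary K x) : rz K := exist _ (x : {ptws V -> R}) (mem_set Kx).

Lemma co_mkpt K x (Kx : bary K x) v : co (mkpt Kx) v = x v.
Proof. by []. Qed.

Lemma cont_co X K (f : X -> rz K) v : continuous f -> continuous (fun x => co (f x) v).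
Proof.
move=> cf; apply: (@cont_coord X V (fun=> R) (fun x => set_val (f x))).
exact: (cont_comp cf (@cont_val _ _)).
Qed.

Lemma cont_real X K (f : X -> rz K) :
  (forall v, continuous (fun x => co (f x) v)) -> continuous f.
Proof.
move=> cf; apply: cont_sub; apply: (@cont_ptws X V (fun=> R)) => v; exact: cf.
Qed.

Lemma hausdorff_real K : hausdorff_space (rz K).
Proof.
apply: hausdorff_set_type; apply: (@hausdorff_product V (fun=> R)) => v.
exact: Rhausdorff.
Qed.

Definition dclosed K := forall S T : {set V}, S \in K -> T \subset S -> T \in K.

Lemma compact_real K : dclosed K -> compact [set: (rz K)].
Proof.
move=> dK; apply: compact_set_type.
pose B : set {ptws V -> R} := [set x | forall v, `[0, 1]%classic (x v)].
have cB : compact B.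
  apply: (@tychonoff V (fun=> R) (fun=> `[0, 1]%classic)) => v; exact: segment_compact.
apply: (subclosed_compact _ cB); last first.
  move=> x [x0 x1 xK] v /=; rewrite in_itv /= x0 -x1 (bigD1 v) //= lerDl.
  by apply: sumr_ge0 => w _; exact: x0.
have cp v : continuous (fun x : {ptws V -> R} => x v) by exact: (@proj_continuous V (fun=> R) v).
have cl0 v : closed [set x : {ptws V -> R} | 0 <= x v].
  exact: ((continuous_closedP _).1 (cp v) [set x | x >= 0] (@closed_ge R 0)).
have cl1 : closed [set x : {ptws V -> R} | \sum_v x v = 1].
  have cs : continuous (fun x : {ptws V -> R} => \sum_v x v) by apply: cont_sum => v _; exact: cp.
  exact: ((continuous_closedP _).1 cs [set x | x = 1] (@closed_eq R 1)).
(* The support of x is in K exactly when, for each S outside K, some coordinate of x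
   indexed by S vanishes, a closed condition. *)
have clS (S : {set V}) : closed [set x : {ptws V -> R} | \prod_(v in S) x v = 0].
  suff cs : continuous (fun x : {ptws V -> R} => \prod_(v in S) x v).
    exact: ((continuous_closedP _).1 cs [set x | x = 0] (@closed_eq R 0)).
  rewrite unlock; elim: (index_enum V) => [|v s IH] /=; first exact: cont_cst.
  by case: (v \in S) => //; apply: contM.
suff -> : [set x : {ptws V -> R} |
      [/\ forall v, 0 <= x v, \sum_v x v = 1 & [set v | x v != 0]%SET \in K]] =
    (\bigcap_(v in [set: V]) [set x : {ptws V -> R} | 0 <= x v]) `&`
    ([set x : {ptws V -> R} | \sum_v x v = 1] `&`
    \bigcap_(S in [set S : {set V} | S \notin K]) [set x : {ptws V -> R} | \prod_(v in S) x v = 0]).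
  apply: closedI; last apply: closedI => //; exact: closed_bigI.
apply/seteqP; split=> x.
  move=> [x0 x1 xK]; split; first by move=> v _; exact: x0.
  split=> // S /= /negP SK; apply/eqP/prodf_eq0; apply: contrapT => SS; apply: SK.
  apply: dK xK _; apply/fintype.subsetP => v vS; rewrite inE.
  by apply/negP => xv; apply: SS; exists v.
move=> [x0 [x1 xK]]; split=> //; first by move=> v; exact: x0.
apply/negPn/negP => NK; have /eqP/prodf_eq0[v] := xK _ NK.
by rewrite inE => /negP.
Qed.

End realizations.

Local Close Scope classical_set_scope.
Local Open Scope set_scope.

(** * Simplicial moves and their effect on realizations *)

Section complexes.
Variable V : finType.
Implicit Types (K L M : {set {set V}}) (S T : {set V}) (u v : V).

Definition link K S := [set T : {set V} | [disjoint S & T] && (S :|: T \in K)].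
Definition del K S := [set T in K | ~~ (S \subset T)].
(** The boundary of the closed star of [S]; it is the join of the boundary of [S] with the
    link of [S]. *)
Definition star_bd K S := [set T : {set V} | (S :|: T \in K) && ~~ (S \subset T)].
Definition cone_at u L := finset.set0 \in L /\ forall S, S \in L -> u |: S \in L.
(** The link of [S] is a cone with apex [u], stated without links. *)
Definition star_apex K S u := u \notin S /\ forall T, T \in K -> S \subset T -> u |: T \in K.

(** Removing the open star of a simplex whose link is a cone amounts to a sequence of
    elementary collapses. *)
Inductive reduces : {set {set V}} -> {set {set V}} -> Prop :=
| reduces_refl K : reduces K K
| reduces_step K L S u : S != finset.set0 -> S \in K -> star_apex K S u ->
    reduces (del K S) L -> reduces K L.

Definition collapsible K := exists L u, reduces K L /\ cone_at u L.

Lemma dclosed_del K S : dclosed K -> dclosed (del K S).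
Proof.
move=> dK T T'; rewrite !inE => /andP[TK ST] T'T; rewrite (dK _ _ TK T'T) /=.
by apply: contra ST => /fintype.subset_trans; apply.
Qed.

Lemma del_sub K S : del K S \subset K.
Proof. by apply/fintype.subsetP => T; rewrite inE => /andP[]. Qed.

Lemma reduces_dclosed K L : reduces K L -> dclosed K -> dclosed L.
Proof. by elim=> // {}K {}L S u S0 SK KS _ IH dK; apply/IH/dclosed_del. Qed.

Lemma reduces_sub K L : reduces K L -> L \subset K.
Proof.
elim=> // {}K {}L S u S0 SK KS _ IH; exact: fintype.subset_trans IH (del_sub _ _).
Qed.

Lemma reduces_trans K L M : reduces K L -> reduces L M -> reduces K M.
Proof. by elim=> // {}K {}L S u S0 SK KS _ IH /IH; exact: reduces_step SK KS. Qed.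

End complexes.

Section moves.
Variables (R : realType) (V : finType).
Implicit Types (K L M A B : {set {set V}}) (S T : {set V}) (u v : V) (t : R).
Local Notation rz := (realization R).

Lemma bary_sub K L x : K \subset L -> @bary R V K x -> bary L x.
Proof. by move=> /fintype.subsetP KL [x0 x1 xK]; split=> //; exact: KL. Qed.

Lemma co_bary K (x : rz K) : bary K (co x).
Proof. by split; [exact: co_ge0|exact: co_sum|exact: co_supp]. Qed.

Definition rincl K L (KL : K \subset L) (x : rz K) : rz L := mkpt (bary_sub KL (co_bary x)).

Lemma cont_rincl K L (KL : K \subset L) : continuous (rincl KL).
Proof. by apply: cont_real => v; exact: (@cont_co R V (rz K) K id v (@cont_id _)). Qed.

Lemma cont_mk (X : topologicalType) K (f : X -> V -> R) (Kf : forall x, bary K (f x)) :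
  (forall v, continuous (fun x => f x v)) -> continuous (fun x => mkpt (Kf x)).
Proof. by move=> cf; apply: cont_real => v; exact: cf. Qed.

Definition deforms K L := exists H : rz K * R -> rz K,
  [/\ continuous H, forall x, H (x, 0) = x & forall x, supp (co (H (x, 1))) \in L].

Lemma min_le1 (x : V -> R) S v : v \in S -> \big[Num.min/1]_(v in S) x v <= x v.
Proof. by move=> vS; rewrite (bigD1 v) //= ge_min lexx. Qed.

Lemma min_ge0 (x : V -> R) S : (forall v, 0 <= x v) -> 0 <= \big[Num.min/1]_(v in S) x v.
Proof. by move=> x0; elim/big_rec: _ => // v m vS m0; rewrite le_min x0 m0. Qed.

Lemma min_att (x : V -> R) S : S != finset.set0 -> (forall v, x v <= 1) ->
  exists2 v, v \in S & \big[Num.min/1]_(v in S) x v = x v.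
Proof.
move=> /set0Pn[v vS] x1.
pose w := [arg min_(i < v in S) x i]%O.
have [wS wmin] : w \in S /\ forall i, i \in S -> x w <= x i.
  by rewrite /w; case: arg_minP.
exists w => //; apply/le_anti; rewrite min_le1 //=.
by elim/big_rec: _ => [|i m iS im]; [exact: x1|rewrite le_min wmin].
Qed.

(** The point with coordinates [x], moved towards [u] by taking [t] times the smallest of
    its coordinates on [S] away from each vertex of [S]. At t = 1 one of these coordinates
    vanishes, and a point outside the open star of [S] does not move. *)
Definition push S u t (x : V -> R) (v : V) : R :=
  x v + t * \big[Num.min/1]_(i in S) x i * ((v == u)%:R * #|S|%:R - (v \in S)%:R).

Lemma push_id S u t x : \big[Num.min/1]_(i in S) x i = 0 -> push S u t x =1 x.
Proof. by move=> m0 v; rewrite /push m0 mulr0 mul0r addr0. Qed.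

(** A point that moves has all of [S] in its support, so that adding [u] to the support stays
    within [K]. *)
Lemma push_bary K S u t x : dclosed K -> star_apex K S u -> 0 <= t -> t <= 1 ->
  bary K x -> bary K (push S u t x).
Proof.
move=> dK [uS KS] t0 t1 [x0 x1 xK].
have m0 := min_ge0 S x0.
have [m1|mN0] := eqVneq (\big[Num.min/1]_(i in S) x i) 0.
  by rewrite (_ : push S u t x = x) //; apply/funext/push_id.
split=> [v||].
- rewrite /push; have [->|vu] := eqVneq v u.
    rewrite (negPf uS) mul1r subr0; apply: addr_ge0 => //.
    by do ! apply: mulr_ge0 => //; exact: ler0n.
  rewrite mul0r sub0r; case: (boolP (v \in S)) => [vS|_]; last by rewrite oppr0 mulr0 addr0.
  rewrite mulrN1 subr_ge0; apply: le_trans (min_le1 x vS).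
  by rewrite ler_piMl.
- rewrite /push big_split /= x1 -mulr_sumr (_ : \sum_v _ = 0) ?mulr0 ?addr0 //.
  rewrite sumrB -mulr_suml (bigD1 u) //= eqxx big1 ?addr0 ?mul1r; last first.
    by move=> v /negPf ->.
  suff -> : \sum_v (v \in S)%:R = #|S|%:R :> R by rewrite subrr.
  rewrite -sum1_card natr_sum [RHS]big_mkcond; apply: eq_bigr => v _.
  by case: (v \in S).
- have SX : S \subset supp x.
    apply/fintype.subsetP => v vS; rewrite inE; apply: contra mN0 => /eqP xv.
    by apply/eqP/le_anti; rewrite m0 andbT -xv min_le1.
  apply: dK (KS _ xK SX) _; apply/fintype.subsetP => v; rewrite !inE.
  apply: contraR; rewrite negb_or negbK => /andP[/negPf vu /eqP xv].
  rewrite /push vu xv mul0r sub0r add0r; case: (boolP (v \in S)) => vS; last by rewrite oppr0 mulr0.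
  by have := fintype.subsetP SX v vS; rewrite inE xv eqxx.
Qed.

Lemma cont_push S u (X : topologicalType) (x : X -> V -> R) (t : X -> R) v :
  continuous t -> (forall v, continuous (fun z => x z v)) ->
  continuous (fun z => push S u (t z) (x z) v).
Proof.
move=> ct cx; apply: contD => //; apply: contM; last exact: cont_cst.
by apply: contM => //; exact: cont_bigmin.
Qed.

Lemma star_apex_deformation K S u : dclosed K -> S != finset.set0 -> star_apex K S u ->
  exists H : rz K * R -> rz K,
  [/\ continuous H, forall x, H (x, 0) = x, forall x, supp (co (H (x, 1))) \in del K S &
   forall x t, supp (co x) \in del K S -> H (x, t) = x].
Proof.
move=> dK S0 KS.
exists (fun w => mkpt (push_bary dK KS (clamp_ge0 w.2) (clamp_le1 w.2) (co_bary w.1))).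
split.
- apply: cont_mk => v; apply: cont_push.
    by apply: cont_comp (@cont_clamp R); exact: cont_snd.
  by move=> i; apply: cont_co; exact: cont_fst.
- move=> x; apply: co_inj => v; rewrite co_mkpt /= clamp0 /push.
  by rewrite !mul0r addr0.
- move=> x; rewrite inE co_supp /=.
  have [v vS mv] := min_att S0 (@co_le1 _ _ _ x).
  apply/fintype.subsetPn; exists v => //; rewrite inE negbK co_mkpt /= clamp1 /push mv vS.
  have -> : (v == u) = false by apply: contraNF KS.1 => /eqP <-.
  by rewrite mul0r sub0r mul1r mulrN1 subrr.
- move=> x t; rewrite inE => /andP[_ /fintype.subsetPn[v vS]].
  rewrite inE negbK => /eqP xv; apply: co_inj => i; rewrite co_mkpt /= push_id //.
  apply/le_anti; rewrite min_ge0; last by move=> ?; exact: co_ge0.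
  by rewrite andbT -xv min_le1.
Qed.

Lemma hequiv_del K S u : dclosed K -> S != finset.set0 -> star_apex K S u ->
  hequiv R (rz K) (rz (del K S)).
Proof.
move=> dK S0 KS; have [H [cH H0 H1 Hdel]] := star_apex_deformation dK S0 KS.
have rb x : bary (del K S) (co (H (x, 1))).
  by split; [exact: co_ge0|exact: co_sum|exact: H1].
pose r x := mkpt (rb x).
have cH1 : continuous (fun x => H (x, 1)).
  by apply: cont_comp cH; apply: cont_pair; [exact: cont_id|exact: cont_cst].
have cr : continuous r by apply: cont_mk => v; exact: cont_co.
have ci := @cont_rincl _ _ (del_sub K S).
apply: (hequivI cr ci).
  apply: htpy_sym; exists H; split=> // x.
  by apply: co_inj => v; rewrite !co_mkpt.
apply: (@htpy_eq _ _ _ id id) => //; last by apply: htpy_refl; exact: cont_id.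
move=> x /=; apply: co_inj => v; rewrite co_mkpt Hdel ?co_mkpt //.
exact: co_supp.
Qed.

(** The inclusion of [A] into [B] is homotopic to a constant map. *)
Definition null A B := exists (b : rz B) (H : rz A * R -> rz B),
  [/\ continuous H, forall x v, co (H (x, 0)) v = co x v & forall x, H (x, 1) = b].

Lemma null_sub A A' B B' : A' \subset A -> B \subset B' -> null A B -> null A' B'.
Proof.
move=> A'A BB' [b [H [cH H0 H1]]]; exists (rincl BB' b).
exists (fun w => rincl BB' (H (rincl A'A w.1, w.2))); split=> [|x v|x] /=.
- apply: cont_comp (@cont_rincl _ _ BB'); apply: cont_comp cH.
  apply: cont_pair; last exact: cont_snd.
  by apply: cont_comp (@cont_rincl _ _ A'A); exact: cont_fst.
- by rewrite co_mkpt H0.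
- by rewrite H1.
Qed.

Lemma null_deforms M N B : M \subset B -> deforms M N -> null N B -> null M B.
Proof.
move=> MB [D [cD D0 D1]] [b [H [cH H0 H1]]].
have rb x : bary N (co (D (x, 1))).
  by split; [exact: co_ge0|exact: co_sum|exact: D1].
have cD1 : continuous (fun x => D (x, 1)).
  by apply: cont_comp cD; apply: cont_pair; [exact: cont_id|exact: cont_cst].
have [G [cG G0 G1]] : htpy R (rincl MB) (fun=> b).
  apply: (@htpy_trans R _ _ (fun x => rincl MB (D (x, 1)))).
    exists (fun w => rincl MB (D w)); split=> [|x|x] //=; last by rewrite D0.
    exact: cont_comp (@cont_rincl _ _ MB).
  exists (fun w => H (mkpt (rb w.1), w.2)); split=> [|x|x] //=.
  - apply: cont_comp cH; apply: cont_pair; last exact: cont_snd.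
    by apply: cont_mk => v; apply: cont_co; apply: cont_comp cD1; exact: cont_fst.
  - by apply: co_inj => v; rewrite H0 !co_mkpt.
by exists b, G; split=> // x v; rewrite G0 co_mkpt.
Qed.

Lemma reduces_deforms K L : reduces K L -> dclosed K -> deforms K L.
Proof.
elim=> {K L} [K dK|K L S u S0 SK KS RL IH dK].
  exists fst; split=> //; first exact: cont_fst.
  by move=> x; exact: co_supp.
have [H [cH H0 H1 _]] := star_apex_deformation dK S0 KS.
have [D [cD D0 D1]] := IH (dclosed_del dK).
have rb x : bary (del K S) (co (H (x, 1))).
  by split; [exact: co_ge0|exact: co_sum|exact: H1].
have cH1 : continuous (fun x => H (x, 1)).
  by apply: cont_comp cH; apply: cont_pair; [exact: cont_id|exact: cont_cst].
have cr : continuous (fun x => mkpt (rb x)) by apply: cont_mk => v; exact: cont_co.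
have [G [cG G0 G1]] : htpy R id (fun x => rincl (del_sub K S) (D (mkpt (rb x), 1))).
  apply: (@htpy_trans R _ _ (fun x => H (x, 1))); first by exists H.
  exists (fun w => rincl (del_sub K S) (D (mkpt (rb w.1), w.2))); split=> [|x|x] //.
  - apply: cont_comp (@cont_rincl _ _ _); apply: cont_comp cD.
    by apply: cont_pair; [apply: cont_comp cr; exact: cont_fst|exact: cont_snd].
  - by apply: co_inj => v; rewrite D0 !co_mkpt.
exists G; split=> // x; rewrite G1; exact: D1.
Qed.

Lemma delta_bary L u : [set u] \in L -> @bary R V L (fun v => (v == u)%:R).
Proof.
move=> uL; split=> [v||]; first exact: ler0n.
  by rewrite (bigD1 u) //= eqxx big1 ?addr0 // => v /negPf ->.
suff -> : supp (fun v : V => (v == u)%:R : R) = [set u] by [].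
by apply/finset.setP => v; rewrite !inE; case: (v == u); rewrite /= ?oner_eq0 ?eqxx.
Qed.

Lemma line_bary L u t x : dclosed L -> cone_at u L -> 0 <= t -> t <= 1 -> bary L x ->
  @bary R V L (fun v => (1 - t) * x v + t * (v == u)%:R).
Proof.
move=> dL [L0 Lu] t0 t1 [x0 x1 xL]; have t1' : 0 <= 1 - t by rewrite subr_ge0.
split=> [v||].
- by apply: addr_ge0; apply: mulr_ge0 => //; exact: ler0n.
- rewrite big_split /= -!mulr_sumr x1 (bigD1 u) //= eqxx big1 ?addr0; last by move=> v /negPf ->.
  by rewrite mulr1 mulr1 subrK.
- apply: dL (Lu _ xL) _; apply/fintype.subsetP => v; rewrite !inE.
  apply: contraR; rewrite negb_or negbK => /andP[/negPf -> /eqP ->].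
  by rewrite !mulr0 addr0.
Qed.

Lemma cone_vertex u L : cone_at u L -> [set u] \in L.
Proof. by case=> L0 /(_ _ L0); rewrite finset.setU0. Qed.

Lemma cone_null u L : dclosed L -> cone_at u L -> null L L.
Proof.
move=> dL Lu; exists (mkpt (delta_bary (cone_vertex Lu))).
exists (fun w => mkpt (line_bary dL Lu (clamp_ge0 w.2) (clamp_le1 w.2) (co_bary w.1))).
split=> [|x v|x].
- apply: cont_mk => v; have cc : continuous (fun w : rz L * R => clamp w.2).
    by apply: cont_comp (@cont_clamp R); exact: cont_snd.
  apply: contD; last by apply: contM => //; exact: cont_cst.
  apply: contM; first by apply: contB => //; exact: cont_cst.
  by apply: cont_co; exact: cont_fst.
- by rewrite co_mkpt /= clamp0; ring.
- by apply: co_inj => v; rewrite !co_mkpt /= clamp1; ring.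
Qed.

Lemma collapsible_null K : dclosed K -> collapsible K -> null K K.
Proof.
move=> dK [L [u [KL Lu]]].
apply: (null_deforms _ (reduces_deforms KL dK)) => //.
apply: null_sub (cone_null (reduces_dclosed KL dK) Lu) => //.
exact: reduces_sub.
Qed.

Lemma hequiv_cone u L : dclosed L -> cone_at u L -> hequiv R (rz L) 'rV[R]_0.
Proof.
move=> dL Lu; have [b [H [cH H0 H1]]] := cone_null dL Lu.
apply: (@hequivI R (rz L) 'rV[R]_0 (fun=> 0) (fun=> b)); [exact: cont_cst|exact: cont_cst| |].
  apply: htpy_sym; exists H; split=> // x.
  by apply: co_inj => v; rewrite H0.
apply: (@htpy_eq _ _ _ id id) => //; last by apply: htpy_refl; exact: cont_id.
by move=> x /=; rewrite [x]thinmx0.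
Qed.

End moves.

(** * Wedges as mapping cones of constant maps *)

Section wedges.
Variable R : realType.
Implicit Types (X Y S : topologicalType).

Lemma wedge_ptE X Y (x : X) (y : Y) :
  wedge_lift (two_points x y) (i := true) x = wedge_lift (two_points x y) (i := false) y.
Proof. exact: (@wedge_liftE _ _ (two_points x y) false y true x). Qed.

Lemma wedge_projl X Y (x : X) (y : Y) : exists q : wedge (two_points x y) -> X,
  (forall a, q (wedge_lift (two_points x y) (i := true) a) = a) /\
  (forall b, q (wedge_lift (two_points x y) (i := false) b) = x).
Proof.
pose f (b : bool) : two_spaces X Y b -> X :=
  match b with true => fun a => a | false => fun=> x end.
have fE i j : f i (two_points x y i) = f j (two_points x y j) by case: i; case: j.
by exists (wedge_fun f); split=> a; rewrite (wedge_lift_funE _ fE).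
Qed.

Lemma wedge_projr X Y (x : X) (y : Y) : exists q : wedge (two_points x y) -> Y,
  (forall a, q (wedge_lift (two_points x y) (i := true) a) = y) /\
  (forall b, q (wedge_lift (two_points x y) (i := false) b) = b).
Proof.
pose f (b : bool) : two_spaces X Y b -> Y :=
  match b with true => fun=> y | false => fun a => a end.
have fE i j : f i (two_points x y i) = f j (two_points x y j) by case: i; case: j.
by exists (wedge_fun f); split=> a; rewrite (wedge_lift_funE _ fE).
Qed.

Lemma wedge_surj X Y (x : X) (y : Y) (z : wedge (two_points x y)) :
  (exists a, z = wedge_lift (two_points x y) (i := true) a) \/
  (exists b, z = wedge_lift (two_points x y) (i := false) b).
Proof.
have : (\bigcup_i (@wedge_lift _ _ (two_points x y) i) @` setT)%classic z by rewrite wedgeTE.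
by case=> -[] _ [a _ <-]; [left|right]; exists a.
Qed.

(** [Y] is the unreduced suspension of [S], with poles [n] and [s]; the polar coordinates are
    injective away from the poles. *)
Record suspends S Y (P : S * R -> Y) (n s : Y) : Prop := Suspends {
  su_cont : continuous P;
  su_1 : forall y, P (y, 1) = n;
  su_0 : forall y, P (y, 0) = s;
  su_neq : s <> n;
  su_n : forall y (r : R), 0 <= r -> r < 1 -> P (y, r) <> n;
  su_inj : forall y y' (r r' : R), 0 <= r -> r < 1 -> 0 <= r' -> r' < 1 ->
    P (y, r) = P (y', r') -> r = r' /\ (0 < r -> y = y');
  su_surj : forall z, [\/ z = n, exists y (r : R), [/\ 0 <= r, r <= 1 & z = P (y, r)] | z = s] }.

Lemma suspends_compact S Y (P : S * R -> Y) n s :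
  suspends P n s -> compact [set: S]%classic -> compact [set: Y]%classic.
Proof.
move=> su cS.
have -> : ([set: Y] = P @` ([set: S] `*` `[0%R, 1%R]) `|` [set n] `|` [set s])%classic.
  apply/seteqP; split=> // z _; have [->|[y [r [r0 r1 ->]]]|->] := su_surj su z.
  - by left; right.
  - by left; left; exists (y, r) => //; split=> //=; rewrite in_itv /= r0.
  - by right.
apply: compactU; last exact: compact_set1.
apply: compactU; last exact: compact_set1.
apply: continuous_compact; first by apply: within_cont; exact: su_cont su.
by apply: compact_setX => //; exact: segment_compact.
Qed.

Lemma two_hausdorff X Y : hausdorff_space X -> hausdorff_space Y ->
  forall b, hausdorff_space (two_spaces X Y b).
Proof. by move=> hX hY []. Qed.

(** The mapping cone of a constant map is the wedge with a suspension, the pole [n] being the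
    base point. *)
Lemma wedge_mcone X Y S (x : X) (P : S * R -> Y) n s :
  compact [set: S]%classic -> compact [set: X]%classic ->
  hausdorff_space X -> hausdorff_space Y -> suspends P n s ->
  mcone (fun _ : S => x) (wedge_lift (two_points x n) (i := true))
    (fun w => wedge_lift (two_points x n) (i := false) (P w))
    (wedge_lift (two_points x n) (i := false) s).
Proof.
move=> cS cX hX hY su.
have [ql [ql1 ql2]] := wedge_projl x n; have [qr [qr1 qr2]] := wedge_projr x n.
have injr : injective (fun b : Y => wedge_lift (two_points x n) (i := false) b).
  by move=> b b' /(congr1 qr); rewrite !qr2.
have lr a b : wedge_lift (two_points x n) (i := false) b =
    wedge_lift (two_points x n) (i := true) a -> b = n.
  by move=> /(congr1 qr); rewrite qr1 qr2.
apply: mcone_compact => //.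
- by apply: wedge_hausdorff; exact: two_hausdorff.
- exact: (@wedge_lift_continuous _ _ (two_points x n) true).
- apply: cont_comp (su_cont su) _; exact: (@wedge_lift_continuous _ _ (two_points x n) false).
- by move=> a a' /(congr1 ql); rewrite !ql1.
- by move=> y; rewrite (su_1 su) wedge_ptE.
- by move=> y; rewrite (su_0 su).
- by move=> a /lr; exact: su_neq su.
- by move=> a y r r0 r1 /lr; exact: su_n su _ _ r0 r1.
- by move=> y y' r r' r0 r1 r0' r1' /injr; exact: su_inj su _ _ _ _ r0 r1 r0' r1'.
- move=> z; have [[a ->]|[b ->]] := wedge_surj z; first by constructor 1; exists a.
  have [->|[y [r [r0 r1 ->]]]|->] := su_surj su b.
  + by constructor 1; exists x; rewrite wedge_ptE.
  + by constructor 2; exists y, r.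
  + by constructor 3.
Qed.

Lemma cont_rV X N (f : X -> 'rV[R]_N) :
  (forall i, continuous (fun x => f x ord0 i)) -> continuous f.
Proof.
move=> cf x U [B /= nB BU].
have h i : \forall y \near x, B ord0 i (f y ord0 i) by exact: (cf i x _ (nB ord0 i)).
suff : \forall y \near x, U (f y) by [].
apply: filterS (filter_forall _ h) => y By; apply: BU => i j /=.
by rewrite ord1.
Qed.

End wedges.

(** * The sphere as the suspension of the boundary of a simplex *)

Lemma sqrt_div_sqr (R : rcfType) (a b : R) : 0 <= a -> 0 < b ->
  Num.sqrt (a / b ^+ 2) = Num.sqrt a / b.
Proof.
by move=> a0 b0; rewrite sqrtrM // sqrtrV ?sqr_ge0 // sqrtr_sqr gtr0_norm.
Qed.

Section polar.
Variables (R : realType) (V : finType) (sigma : {set V}) (k : nat).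
Hypothesis sigmak : #|sigma| = k.+1.
Local Notation N := (k.+1%:R : R).

Definition bdry := [set T : {set V} | T \proper sigma].

Lemma bdry_dclosed : dclosed bdry.
Proof. by move=> S T; rewrite !inE => Ssg TS; exact: sub_proper_trans TS Ssg. Qed.

Definition vx (i : 'I_k.+1) : V := enum_val (cast_ord (esym sigmak) i).

Lemma vx_in i : vx i \in sigma. Proof. exact: enum_valP. Qed.

Lemma vx_inj : injective vx.
Proof. by move=> i j /enum_val_inj /cast_ord_inj. Qed.

Lemma vx_surj v : v \in sigma -> exists i, v = vx i.
Proof.
move=> vsg; exists (cast_ord sigmak (enum_rank_in vsg v)).
by rewrite /vx cast_ordK enum_rankK_in.
Qed.

Lemma sum_vx (f : V -> R) : (forall v, v \notin sigma -> f v = 0) ->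
  \sum_v f v = \sum_i f (vx i).
Proof.
move=> f0; rewrite (bigID (mem sigma)) /= [X in _ + X]big1 ?addr0; last by move=> v /f0.
rewrite -(big_imset f (h := vx) (A := predT)) /=; last by move=> i j _ _ /vx_inj.
apply: eq_bigl => v; apply/idP/imsetP => [/vx_surj[i ->]|[i _ ->]]; first by exists i.
exact: vx_in.
Qed.

Implicit Types (y : realization R bdry) (r : R).

Lemma bdry_out y v : v \notin sigma -> co y v = 0.
Proof.
move=> vsg; apply/eqP; apply: contraNT vsg => yv.
have := co_supp y; rewrite inE => /proper_sub /fintype.subsetP; apply.
by rewrite inE.
Qed.

Lemma bdry_zero y : exists i, co y (vx i) = 0.
Proof.
have := co_supp y; rewrite inE => /properP[_ [v vsg]].
rewrite inE negbK => /eqP yv; have [i vi] := vx_surj vsg.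
by exists i; rewrite -vi.
Qed.

Lemma bdry_sum y : \sum_i co y (vx i) = 1.
Proof. by rewrite -(co_sum y) (@sum_vx (co y)) // => v; exact: bdry_out. Qed.

Lemma N_gt0 : 0 < N. Proof. exact: ltr0Sn. Qed.
Lemma N_neq0 : N != 0. Proof. exact: lt0r_neq0 N_gt0. Qed.

Lemma sum_constI (a : R) : \sum_(i < k.+1) a = N * a.
Proof. by rewrite sumr_const card_ord mulr_natl. Qed.

(** Coordinates of the boundary point relative to the barycentre of the simplex. *)
Definition centred y i : R := co y (vx i) - N^-1.
Definition sq y : R := \sum_i centred y i ^+ 2.

Lemma sum_centred y : \sum_i centred y i = 0.
Proof. by rewrite sumrB bdry_sum sum_constI mulfV ?N_neq0 // subrr. Qed.

Lemma sq_gt0 y : 0 < sq y.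
Proof.
have [i yi] := bdry_zero y.
rewrite /sq (bigD1 i) //= ltr_wpDr //; first by apply: sumr_ge0 => j _; exact: sqr_ge0.
by rewrite exprn_even_gt0 //= /centred yi sub0r oppr_eq0 invr_eq0 N_neq0.
Qed.

Definition rN : R := Num.sqrt N.
Lemma rN_gt0 : 0 < rN. Proof. by rewrite sqrtr_gt0 N_gt0. Qed.
Lemma rN_sq : rN ^+ 2 = N. Proof. by rewrite sqr_sqrtr // ltW // N_gt0. Qed.

Lemma rN_neq0 : rN != 0. Proof. exact: lt0r_neq0 rN_gt0. Qed.

Lemma sum_aff (d : 'I_k.+1 -> R) (a b : R) : \sum_i d i = 0 ->
  \sum_i (a * d i + b) = N * b.
Proof. by move=> d0; rewrite big_split /= -mulr_sumr d0 mulr0 add0r sum_constI. Qed.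

Lemma sum_aff_sqr (d : 'I_k.+1 -> R) (a b : R) : \sum_i d i = 0 ->
  \sum_i (a * d i + b) ^+ 2 = a ^+ 2 * (\sum_i d i ^+ 2) + N * b ^+ 2.
Proof.
move=> d0.
rewrite (eq_bigr (fun i => (a ^+ 2 * d i ^+ 2 + b ^+ 2) + (2 * a * b) * d i)); last first.
  by move=> i _; ring.
by rewrite big_split /= -mulr_sumr d0 mulr0 addr0 big_split /= -mulr_sumr sum_constI.
Qed.

(** The sphere in the space of all coordinates of the simplex is the suspension of its
    equator, cut out by the hyperplane of vectors of sum 0, with poles on the diagonal. The
    direction of a boundary point seen from the barycentre lies on that equator. *)
Definition pol y r : 'rV[R]_k.+1 := \row_i
  (2 * Num.sqrt (clamp r * (1 - clamp r)) / Num.sqrt (sq y) * centred y i + (2 * clamp r - 1) / rN).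

Lemma sum_pol y r : \sum_i pol y r ord0 i = (2 * clamp r - 1) * rN.
Proof.
under eq_bigr do rewrite mxE.
rewrite sum_aff ?sum_centred // -rN_sq; field; exact: rN_neq0.
Qed.

Lemma pol_sphere y r : unit_sphere R k.+1 (pol y r).
Proof.
rewrite /unit_sphere /=; under eq_bigr do rewrite mxE.
rewrite sum_aff_sqr ?sum_centred // -/(sq y) -rN_sq !expr_div_n exprMn.
have c0 : 0 <= clamp r * (1 - clamp r) by rewrite mulr_ge0 ?clamp_ge0 // subr_ge0 clamp_le1.
rewrite (sqr_sqrtr c0) (sqr_sqrtr (ltW (sq_gt0 y))).
by field; rewrite rN_neq0 lt0r_neq0 ?sq_gt0.
Qed.

Lemma cst_sphere (b : R) : b ^+ 2 = 1 -> unit_sphere R k.+1 (\row_i (b / rN)).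
Proof.
move=> b1; rewrite /unit_sphere /=; under eq_bigr do rewrite mxE.
by rewrite sum_constI expr_div_n b1 -rN_sq; field; exact: rN_neq0.
Qed.

Definition onS (x : 'rV[R]_k.+1) (Sx : unit_sphere R k.+1 x) : sphere R k :=
  @exist _ (fun x => x \in unit_sphere R k.+1) x (mem_set Sx).
Definition npole : sphere R k := onS (cst_sphere (expr1n R 2)).
Definition spole : sphere R k := onS (cst_sphere (sqrr_sign R 1)).
Definition polS (w : realization R bdry * R) : sphere R k :=
  onS (pol_sphere w.1 w.2).

Lemma cont_polS : continuous polS.
Proof.
apply: cont_sub; apply: cont_rV => i.
under [X in continuous X]funext do rewrite /= mxE.
have cc : continuous (fun w : realization R bdry * R => clamp w.2).
  exact: cont_comp (@cont_snd _ _) (@cont_clamp R).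
have ccentred j : continuous (fun w : realization R bdry * R => centred w.1 j).
  by apply: contB; [apply: cont_co; exact: cont_fst|exact: cont_cst].
have csqrt (f : realization R bdry * R -> R) : continuous f -> continuous (fun w => Num.sqrt (f w)).
  by move=> cf; exact: cont_comp cf (@sqrt_continuous R).
have cst (a : R) : continuous (fun _ : realization R bdry * R => a) by exact: cont_cst.
apply: contD; last by apply: contM => //; apply: contB => //; apply: contM.
apply: contM => //; apply: contM.
  by apply: contM => //; apply: csqrt; apply: contM => //; exact: contB.
have cs : continuous (fun w : realization R bdry * R => Num.sqrt (sq w.1)).
  apply: csqrt; apply: cont_sum => j _; exact: contM.
move=> w; apply: (@continuousV R _ (fun w : realization R bdry * R => Num.sqrt (sq w.1))).
  by rewrite sqrtr_eq0 -ltNge sq_gt0.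
exact: cs.
Qed.

Lemma sphereP (x y : sphere R k) :
  (forall i, (set_val x : 'rV[R]_k.+1) ord0 i = (set_val y : 'rV[R]_k.+1) ord0 i) -> x = y.
Proof. by move=> xy; apply/val_inj/rowP => i; exact: xy. Qed.

Lemma pol_suspends : suspends polS npole spole.
Proof.
split.
- exact: cont_polS.
- move=> y; apply: sphereP => i /=; rewrite !mxE /= clamp1 subrr mulr0 sqrtr0 mulr0 !mul0r add0r.
  by congr (_ / _); ring.
- move=> y; apply: sphereP => i /=; rewrite !mxE /= clamp0 mul0r sqrtr0 mulr0 !mul0r add0r.
  by congr (_ / _); ring.
- move=> /(congr1 (fun x : sphere R k => (set_val x : 'rV[R]_k.+1) ord0 ord0)) /=.
  rewrite !mxE /= expr1 mulN1r mul1r; have : 0 < rN^-1 by rewrite invr_gt0 rN_gt0.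
  by move: rN^-1 => a; lra.
- move=> y r r0 r1 /(congr1 (fun x : sphere R k => \sum_i (set_val x : 'rV[R]_k.+1) ord0 i)) /=.
  rewrite sum_pol (clamp_id r0 (ltW r1)); under eq_bigr do rewrite mxE.
  rewrite sum_constI -rN_sq; have := rN_gt0; move: rN => a a0 H.
  have {}H : (2 * r - 1) * a = a by rewrite H; field; exact: lt0r_neq0.
  nra.
- move=> y y' r r' r0 r1 r0' r1' E.
  have rr : r = r'.
    move/(congr1 (fun x : sphere R k => \sum_i (set_val x : 'rV[R]_k.+1) ord0 i)) : E => /=.
    rewrite !sum_pol (clamp_id r0 (ltW r1)) (clamp_id r0' (ltW r1')) => /(mulIf rN_neq0); lra.
  split=> // rp; subst r'.
  have Ei i : centred y i / Num.sqrt (sq y) = centred y' i / Num.sqrt (sq y').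
    move/(congr1 (fun x : sphere R k => (set_val x : 'rV[R]_k.+1) ord0 i)) : E => /=.
    rewrite !mxE (clamp_id r0 (ltW r1)) => /addIr.
    rewrite -!mulrA => /mulfI; rewrite pnatr_eq0 => /(_ isT) /mulfI.
    rewrite sqrtr_eq0 -ltNge mulr_gt0 ?subr_gt0 // => /(_ isT).
    by rewrite ![_^-1 * _]mulrC.
  have key z z' : (forall i, centred z i / Num.sqrt (sq z) = centred z' i / Num.sqrt (sq z')) ->
      Num.sqrt (sq z) <= Num.sqrt (sq z').
    move=> zz; have [j zj] := bdry_zero z'.
    have s0 : 0 < Num.sqrt (sq z) by rewrite sqrtr_gt0 sq_gt0.
    have s0' : 0 < Num.sqrt (sq z') by rewrite sqrtr_gt0 sq_gt0.
    have := zz j; rewrite {2}/centred zj sub0r => zzj.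
    have : - N^-1 <= centred z j by rewrite /centred lerBrDr addNr co_ge0.
    have -> : centred z j = - (N^-1 * (Num.sqrt (sq z) / Num.sqrt (sq z'))).
      rewrite -[LHS](mulfVK (lt0r_neq0 s0)) zzj; ring.
    rewrite lerN2 ger_pMr; last by rewrite invr_gt0 N_gt0.
    by rewrite ler_pdivrMr // mul1r.
  have ss : Num.sqrt (sq y) = Num.sqrt (sq y').
    by apply/le_anti; rewrite !key // => i; rewrite Ei.
  apply: co_inj => v; have [/vx_surj[i ->]|vsg] := boolP (v \in sigma); last by rewrite !bdry_out.
  have := Ei i; rewrite ss => /mulIf; rewrite invr_eq0 sqrtr_eq0 -ltNge sq_gt0 => /(_ isT).
  by move/addIr.
- move=> z; pose c i : R := (set_val z : 'rV[R]_k.+1) ord0 i.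
  have zc : \sum_i c i ^+ 2 = 1 by exact: (set_valP z).
  (* q is the height of z along the axis of the poles, and d its horizontal component. *)
  pose q : R := (\sum_i c i) / rN.
  pose d i := c i - q / rN.
  have cd i : c i = 1 * d i + q / rN by rewrite /d mul1r subrK.
  have sd : \sum_i d i = 0.
    by rewrite sumrB sum_constI -rN_sq /q; field; exact: rN_neq0.
  have sd2 : \sum_i d i ^+ 2 = 1 - q ^+ 2.
    move: zc; under eq_bigr do rewrite cd.
    rewrite sum_aff_sqr // -rN_sq expr_div_n => <-; field; exact: rN_neq0.
  have q2 : q ^+ 2 <= 1 by rewrite -subr_ge0 -sd2; apply: sumr_ge0 => i _; exact: sqr_ge0.
  have d0P : q ^+ 2 = 1 -> forall i, d i = 0.
    move=> q1 i; apply/eqP; rewrite -sqrf_eq0; apply/eqP; move: sd2; rewrite q1 subrr => /eqP.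
    rewrite psumr_eq0; last by move=> j _; exact: sqr_ge0.
    by move=> /allP /(_ i (mem_index_enum i)) /eqP.
  have [q1|qN1] := eqVneq q 1.
    constructor 1; apply: sphereP => i /=; rewrite mxE -/(c i) cd d0P ?q1 ?expr1n //; ring.
  have [qm1|qNm1] := eqVneq q (-1).
    constructor 3; apply: sphereP => i /=; rewrite mxE -/(c i) cd d0P ?qm1 ?sqrrN ?expr1n //.
    by rewrite expr1; ring.
  constructor 2.
  have q12 : 0 < 1 - q ^+ 2.
    rewrite subr_gt0 lt_neqAle q2 andbT sqrf_eq1 negb_or qN1; exact: qNm1.
  pose w := [arg min_(i < (ord0 : 'I_k.+1)) d i]%O.
  have wmin i : d w <= d i by rewrite /w; case: arg_minP => // j _; apply.
  have mu0 : d w < 0.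
    rewrite ltNge; apply/negP => dw0.
    have : \sum_i d i ^+ 2 = 0.
      have d0 i : d i = 0.
        apply/eqP; move/eqP : sd; rewrite psumr_eq0; last by move=> j _; exact: le_trans (wmin j).
        by move=> /allP /(_ i (mem_index_enum i)).
      by rewrite big1 // => i _; rewrite d0 expr0n.
    by rewrite sd2 => q0; rewrite q0 ltxx in q12.
  pose mu := - d w; have mup : 0 < mu by rewrite oppr_gt0.
  (* The ray from the barycentre in the direction d leaves the simplex at x, where the
     smallest coordinate reaches 0. *)
  pose x i : R := N^-1 + d i / (N * mu).
  pose yv (v : V) : R := \sum_i (vx i == v)%:R * x i.
  have yvE i : yv (vx i) = x i.
    rewrite /yv (bigD1 i) //= eqxx mul1r big1 ?addr0 // => j ji.
    by rewrite (inj_eq vx_inj) (negPf ji) mul0r.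
  have yv0 v : v \notin sigma -> yv v = 0.
    move=> vsg; rewrite /yv big1 // => i _; case: eqP => [vi|_]; last by rewrite mul0r.
    by move: vsg; rewrite -vi vx_in.
  have x0 i : 0 <= x i.
    rewrite /x -(ler_pM2r (mulr_gt0 N_gt0 mup)) mul0r mulrDl mulfVK; last first.
      by rewrite mulf_neq0 ?N_neq0 // lt0r_neq0.
    by rewrite mulrA mulVf ?N_neq0 // mul1r /mu addrC subr_ge0.
  have xw : x w = 0.
    have dw : d w = - mu by rewrite opprK.
    by rewrite /x dw mulNr invfM mulrCA mulfV ?mulr1 ?subrr // lt0r_neq0.
  have sx : \sum_i x i = 1.
    rewrite big_split /= -mulr_suml sd mul0r addr0 sum_constI mulfV //; exact: N_neq0.
  have yb : bary bdry yv.
    split=> [v||].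
    - by apply: sumr_ge0 => i _; apply: mulr_ge0 => //; exact: ler0n.
    - by rewrite (sum_vx yv0) (eq_bigr x) // => i _; rewrite yvE.
    - rewrite inE properE; apply/andP; split.
        by apply/fintype.subsetP => v; rewrite inE; apply: contraR => /yv0 ->.
      by apply/fintype.subsetPn; exists (vx w); [exact: vx_in|rewrite inE yvE xw eqxx].
  exists (mkpt yb), ((1 + q) / 2).
  have qlt : -1 < q < 1.
    by apply/andP; split; move: q12; rewrite expr2; nra.
  have /andP[ql qr] := qlt.
  split; [lra|lra|].
  have cl : clamp ((1 + q) / 2) = (1 + q) / 2 by apply: clamp_id; lra.
  apply: sphereP => i; rewrite /= mxE /= cl.
  have centredE j : centred (mkpt yb) j = d j / (N * mu).
    by rewrite /centred co_mkpt yvE /x addrC addKr.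
  have sqE : sq (mkpt yb) = (1 - q ^+ 2) / (N * mu) ^+ 2.
    rewrite /sq; under eq_bigr do rewrite centredE expr_div_n.
    by rewrite -mulr_suml sd2.
  rewrite sqE centredE -/(c i) cd.
  have Nmu : 0 < N * mu by rewrite mulr_gt0 // N_gt0.
  rewrite (sqrt_div_sqr (ltW q12) Nmu).
  have -> : (1 + q) / 2 * (1 - (1 + q) / 2) = (1 - q ^+ 2) / 2 ^+ 2 by field.
  rewrite (sqrt_div_sqr (ltW q12) (ltr0Sn R 1)).
  have s0 : Num.sqrt (1 - q ^+ 2) != 0 by rewrite sqrtr_eq0 -ltNge.
  by field; rewrite rN_neq0 s0 (lt0r_neq0 mup) nat1r N_neq0.
Qed.

End polar.

(** * Attaching a facet *)

Section facet.
Variables (R : realType) (V : finType) (sigma : {set V}) (k : nat) (K : {set {set V}}).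
Hypotheses (sigmak : #|sigma| = k.+1) (dK : dclosed K) (sigmaK : sigma \in K).
Hypothesis facet : forall S, S \in K -> sigma \subset S -> S = sigma.
Local Notation N := (k.+1%:R : R).
Implicit Types (y : realization R (bdry sigma)) (r : R).

Lemma bdry_del : bdry sigma \subset del K sigma.
Proof.
apply/fintype.subsetP => S; rewrite !inE properE => /andP[Ssg ->].
by rewrite (dK sigmaK Ssg).
Qed.

(** The barycentre of [sigma]. *)
Definition bc (v : V) : R := (v \in sigma)%:R / N.

Lemma sum_bc : \sum_v bc v = 1.
Proof.
rewrite (sum_vx sigmak); last by move=> v /negPf vsg; rewrite /bc vsg mul0r.
under eq_bigr do rewrite /bc vx_in mul1r.
by rewrite sum_constI mulfV // N_neq0.
Qed.

Lemma supp_sigma (x : V -> R) : (forall v, v \notin sigma -> x v = 0) -> supp x \subset sigma.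
Proof. by move=> x0; apply/fintype.subsetP => v; rewrite inE; apply: contraR => /x0 ->. Qed.

Lemma cyl_bary y r : bary K (fun v => (1 - clamp r) * bc v + clamp r * co y v).
Proof.
have r0 := clamp_ge0 r; have r1 : 0 <= 1 - clamp r by rewrite subr_ge0 clamp_le1.
split=> [v||].
- by apply: addr_ge0; apply: mulr_ge0 => //; [rewrite mulr_ge0 ?invr_ge0 ?ler0n|exact: co_ge0].
- by rewrite big_split /= -!mulr_sumr sum_bc co_sum !mulr1 subrK.
- apply: dK sigmaK _; apply: supp_sigma => v vsg.
  by rewrite (bdry_out y vsg) /bc (negPf vsg) mul0r !mulr0 addr0.
Qed.

Definition cyl (w : realization R (bdry sigma) * R) : realization R K := mkpt (cyl_bary w.1 w.2).

Lemma bc_bary : bary K bc.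
Proof.
split=> [v||].
- by rewrite mulr_ge0 ?invr_ge0 ?ler0n.
- exact: sum_bc.
- by apply: dK sigmaK _; apply: supp_sigma => v /negPf vsg; rewrite /bc vsg mul0r.
Qed.

Lemma del_proper (x : realization R (del K sigma)) : exists2 v, v \in sigma & co x v = 0.
Proof.
have := co_supp x; rewrite inE => /andP[_ /fintype.subsetPn[v vsg]].
by rewrite inE negbK => /eqP xv; exists v.
Qed.

Lemma bc_gt0 v : v \in sigma -> 0 < bc v.
Proof. by move=> vsg; rewrite /bc vsg mul1r invr_gt0 ltr0Sn. Qed.

(** A facet is the cone over its boundary with apex its barycentre; the height of a point is
    read off its smallest coordinate. *)
Lemma facet_mcone :
  mcone (rincl bdry_del : realization R _ -> realization R _)
    (rincl (del_sub K sigma)) cyl (mkpt bc_bary).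
Proof.
apply: mcone_compact.
- exact/compact_real/bdry_dclosed.
- exact/compact_real/dclosed_del.
- exact: hausdorff_real.
- exact: cont_rincl.
- apply: cont_mk => v; have cc : continuous (fun w : realization R (bdry sigma) * R => clamp w.2).
    exact: cont_comp (@cont_snd _ _) (@cont_clamp R).
  apply: contD; apply: contM => //; last by apply: cont_co; exact: cont_fst.
  + by apply: contB => //; exact: cont_cst.
  + exact: cont_cst.
- by move=> x x' /(congr1 (@co _ _ _)) xx; apply: co_inj => v; have := congr1 (fun f => f v) xx.
- by move=> y; apply: co_inj => v; rewrite !co_mkpt /= clamp1; ring.
- by move=> y; apply: co_inj => v; rewrite !co_mkpt /= clamp0; ring.
- move=> x /(congr1 (@co _ _ _)) xx; have [v vsg xv] := del_proper x.
  have := congr1 (fun f => f v) xx; rewrite !co_mkpt xv => bv.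
  by have := bc_gt0 vsg; rewrite bv ltxx.
- move=> x y r r0 r1 /(congr1 (@co _ _ _)) xx; have [v vsg xv] := del_proper x.
  have := congr1 (fun f => f v) xx; rewrite !co_mkpt xv /= (clamp_id r0 (ltW r1)) => bv.
  have := bc_gt0 vsg; have := co_ge0 y v; nra.
- move=> y y' r r' r0 r1 r0' r1' /(congr1 (@co _ _ _)) xx.
  have E v : (1 - r) * bc v + r * co y v = (1 - r') * bc v + r' * co y' v.
    have := congr1 (fun f => f v) xx.
    by rewrite !co_mkpt /= (clamp_id r0 (ltW r1)) (clamp_id r0' (ltW r1')).
  have rr : r = r'.
    have [i yi] := bdry_zero sigmak y; have [j yj] := bdry_zero sigmak y'.
    have := E (vx sigmak i); have := E (vx sigmak j); rewrite yi yj.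
    have := bc_gt0 (vx_in sigmak i); have := bc_gt0 (vx_in sigmak j).
    have -> : bc (vx sigmak i) = bc (vx sigmak j) by rewrite /bc !vx_in.
    have := co_ge0 y (vx sigmak j); have := co_ge0 y' (vx sigmak i).
    move: (bc _) (co y _) (co y' _) => b c d; nra.
  split=> // rp; apply: co_inj => v; have := E v; rewrite -rr => /addrI /mulfI; apply.
  exact: lt0r_neq0.
- move=> z; have [zsg|zsg] := boolP (sigma \subset supp (co z)); last first.
    have zb : bary (del K sigma) (co z).
      by split; [exact: co_ge0|exact: co_sum|rewrite inE co_supp].
    by constructor 1; exists (mkpt zb); exact: co_inj.
  have zE := facet (co_supp z) zsg.
  have z0 v : v \notin sigma -> co z v = 0.
    by rewrite -zE inE negbK => /eqP.
  have sigma0 : sigma != finset.set0 by rewrite -card_gt0 sigmak.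
  have [w wsg mw] := min_att sigma0 (@co_le1 _ _ _ z).
  have wmin v : v \in sigma -> co z w <= co z v by move=> vsg; rewrite -mw min_le1.
  have w0 : 0 < co z w.
    by rewrite lt_neqAle co_ge0 eq_sym andbT; have := wsg; rewrite -{1}zE inE.
  have sz : \sum_(i < k.+1) (co z (vx sigmak i) - co z w) = 1 - N * co z w.
    by rewrite sumrB -(sum_vx sigmak z0) co_sum sum_constI.
  pose r := 1 - N * co z w.
  have r0 : 0 <= r.
    by rewrite /r -sz; apply: sumr_ge0 => i _; rewrite subr_ge0 wmin // vx_in.
  have r1 : r < 1 by rewrite /r gtrBl mulr_gt0 // ltr0Sn.
  have rbc v : v \in sigma -> (1 - r) * bc v = co z w.
    by move=> vsg; rewrite /r /bc vsg opprB addrC subrK mul1r mulrC mulKf // N_neq0.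
  have [rz|rN0] := eqVneq r 0.
    constructor 3; apply: co_inj => v; rewrite co_mkpt.
    have [vsg|vsg] := boolP (v \in sigma); last by rewrite z0 // /bc (negPf vsg) mul0r.
    have := rbc v vsg; rewrite rz subr0 mul1r => ->.
    have [i ->] := vx_surj sigmak vsg.
    apply/eqP; rewrite -subr_eq0; move/eqP : sz; rewrite -/r rz psumr_eq0.
      by move=> /allP /(_ i (mem_index_enum _)).
    by move=> j _; rewrite subr_ge0 wmin // vx_in.
  have rp : 0 < r by rewrite lt_neqAle eq_sym rN0.
  have yb : bary (bdry sigma) (fun v => (co z v - (1 - r) * bc v) / r).
    split=> [v||].
    - rewrite divr_ge0 //; have [vsg|vsg] := boolP (v \in sigma).
        by rewrite rbc // subr_ge0 wmin.
      by rewrite z0 // /bc (negPf vsg) mul0r mulr0 subr0.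
    - by rewrite -mulr_suml sumrB -mulr_sumr sum_bc co_sum mulr1 opprB addrC subrK mulfV.
    - rewrite inE properE; apply/andP; split.
        by apply: supp_sigma => v vsg; rewrite z0 // /bc (negPf vsg) mul0r mulr0 subr0 mul0r.
      apply/fintype.subsetPn; exists w => //.
      by rewrite inE rbc // subrr mul0r eqxx.
  constructor 2; exists (mkpt yb), r; split=> //; first exact: ltW.
  apply: co_inj => v; rewrite !co_mkpt /= (clamp_id r0 (ltW r1)).
  by rewrite [X in _ + X]mulrC divfK // addrC subrK.
Qed.

End facet.

Section spheres.
Variables (R : realType) (V : finType).
Implicit Types (K L : {set {set V}}) (S T : {set V}).

(** Compactness and separation of the wedge are recorded because they are what makes the next
    wedge a mapping cone. *)
Definition spherical K := exists W : topologicalType, [/\ wedge_of_spheres R W,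
  compact [set: W]%classic, hausdorff_space W & hequiv R (realization R K) W].

Lemma spherical_cone u K : dclosed K -> cone_at u K -> spherical K.
Proof.
move=> dK Ku; exists 'rV[R]_0; split; [exact: wedge_none| |exact: norm_hausdorff|].
  rewrite (_ : [set: _]%classic = [set 0]%classic); first exact: compact_set1.
  by apply/seteqP; split=> // x _ /=; rewrite [x]thinmx0.
exact: hequiv_cone dK Ku.
Qed.

Lemma spherical_empty : spherical [set finset.set0].
Proof.
have noS (x : set_type (unit_sphere R 0)) : False.
  by have := set_valP x; rewrite /unit_sphere /= big_ord0 => /eqP; rewrite eq_sym oner_eq0.
have noK (x : realization R [set (finset.set0 : {set V})]) : False.
  have := co_sum x; rewrite big1; first by move=> /eqP; rewrite eq_sym oner_eq0.
  move=> v _; apply/eqP; have := co_supp x; rewrite inE => /eqP/finset.setP/(_ v).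
  by rewrite !inE => /negbFE.
exists (set_type (unit_sphere R 0)); split; first exact: wedge_sphereN1.
- have -> : ([set: set_type (unit_sphere R 0)] = set0)%classic.
    by apply/seteqP; split=> // x _; exact: (noS x).
  exact: compact0.
- by move=> x; case: (noS x).
- apply: (@hequivI _ _ _ (fun x => False_rect _ (noK x)) (fun x => False_rect _ (noS x))).
  + by move=> x; case: (noK x).
  + by move=> x; case: (noS x).
  + exists fst; split=> [|x|//]; first exact: cont_fst.
    by case: (noK x).
  + exists fst; split=> [|x|//]; first exact: cont_fst.
    by case: (noS x).
Qed.

Lemma spherical_hequiv K L :
  hequiv R (realization R K) (realization R L) -> spherical L -> spherical K.
Proof. by move=> KL [W [wW cW hW LW]]; exists W; split=> //; exact: hequiv_trans KL LW. Qed.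

(** Attaching a facet along a null-homotopic boundary adds a sphere: the attaching map slides
    to a constant, whose cone is a wedge with a sphere, and the base is then replaced by the
    wedge that it is equivalent to. Since the base point of the wedge is arbitrary, the end
    point of the null homotopy need not be controlled. *)
Lemma spherical_attach K S : dclosed K -> S != finset.set0 -> S \in K ->
  (forall T, T \in K -> S \subset T -> T = S) ->
  null R (star_bd K S) (del K S) -> spherical (del K S) -> spherical K.
Proof.
move=> dK S0 SK facet; have [k Sk] : exists k, #|S| = k.+1.
  by move: S0; rewrite -card_gt0; case: #|S| => // k _; exists k.
have -> : star_bd K S = bdry S.
  apply/finset.setP => T; rewrite !inE properE; congr andb; apply/idP/idP => [STK|TS].
    by rewrite -(facet _ STK (finset.subsetUl _ _)) finset.subsetUr.
  by rewrite (finset.setUidPl TS).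
move=> [b [H [cH H0 H1]]] [W [wW cW hW /hequivE[f [g [cf cg gf fg]]]]].
have cS : compact [set: realization R (bdry S)]%classic by exact/compact_real/bdry_dclosed.
have cX : compact [set: realization R (del K S)]%classic by exact/compact_real/dclosed_del.
have hX := @hausdorff_real R V (del K S).
have hS : hausdorff_space (sphere R k) by apply: hausdorff_set_type; exact: norm_hausdorff.
have su := pol_suspends R Sk.
have cSp := suspends_compact su cS.
have mcK := facet_mcone R Sk dK SK facet.
pose X := realization R (del K S); pose Sg := realization R (bdry S).
have mcX (x : X) := wedge_mcone x cS cX hX hS su.
have mcW (x : W) := wedge_mcone x cS cW hW hS su.
have H0' y : H (y, 0) = rincl (bdry_del dK SK) y by apply: co_inj => v; rewrite H0.
have [E [E' [[cE _ _ _] [cE' _ _ _] EE' E'E]]] := slide_hequiv mcK (mcX b) cH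
  H0' H1.
have ZWZ := mcone_base_change cf cg gf fg (@cont_cst Sg X b) (mcX b) (mcW (f b)) (mcX (g (f b)))
  (mcW (f (g (f b)))).
exists (wedge (two_points (f b) (npole R k))); split.
- exact: wedge_attach.
- by apply: wedge_compact => [|[]//]; exact: (@finite_finset bool).
- by apply: wedge_hausdorff; exact: two_hausdorff.
- apply: (@hequiv_trans R (wedge (two_points b (npole R k)))); first exact: (hequivI cE cE').
  exact: hequiv_sym.
Qed.

End spheres.

(** * Decomposable complexes *)

Section links.
Variable V : finType.
Implicit Types (K L M C : {set {set V}}) (S T : {set V}) (u v : V).

Lemma link_set0 K S : (finset.set0 \in link K S) = (S \in K).
Proof. by rewrite inE finset.setU0 disjoint_sym finset.disjoints_subset finset.sub0set. Qed.

Lemma mem_link K S T : (T \in link K S) = [disjoint S & T] && (S :|: T \in K).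
Proof. by rewrite inE. Qed.

Lemma setUDK S T : S \subset T -> S :|: (T :\: S) = T.
Proof.
move=> ST; apply/finset.setP => x; rewrite !inE; case xS: (x \in S) => //=.
by rewrite (fintype.subsetP ST _ xS).
Qed.

Lemma setUD S T : S :|: (T :\: S) = S :|: T.
Proof. by apply/finset.setP => x; rewrite !inE; case: (x \in S). Qed.

Lemma setDUK S T : [disjoint S & T] -> (S :|: T) :\: S = T.
Proof.
move=> ST; apply/finset.setP => x; rewrite !inE; case xT: (x \in T); last by case: (x \in S).
by rewrite (disjointFl ST xT).
Qed.

Lemma link_diff K S T : T \in K -> S \subset T -> T :\: S \in link K S.
Proof.
move=> TK ST; rewrite mem_link setUDK // TK andbT.
by rewrite disjoint_sym finset.disjoints_subset finset.subsetDr.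
Qed.

Lemma disjoint_notin S T v : [disjoint S & T] -> v \in T -> v \notin S.
Proof. by move=> ST vT; rewrite (disjointFl ST vT). Qed.

Lemma star_apex_link K S T u :
  T \in link K S -> star_apex (link K S) T u -> star_apex K (S :|: T) u.
Proof.
move=> TL [uT LT]; have uL := LT _ TL (fintype.subxx _).
have uS : u \notin S.
  by move: uL; rewrite mem_link => /andP[Su _]; apply: disjoint_notin Su _; rewrite finset.setU11.
split; first by rewrite finset.in_setU negb_or uS.
move=> T' T'K; rewrite finset.subUset => /andP[ST' TT'].
have : T \subset T' :\: S.
  rewrite finset.subsetD TT' disjoint_sym.
  by move: TL; rewrite mem_link => /andP[].
move=> /(LT _ (link_diff T'K ST')); rewrite mem_link => /andP[_].
by rewrite finset.setUCA setUDK.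
Qed.

Lemma star_apex_cone K S u : cone_at u (link K S) -> star_apex K S u.
Proof.
move=> [L0 Lu]; rewrite -[S]finset.setU0; apply: star_apex_link => //.
split; first by rewrite inE.
by move=> T TL _; exact: Lu.
Qed.

Lemma link_del K S T : T \in link K S -> link (del K (S :|: T)) S = del (link K S) T.
Proof.
rewrite mem_link => /andP[ST _]; apply/finset.setP => T'; rewrite !inE -andbA.
congr [&& _, _ & ~~ _]; apply/idP/idP => [STT'|TT']; last exact: finset.setUS.
apply/fintype.subsetP => v vT; have := fintype.subsetP STT' v.
by rewrite !inE vT orbT (negPf (disjoint_notin ST vT)) => /(_ isT).
Qed.

Lemma del_del K S T : del (del K (S :|: T)) S = del K S.
Proof.
apply/finset.setP => T'; rewrite !inE -andbA; congr andb.
by rewrite finset.subUset; case: (S \subset T'); rewrite ?andbF.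
Qed.

Lemma star_bd_del K S T : star_bd (del K T) S \subset star_bd K S.
Proof. by apply/fintype.subsetP => T'; rewrite !inE => /andP[/andP[-> _] ->]. Qed.

Lemma link_link K S T : [disjoint S & T] -> link (link K S) T = link K (S :|: T).
Proof.
move=> ST; apply/finset.setP => T'; rewrite !mem_link finset.setUA andbA; congr andb.
have e (A B : {set V}) : [disjoint A & B] = (A :&: B == finset.set0) by rewrite finset.setI_eq0.
rewrite !e finset.setIUl !finset.setU_eq0 finset.setIUr finset.setU_eq0 -(e S T) ST /=.
by rewrite andbC.
Qed.

(** The complex [K] with its link at [S] cut down to [M]. *)
Definition trim K S M := [set T in K | (S \subset T) ==> (T :\: S \in M)].

(** The link of [T] in the link of [S] is the link of their union, so reductions of a link
    lift to the complex. *)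
Lemma reduces_lift K S M : S != finset.set0 -> reduces (link K S) M -> reduces K (trim K S M).
Proof.
move=> S0; move eL : (link K S) => L LM; elim: LM K eL => {L M} [L|L M T u T0 TL LT LM IH] K eL.
  suff -> : trim K S L = K by exact: reduces_refl.
  apply/finset.setP => T; rewrite inE; case TK : (T \in K) => //=.
  by apply/implyP => ST; rewrite -eL link_diff.
rewrite -eL in TL LT LM.
have STK : S :|: T \in K by move: TL; rewrite mem_link => /andP[].
apply: (reduces_step (S := S :|: T) (u := u)) => //.
- by rewrite finset.setU_eq0 (negPf S0).
- exact: star_apex_link.
have -> : trim K S M = trim (del K (S :|: T)) S M; last by apply: IH; rewrite link_del // eL.
apply/finset.setP => T'; rewrite !inE; case: (T' \in K) => //=.
rewrite finset.subUset; case ST' : (S \subset T') => //=.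
case T'M : (T' :\: S \in M); last by rewrite andbF.
have := fintype.subsetP (reduces_sub LM) _ T'M; rewrite inE => /andP[_ TT'].
rewrite andbT; apply/esym; apply: contra TT' => TT'.
rewrite finset.subsetD TT' disjoint_sym.
by move: TL; rewrite mem_link => /andP[].
Qed.

Lemma link_trim K S M : M \subset link K S -> link (trim K S M) S = M.
Proof.
move=> /fintype.subsetP MK.
apply/finset.setP => T; rewrite mem_link inE finset.subsetUl /=.
apply/idP/idP => [/andP[ST /andP[_]]|TM]; first by rewrite setDUK.
have := MK _ TM; rewrite mem_link => /andP[ST ->].
by rewrite setDUK // ST.
Qed.

Lemma del_trim K S M : del (trim K S M) S = del K S.
Proof.
by apply/finset.setP => T; rewrite !inE; case: (S \subset T); rewrite ?andbF ?andbT.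
Qed.

Lemma collapsible_del K S :
  S != finset.set0 -> S \in K -> collapsible (link K S) -> reduces K (del K S).
Proof.
move=> S0 SK [M [u [KM Mu]]]; apply: reduces_trans (reduces_lift S0 KM) _.
have SKt : S \in trim K S M.
  by rewrite inE SK fintype.subxx /= finset.setDv; case: Mu.
rewrite -(del_trim K S M).
apply: reduces_step S0 SKt _ (reduces_refl _); apply: star_apex_cone.
by rewrite link_trim ?reduces_sub //; exact: Mu.
Qed.

(** In the last clause the link of [v] is null-homotopic in the deletion of [v], because it
    lies in a collapsible complex [C] there; so [L] is equivalent to the wedge of the deletion
    with the suspension of the link. *)
Inductive decomposable : {set {set V}} -> Prop :=
| decomposable_empty : decomposable [set finset.set0]
| decomposable_cone L u : cone_at u L -> decomposable L
| decomposable_step L S u : S != finset.set0 -> S \in L -> star_apex L S u ->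
    decomposable (del L S) -> decomposable L
| decomposable_split L v C : dclosed C -> link L [set v] \subset C -> C \subset del L [set v] ->
    collapsible C -> decomposable (del L [set v]) -> decomposable (link L [set v]) ->
    decomposable L.

Lemma decomposable_reduces L M : reduces L M -> decomposable M -> decomposable L.
Proof. by elim=> // {}L {}M S u S0 SL LS _ IH /IH; exact: decomposable_step SL LS. Qed.

Lemma decomposable_set0 L : decomposable L -> finset.set0 \in L.
Proof.
elim=> {L} [|L u []|L S u _ _ _ _ |L v C _ _ _ _ _ + _ _] //.
- by rewrite finset.set11.
- by rewrite inE => /andP[].
- by rewrite inE => /andP[].
Qed.

End links.

Section attach.
Variables (R : realType) (V : finType).
Implicit Types (K L M C : {set {set V}}) (S T : {set V}) (u v : V).

Lemma spherical_del K S u : dclosed K -> S != finset.set0 -> star_apex K S u ->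
  spherical R (del K S) -> spherical R K.
Proof. by move=> dK S0 KS; apply: spherical_hequiv; exact: hequiv_del dK S0 KS. Qed.

(** To learn that a suspension of [L] is a wedge of spheres, one would need to know how
    suspensions interact with wedges and base points. Attaching the join of a simplex [S]
    with [L] along a null-homotopic join of the boundary of [S] with [L] avoids this: the
    statement passes through each clause of the definition of [decomposable], and for [L]
    reduced to the empty simplex it is the attachment of a facet. *)
Lemma spherical_attach_decomposable L K S :
  decomposable L -> dclosed K -> S != finset.set0 -> link K S = L ->
  null R (star_bd K S) (del K S) -> spherical R (del K S) -> spherical R K.
Proof.
move=> GL; elim: GL K S => {L} [|L u Lu|L T u T0 TL LT _ IH|L v C dC lC Cd CC _ IHd Gl IHl] K S
  dK S0 eL nK WK.
- have SK : S \in K by rewrite -link_set0 eL finset.set11.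
  apply: (spherical_attach dK S0 SK _ nK WK) => T TK ST; apply/eqP.
  rewrite finset.eqEsubset ST andbT -finset.setD_eq0.
  by have := link_diff TK ST; rewrite eL inE.
- by apply: spherical_del dK S0 _ WK; apply: star_apex_cone; rewrite eL; exact: Lu.
- rewrite -eL in TL LT IH *.
  have ST0 : S :|: T != finset.set0 by rewrite finset.setU_eq0 (negPf S0).
  apply: (spherical_del dK ST0 (star_apex_link TL LT)).
  apply: (IH _ S) => //.
  + exact: dclosed_del.
  + exact: link_del.
  + by rewrite del_del; apply: null_sub nK => //; exact: star_bd_del.
  + by rewrite del_del.
- have vL : [set v] \in link K S by rewrite eL -link_set0; exact: decomposable_set0 Gl.
  have Sv : [disjoint S & [set v]] by move: vL; rewrite mem_link => /andP[].
  have vS : v \notin S by apply: disjoint_notin Sv _; rewrite inE.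
  pose S' := S :|: [set v].
  have S'0 : S' != finset.set0 by rewrite finset.setU_eq0 (negPf S0).
  have S'E T : (S' \subset T) = (S \subset T) && (v \in T) by rewrite finset.subUset finset.sub1set.
  have WK1 : spherical R (del K S').
    apply: (IHd _ S) => //; [exact: dclosed_del|by rewrite link_del // eL| |by rewrite del_del].
    by rewrite del_del; apply: null_sub nK => //; exact: star_bd_del.
  apply: (IHl K S') => //; first by rewrite -link_link // eL.
  (* Inside M the part S * link(v) can be pushed off the face S, because the link of S
     in M is the collapsible complex C; what remains lies in the boundary of the star of
     S, which is null-homotopic by assumption. *)
  pose M := star_bd K S' :|: [set T : {set V} | T :\: S \in C].
  have memM T : (T \in M) = (T \in star_bd K S') || (T :\: S \in C).
    by rewrite finset.in_setU [in X in _ || X]inE.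
  have CL T : T \in C -> T \in link K S /\ v \notin T.
    by move=> /(fintype.subsetP Cd); rewrite inE finset.sub1set eL => /andP[-> ->].
  have C0 : finset.set0 \in C by apply: (fintype.subsetP lC); exact: decomposable_set0 Gl.
  have dM : dclosed M.
    move=> T T'; rewrite !memM => /orP[TB|TC] T'T; last first.
      by rewrite (dC _ _ TC) ?orbT // finset.setSD.
    move: TB; rewrite !inE => /andP[S'T nS'T]; rewrite (dK _ _ S'T) ?finset.setUS //=.
    by rewrite (contra _ nS'T) // => /fintype.subset_trans; apply.
  have lkM : link M S = C.
    apply/finset.setP => T; rewrite mem_link memM; apply/idP/idP.
      move=> /andP[ST /orP[|]]; last by rewrite setDUK.
      rewrite inE finset.setUCA => /andP[STK].
      rewrite S'E finset.subsetUl /= inE negb_or => /andP[_ vT].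
      apply: (fintype.subsetP lC); rewrite mem_link disjoints1 vT /= -eL mem_link.
      apply/andP; split.
        by rewrite -finset.setI_eq0 finset.setIUr finset.setU_eq0 !finset.setI_eq0 Sv ST.
      by apply: dK STK _; rewrite -finset.setUA finset.subsetUr.
    move=> TC; have [TL vT] := CL T TC; move: TL; rewrite mem_link => /andP[ST STK].
    by rewrite ST setDUK // TC orbT.
  have SM : S \in M by rewrite memM finset.setDv C0 orbT.
  apply: (@null_sub _ _ M _ (del K S')) => //; first exact: finset.subsetUl.
  apply: (@null_deforms R V M (del M S)).
  + apply/fintype.subsetP => T; rewrite memM => /orP[|TC].
      rewrite !inE => /andP[S'T ->]; rewrite andbT.
      by apply: dK S'T _; exact: finset.subsetUr.
    have [TL vT] := CL _ TC; move: TL; rewrite mem_link setUD => /andP[_ STK].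
    rewrite inE (dK _ _ STK) ?finset.subsetUr // S'E negb_and.
    by move: vT; rewrite inE (negPf vS) /= => ->; rewrite orbT.
  + by apply: reduces_deforms => //; apply: collapsible_del => //; rewrite lkM.
  + apply: null_sub nK.
    * apply/fintype.subsetP => T; rewrite inE memM => /andP[TM ST]; rewrite inE ST andbT.
      case/orP: TM => [|TC]; last first.
        by have [TL _] := CL _ TC; move: TL; rewrite mem_link setUD => /andP[].
      rewrite inE => /andP[S'T _]; apply: dK S'T _.
      by rewrite finset.setSU // finset.subsetUl.
    * apply/fintype.subsetP => T; rewrite !inE => /andP[-> ST].
      by rewrite S'E (negPf ST).
Qed.

Theorem spherical_decomposable L : decomposable L -> dclosed L -> spherical R L.
Proof.
elim=> {L} [|L u Lu|L T u T0 TL LT _ IH|L v C dC lC Cd CC _ IHd Gl _] dL.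
- exact: spherical_empty.
- exact: spherical_cone Lu.
- by apply: spherical_del T0 LT _ => //; apply: IH; exact: dclosed_del.
- apply: (spherical_attach_decomposable Gl dL _ (erefl _)).
  + by apply/set0Pn; exists v; rewrite inE.
  + apply: null_sub (collapsible_null R dC CC) => //; apply: fintype.subset_trans lC.
    apply/fintype.subsetP => T; rewrite !inE => /andP[-> vT].
    by rewrite andbT disjoints1; move: vT; rewrite finset.sub1set.
  + by apply: IHd; exact: dclosed_del.
Qed.

End attach.

(** * Independence complexes of graphs containing a cycle with few branching vertices *)

Section independence.
Variables (V : finType) (e : rel V).
Hypotheses (e_sym : symmetric e) (e_irr : irreflexive e).
Implicit Types (U S T : {set V}) (x y z v w : V).

Definition indep U := [set S in powerset U | S \in independence_complex e].

Lemma indepP U S : reflect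
  [/\ S \subset U & forall x y, x \in S -> y \in S -> ~~ e x y] (S \in indep U).
Proof.
rewrite !inE; apply: (iffP andP) => -[SU eS]; split=> //.
  by move=> x y xS yS; move/forall_inP : eS => /(_ x xS)/forall_inP/(_ y yS).
by apply/forall_inP => x xS; apply/forall_inP => y yS; exact: eS.
Qed.

Lemma indepT : indep [set: V] = independence_complex e.
Proof. by apply/finset.setP => S; rewrite [LHS]inE powersetE finset.subsetT. Qed.

Lemma indep_dclosed U : dclosed (indep U).
Proof.
move=> S T /indepP[SU eS] TS; apply/indepP; split; first exact: fintype.subset_trans SU.
by move=> x y xT yT; apply: eS; exact: (fintype.subsetP TS).
Qed.

Lemma indepS U U' : U \subset U' -> indep U \subset indep U'.
Proof.
move=> UU'; apply/fintype.subsetP => S /indepP[SU eS]; apply/indepP; split=> //.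
exact: fintype.subset_trans SU UU'.
Qed.

Lemma indep1 U v : v \in U -> [set v] \in indep U.
Proof.
move=> vU; apply/indepP; split; first by rewrite finset.sub1set.
by move=> x y; rewrite !inE => /eqP -> /eqP ->; rewrite e_irr.
Qed.

Lemma indep_empty : indep finset.set0 = [set finset.set0].
Proof.
apply/finset.setP => S; rewrite inE; apply/indepP/eqP => [[]|->].
  by rewrite finset.subset0 => /eqP.
by split=> // x y; rewrite inE.
Qed.

(** The vertices left once [v] is chosen in an independent set. *)
Definition away U v := [set w in U | (w != v) && ~~ e v w].

Lemma mem_away U v w : (w \in away U v) = [&& w \in U, w != v & ~~ e v w].
Proof. by rewrite inE. Qed.

Lemma away_sub U v : away U v \subset U :\ v.
Proof. by apply/fintype.subsetP => w; rewrite !inE => /and3P[-> ->]. Qed.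

Lemma del_indep U v : del (indep U) [set v] = indep (U :\ v).
Proof.
apply/finset.setP => S; rewrite inE; apply/andP/indepP => [[/indepP[SU eS] vS]|[SU eS]].
  split=> //; rewrite finset.subsetD1 SU /=.
  by move: vS; rewrite finset.sub1set.
move: SU; rewrite finset.subsetD1 => /andP[SU vS].
by split; [exact/indepP|rewrite finset.sub1set].
Qed.

Lemma link_indep U v : v \in U -> link (indep U) [set v] = indep (away U v).
Proof.
move=> vU; apply/finset.setP => S; rewrite mem_link disjoints1.
apply/andP/indepP => [[vS /indepP[SU eS]]|[SU eS]].
  split=> [|x y xS yS]; last by apply: eS; rewrite !inE ?xS ?yS orbT.
  apply/fintype.subsetP => x xS; rewrite mem_away (fintype.subsetP SU) ?inE ?xS ?orbT //=.
  rewrite eS ?inE ?eqxx ?xS ?orbT // andbT.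
  by apply: contraNneq vS => <-.
have vS : v \notin S.
  by apply/negP => /(fintype.subsetP SU); rewrite mem_away eqxx andbF.
split=> //; apply/indepP; split.
  apply/fintype.subsetP => x; rewrite !inE => /predU1P[->//|/(fintype.subsetP SU)].
  by rewrite mem_away => /andP[].
move=> x y; rewrite !inE => /predU1P[->|xS] /predU1P[->|yS].
- by rewrite e_irr.
- by have := fintype.subsetP SU _ yS; rewrite mem_away => /and3P[].
- by rewrite e_sym; have := fintype.subsetP SU _ xS; rewrite mem_away => /and3P[].
- exact: eS.
Qed.

Lemma isolated_cone U x : x \in U -> (forall z, z \in U -> ~~ e x z) -> cone_at x (indep U).
Proof.
move=> xU xz; split; first by apply/indepP; split=> [|y z]; rewrite ?finset.sub0set ?inE.
move=> S /indepP[SU eS]; apply/indepP; split.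
  by rewrite finset.subUset finset.sub1set xU.
move=> y z; rewrite !inE => /predU1P[->|yS] /predU1P[->|zS].
- by rewrite e_irr.
- by apply: xz; exact: (fintype.subsetP SU).
- by rewrite e_sym; apply: xz; exact: (fintype.subsetP SU).
- exact: eS.
Qed.

Definition dominates U x y := [/\ x \in U, y \in U, x != y, ~~ e x y &
  forall z, z \in U -> e x z -> e y z].

Lemma dominates_star U x y : dominates U x y -> star_apex (indep U) [set y] x.
Proof.
move=> [xU yU xy exy xyz]; split; first by rewrite inE.
move=> S /indepP[SU eS]; rewrite finset.sub1set => yS; apply/indepP; split.
  by rewrite finset.subUset finset.sub1set xU.
have xS z : z \in S -> ~~ e x z.
  by move=> zS; apply: contra (eS _ _ yS zS) => /xyz; apply; exact: (fintype.subsetP SU).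
move=> z t; rewrite !inE => /predU1P[->|zS] /predU1P[->|tS].
- by rewrite e_irr.
- exact: xS.
- by rewrite e_sym; exact: xS.
- exact: eS.
Qed.

Lemma set1_neq0 v : [set v] != finset.set0 :> {set V}.
Proof. by apply/set0Pn; exists v; rewrite inE. Qed.

(** A set containing [y] and independent remains so when [x] is added: the link of [y] is a
    cone with apex [x]. *)
Lemma dominates_reduces U x y : dominates U x y -> reduces (indep U) (indep (U :\ y)).
Proof.
move=> D; have [xU yU _ _ _] := D; rewrite -del_indep.
apply: (reduces_step (S := [set y]) (u := x)).
- exact: set1_neq0.
- exact: indep1.
- exact: dominates_star.
- exact: reduces_refl.
Qed.

Definition third (c : nat -> V) k := [seq c (3 * l + 2)%N | l <- iota 0 k].
Definition thin U (c : nat -> V) k := [set z in U | z \notin third c k].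

Lemma mem_thin U c k z : (z \in thin U c k) = (z \in U) && (z \notin third c k).
Proof. by rewrite inE. Qed.

Lemma third_in c k l : (l < k)%N -> c (3 * l + 2)%N \in third c k.
Proof. by move=> lk; apply/mapP; exists l => //; rewrite mem_iota. Qed.

Lemma third_notin c k z : (forall l, (l < k)%N -> z <> c (3 * l + 2)%N) -> z \notin third c k.
Proof. by move=> H; apply/mapP => -[l]; rewrite mem_iota => /H. Qed.

Lemma thirdS c k : third c k.+1 = rcons (third c k) (c (3 * k + 2)%N).
Proof. by rewrite /third -[in LHS](addn1 k) iotaD map_cat cats1. Qed.

(** A leaf dominates the vertices at distance two from it. Along a path whose interior
    vertices have no other neighbours this propagates with period three: the removal of
    c 2 makes c 3 a leaf, which removes c 5, and so on. *)
Lemma reduces_path U c k :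
  (forall l, (l < k)%N -> c (3 * l)%N \in U) ->
  (forall l l', (l < k)%N -> (l' < k)%N -> c (3 * l)%N <> c (3 * l' + 2)%N) ->
  (forall l, (l < k)%N -> ~~ e (c (3 * l)%N) (c (3 * l + 2)%N)) ->
  (forall l, (l < k)%N -> e (c (3 * l + 2)%N) (c (3 * l + 1)%N)) ->
  (forall l z, (l < k)%N -> z \in U -> e (c (3 * l)%N) z ->
     z = c (3 * l + 1)%N \/ (0 < l)%N /\ z = c (3 * l - 1)%N) ->
  reduces (indep U) (indep (thin U c k)).
Proof.
elim: k => [|k IH] cU cc ecc ec cz.
  suff -> : thin U c 0 = U by exact: reduces_refl.
  by apply/finset.setP => z; rewrite inE andbT.
apply: (reduces_trans (L := indep (thin U c k))).
  apply: IH => [l lk|l l' lk lk'|l lk|l lk|l z lk].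
  - exact/cU/ltnW.
  - by apply: cc; exact: ltnW.
  - exact/ecc/ltnW.
  - exact/ec/ltnW.
  - exact/cz/ltnW.
have thinS : thin U c k.+1 = thin U c k :\ c (3 * k + 2)%N.
  apply/finset.setP => z; rewrite in_setD1 !mem_thin thirdS mem_rcons inE negb_or.
  by case: (z \in U); rewrite ?andbF.
rewrite thinS; have [yU|yU] := boolP (c (3 * k + 2)%N \in thin U c k); last first.
  suff -> : thin U c k :\ c (3 * k + 2)%N = thin U c k by exact: reduces_refl.
  apply/finset.setP => z; rewrite in_setD1; case: eqP => //= ->.
  by rewrite (negPf yU).
apply: (dominates_reduces (x := c (3 * k)%N)); split=> //.
- rewrite mem_thin cU //=; apply: third_notin => l lk; apply: cc => //; exact: ltnW.
- by apply/eqP; exact: cc.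
- exact: ecc.
- move=> z; rewrite mem_thin => /andP[zU zt] /cz -/(_ (leqnn _) zU) [->|[k0 zE]]; first exact: ec.
  move: zt; rewrite zE (_ : (3 * k - 1 = 3 * k.-1 + 2)%N) ?third_in //; lia.
Qed.

(** Once the neighbour [z] of the leaf [x] is deleted, [x] is isolated and the deletion of [z]
    is a cone. *)
Lemma decomposable_leaf U x z :
  x \in U -> z \in U -> x != z -> (forall t, t \in U -> e x t -> t = z) ->
  decomposable (indep (U :\ z)) -> decomposable (indep (away U z)) -> decomposable (indep U).
Proof.
move=> xU zU xz xt Gd Gl; apply: (@decomposable_split _ _ z (indep (U :\ z))).
- exact: indep_dclosed.
- by rewrite link_indep // indepS // away_sub.
- by rewrite del_indep.
- exists (indep (U :\ z)), x; split; first exact: reduces_refl.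
  apply: isolated_cone; first by rewrite !inE xz.
  move=> t; rewrite !inE => /andP[tz tU]; apply: contra tz => /xt -> //.
- by rewrite del_indep.
- by rewrite link_indep.
Qed.

Section cycle.
Variables (U : {set V}) (c : nat -> V) (m : nat).
Hypotheses (m2 : (2 <= m)%N)
  (cinj : forall i j, (i <= 2 * m + 1)%N -> (j <= 2 * m + 1)%N -> c i = c j -> i = j)
  (cU : forall i, (i <= 2 * m + 1)%N -> c i \in U)
  (ce : forall i, (i <= 2 * m)%N -> e (c i) (c i.+1))
  (clast : forall z, z \in U -> e (c (2 * m + 1)%N) z -> z = c (2 * m)%N \/ z = c 0)
  (cmid : forall i z, (0 < i < 2 * m)%N -> z \in U -> e (c i) z -> z = c i.-1 \/ z = c i.+1)
  (cpar : forall i, (i.+2 <= 2 * m + 1)%N -> ~~ e (c i) (c i.+2))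
  (IH : forall U', (U' \proper U)%N -> decomposable (indep U')).

Lemma ce' i j : (i <= 2 * m)%N -> j = i.+1 -> e (c j) (c i).
Proof. by move=> i2m ->; rewrite e_sym ce. Qed.

Lemma cneq i j : (i <= 2 * m + 1)%N -> (j <= 2 * m + 1)%N -> (i != j)%N -> c i != c j.
Proof. by move=> i2 j2; apply: contra => /eqP/cinj -> //. Qed.

Lemma proper_del v : v \in U -> U :\ v \proper U.
Proof. by move=> vU; rewrite properD1. Qed.

Lemma proper_away U' v : v \in U -> U' \subset away U v -> U' \proper U.
Proof.
move=> vU U'v; apply: sub_proper_trans (proper_del vU).
exact: fintype.subset_trans (away_sub _ _).
Qed.

(** In a cycle of length 2m + 2 with no branching except at c 0 and c (2m), the vertex to
    branch on is dictated by the residue of 2m modulo 3, domination along the cycle having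
    period three. *)
Lemma decomposable_cycle : decomposable (indep U).
Proof.
have c0U : c 0 \in U by exact: cU.
have [k [mk|[mk|mk]]] : exists k, (2 * m = 3 * k \/ (2 * m = 3 * k + 1 \/ 2 * m = 3 * k + 2))%N.
  by exists (2 * m %/ 3)%N; lia.
(* Deleting c_0 makes c_1 a leaf, which removes c_3, and then c_6 up to c_2m; the
   vertex c_(2m+1) has lost both its neighbours, so the deletion is collapsible. *)
- apply: (@decomposable_split _ _ (c 0) (indep (U :\ c 0))).
  + exact: indep_dclosed.
  + by rewrite link_indep // indepS // away_sub.
  + by rewrite del_indep.
  + exists (indep (thin (U :\ c 0) (fun j => c j.+1) k)), (c (2 * m + 1)%N); split.
      apply: reduces_path => /=.
      * by move=> l lk; rewrite !inE cneq ?cU //; lia.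
      * by move=> l l' lk lk'; apply/eqP/cneq; lia.
      * move=> l lk; have := @cpar (3 * l).+1; rewrite addn2; apply; lia.
      * move=> l lk; apply: ce'; lia.
      * move=> l z lk; rewrite !inE => /andP[z0 zU] /cmid-/(_ _ zU) /= [|zE|zE]; first lia.
          right; split; last first.
            rewrite zE; congr c; move: z0; rewrite zE.
            by case: (l) => [|l']; [rewrite eqxx|lia].
          by move: z0; rewrite zE; case: (l) => //; rewrite eqxx.
        by left; rewrite zE; congr c; lia.
    apply: isolated_cone.
      rewrite mem_thin !inE cneq ?cU //=; try lia.
      apply: third_notin => l lk; apply/eqP/cneq; lia.
    move=> z; rewrite mem_thin !inE => /andP[/andP[z0 zU] zt]; apply/negP => /clast-/(_ zU) [zE|zE].
      move: zt; rewrite zE (_ : (2 * m = (3 * k.-1 + 2).+1)%N); last lia.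
      rewrite (@third_in (fun j => c j.+1)) //; lia.
    by move: z0; rewrite zE eqxx.
  + by rewrite del_indep; apply: IH; exact: proper_del.
  + by rewrite link_indep //; apply: IH; exact: (proper_away c0U (fintype.subxx _)).
(* In the link of c_0 the vertex c_2 is a leaf, which removes c_4, and then c_7 up to
   c_2m. Nothing left is adjacent to c_(2m+1), so the cone over the trimmed link with
   this apex lies in the deletion of c_0. *)
- pose c' j := c j.+2.
  pose U' := thin (away U (c 0)) c' k.
  have U's : U' \subset away U (c 0) by apply/fintype.subsetP => z; rewrite inE => /andP[].
  have R : reduces (link (indep U) [set c 0]) (indep U').
    rewrite link_indep //; apply: reduces_path => /=.
    + move=> l lk; have li : (3 * l + 2 <= 2 * m + 1)%N by lia.
      rewrite /c' -addn2 mem_away cU // (cneq li (leq0n _)) ?addn2 //=.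
      apply/negP; rewrite e_sym => /cmid-/(_ _ c0U) [|/cinj|/cinj]; lia.
    + by move=> l l' lk lk'; apply/eqP/cneq; lia.
    + move=> l lk; have := @cpar (3 * l).+2; rewrite /c' addn2; apply; lia.
    + move=> l lk; apply: ce'; lia.
    + move=> l z lk; rewrite mem_away => /and3P[zU z0 ez] /cmid-/(_ _ zU) /= [|zE|zE]; first lia.
        have l0 : (0 < l)%N.
          case: (l) zE => // zE; move: ez; rewrite zE /= ?muln0 ce //; lia.
        by right; split=> //; rewrite zE /c'; congr c; lia.
      by left; rewrite zE /c'; congr c; lia.
  apply: (decomposable_reduces (reduces_lift (set1_neq0 _) R)).
  have M : indep U' \subset link (indep U) [set c 0] by exact: reduces_sub R.
  pose w := c (2 * m + 1)%N.
  have wU : w \in U by rewrite cU.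
  have wU' : forall z, z \in U' -> ~~ e w z.
    move=> z; rewrite mem_thin mem_away => /andP[/and3P[zU z0 ez] zt].
    apply/negP => /clast-/(_ zU) [zE|zE]; last by move: z0; rewrite zE eqxx.
    move: zt; rewrite zE (_ : (2 * m = (3 * k.-1 + 2).+2)%N); last lia.
    rewrite (@third_in c') //; lia.
  apply: (@decomposable_split _ _ (c 0) (indep (w |: U'))).
  + exact: indep_dclosed.
  + by rewrite link_trim // indepS // finset.subsetUr.
  + rewrite del_trim del_indep indepS // finset.subUset finset.sub1set !inE wU andbT.
    have -> : w != c 0 by apply: cneq; lia.
    exact: fintype.subset_trans U's (away_sub _ _).
  + exists (indep (w |: U')), w; split; first exact: reduces_refl.
    apply: isolated_cone; first by rewrite finset.setU11.
    by move=> z; rewrite finset.in_setU1 => /predU1P[->|/wU' //]; rewrite e_irr.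
  + by rewrite del_trim del_indep; apply: IH; exact: proper_del.
  + by rewrite link_trim //; apply: IH; exact: (proper_away c0U U's).
(* In the link of c_4 the vertices c_2 and c_6 are leaves: the first removes c_0, the
   second removes c_8, and then c_11 up to c_2m. This isolates c_(2m+1), so the link is
   collapsible and c_4 can be deleted. *)
- have m4 : (4 <= m)%N by lia.
  have c4U : c 4 \in U by apply: cU; lia.
  have away4 i : (i <= 2 * m + 1)%N -> (i != 3)%N -> (i != 4)%N -> (i != 5)%N ->
      c i \in away U (c 4).
    move=> i2m i3 i4 i5; rewrite mem_away cU //= (_ : c i != c 4) /=; last by apply: cneq; lia.
    apply/negP => /cmid-/(_ _ (cU i2m)) [|/cinj|/cinj]; lia.
  pose c1 j := c (2 - j)%N; pose U1 := thin (away U (c 4)) c1 1.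
  pose c2 j := c (6 + j)%N; pose U2 := thin U1 c2 k.-1.
  have U1E z : z \in U1 -> [/\ z \in U, z \in away U (c 4) & z != c 0].
    rewrite mem_thin => /andP[za]; rewrite /third /= inE /c1 /= => ->.
    by move: (za); rewrite mem_away => /andP[->].
  have R1 : reduces (indep (away U (c 4))) (indep U1).
    apply: reduces_path => /= -[|//] /= => [_|[|//] _ _|_|_|z _].
    + by apply: away4; lia.
    + by apply/eqP/cneq; lia.
    + by rewrite e_sym; apply: cpar; lia.
    + by apply: ce; lia.
    + rewrite mem_away => /and3P[zU z4 ez] /cmid-/(_ _ zU) /= [|->|zE]; [lia|by left|].
      by move: ez; rewrite zE e_sym ce //; lia.
  have R2 : reduces (indep U1) (indep U2).
    apply: reduces_path => /=.
    + move=> l lk; rewrite mem_thin away4; [|lia|lia|lia|lia].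
      by rewrite /third /= inE; apply: cneq; lia.
    + by move=> l l' lk lk'; apply/eqP/cneq; lia.
    + move=> l lk; have := @cpar (6 + 3 * l)%N; rewrite /c2 addnA addn2; apply; lia.
    + by move=> l lk; apply: ce'; lia.
    + move=> l z lk /U1E[zU za z0] /cmid-/(_ _ zU) /= [|zE|zE]; first lia.
        have l0 : (0 < l)%N.
          case: (l) zE => // zE; move: za; rewrite zE mem_away /= ?muln0 ce ?andbF //; lia.
        by right; split=> //; rewrite zE /c2; congr c; lia.
      by left; rewrite zE /c2; congr c; lia.
  have C4 : collapsible (link (indep U) [set c 4]).
    rewrite link_indep //; exists (indep U2), (c (2 * m + 1)%N); split.
      exact: reduces_trans R1 R2.
    apply: isolated_cone.
      rewrite mem_thin mem_thin away4; [|lia|lia|lia|lia].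
      rewrite /third /= inE /c1 /= (_ : _ != _); last by apply: cneq; lia.
      by apply: third_notin => l lk; apply/eqP/cneq; lia.
    move=> z; rewrite mem_thin => /andP[/U1E[zU za z0] zt]; apply/negP => /clast-/(_ zU) [zE|zE].
      move: zt; rewrite zE (_ : (2 * m = 6 + (3 * k.-2 + 2))%N); last lia.
      by rewrite (@third_in c2) //; lia.
    by move: z0; rewrite zE eqxx.
  apply: (decomposable_reduces (collapsible_del (set1_neq0 _) (indep1 c4U) C4)).
  by rewrite del_indep; apply: IH; exact: proper_del.
Qed.

End cycle.
End independence.

(** * Incidence graphs of outerplanar graphs *)

Section outerplanar.
Variables (R : realType) (V : finType) (e : rel V) (P : {set V}) (pos : V -> R).
Hypotheses (e_sym : symmetric e) (e_irr : irreflexive e) (bip : bipartition e P)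
  (posinj : {in P &, injective pos})
  (deg2 : forall q a b c, a \in P -> b \in P -> c \in P -> e q a -> e q b -> e q c ->
     [\/ a = b, a = c | b = c])
  (cross : forall q q' a b c d, a \in P -> b \in P -> c \in P -> d \in P ->
     pos a < pos b -> pos b < pos c -> pos c < pos d ->
     e q a -> e q c -> e q' b -> e q' d -> False).
Implicit Types (U : {set V}) (a b k l q x y z : V).

Section core.
Variable U : {set V}.
Hypotheses (branch : forall x, x \in U -> exists z z',
     [/\ z \in U, z' \in U, z != z', e x z & e x z'])
  (nodom : forall x y, ~ dominates e U x y).

Definition PU := [set x in U | x \in P].

Lemma PU_P x : x \in PU -> x \in P. Proof. by rewrite inE => /andP[]. Qed.
Lemma PU_U x : x \in PU -> x \in U. Proof. by rewrite inE => /andP[]. Qed.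

Lemma nbrP q a : e q a -> a \in P -> q \notin P.
Proof. by move=> /bip; case: (q \in P) => //; case: (a \in P). Qed.

Lemma nbrQ q a : e q a -> q \notin P -> a \in P.
Proof. by move=> /bip; case: (q \in P) => //; case: (a \in P). Qed.

Lemma nadj x y : (x \in P) = (y \in P) -> ~~ e x y.
Proof. by move=> xy; apply/negP => /bip; rewrite xy eqxx. Qed.

(** Two vertices outside [P] with the same two neighbours would dominate each other. *)
Lemma edge_uniq q q' a b : q \in U -> q' \in U -> a \in PU -> b \in PU -> a != b ->
  e q a -> e q b -> e q' a -> e q' b -> q = q'.
Proof.
move=> qU q'U /PU_P aP /PU_P bP ab qa qb q'a q'b; apply/eqP/negPn/negP => qq'.
apply: (@nodom q q'); split=> //.
  by apply: nadj; rewrite (negPf (nbrP qa aP)) (negPf (nbrP q'a aP)).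
move=> z zU qz; have [E|<-|<-] // := deg2 aP bP (nbrQ qz (nbrP qa aP)) qa qb qz.
by rewrite E eqxx in ab.
Qed.

Lemma other_end q a : q \in U -> a \in P -> e q a -> exists b, [/\ b \in PU, b != a & e q b].
Proof.
move=> qU aP qa; have [z [z' [zU z'U zz' qz qz']]] := branch qU.
have qP := nbrP qa aP.
have [za|za] := eqVneq z a; last by exists z; rewrite inE zU (nbrQ qz qP).
by exists z'; rewrite inE z'U (nbrQ qz' qP) -za eq_sym.
Qed.

Lemma two_ends a : a \in PU -> exists q q' b b',
  [/\ q \in U, q' \in U, b \in PU & b' \in PU] /\
  [/\ e q a, e q b, e q' a, e q' b' & [/\ b != a, b' != a & b != b']].
Proof.
move=> aPU; have [q [q' [qU q'U qq' aq aq']]] := branch (PU_U aPU).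
rewrite e_sym in aq; rewrite e_sym in aq'.
have [b [bPU ba qb]] := other_end qU (PU_P aPU) aq.
have [b' [b'PU b'a q'b']] := other_end q'U (PU_P aPU) aq'.
exists q, q', b, b'; do ! split=> //.
apply: contra qq' => /eqP bb'; apply/eqP.
by apply: (@edge_uniq q q' a b) => //; rewrite ?bb' // eq_sym -bb'.
Qed.

(** The vertices in [P] are those of an outerplanar graph, the vertices outside [P] are its
    edges. *)
Definition adj a b := [exists q, [&& q \in U, e q a & e q b]].
Definition btw a b := [set k in PU | pos a < pos k < pos b].
Definition spans ab := [&& ab.1 \in PU, ab.2 \in PU, pos ab.1 < pos ab.2, adj ab.1 ab.2 &
  btw ab.1 ab.2 != finset.set0].

Lemma adjI q a b : q \in U -> e q a -> e q b -> adj a b.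
Proof. by move=> qU qa qb; apply/existsP; exists q; rewrite qU qa qb. Qed.

Lemma adjC a b : adj a b -> adj b a.
Proof. by move=> /existsP[q /and3P[qU qa qb]]; exact: adjI qU qb qa. Qed.

Lemma PU_neq a b : a \in PU -> b \in PU -> a != b -> pos a != pos b.
Proof. by move=> aPU bPU; apply: contra => /eqP/posinj -> //; exact: PU_P. Qed.

(** The first vertex has two neighbours, both after it, and its edge to the farther one passes
    over the nearer one. *)
Lemma exists_spans x : x \in U -> exists ab, spans ab.
Proof.
move=> xU.
have [k kPU] : exists k, k \in PU.
  have [xP|xP] := boolP (x \in P); first by exists x; rewrite inE xU.
  have [z [_ [zU _ _ xz _]]] := branch xU; exists z.
  by rewrite inE zU (nbrQ xz).
pose a := [arg min_(i < k in PU) pos i]%O.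
have [aPU amin] : a \in PU /\ forall i, i \in PU -> pos a <= pos i.
  by rewrite /a; case: arg_minP.
have [q [q' [b [b' [[qU q'U bPU b'PU] [qa qb q'a q'b' [ba b'a bb']]]]]]] := two_ends aPU.
have alt i : i \in PU -> i != a -> pos a < pos i.
  by move=> iPU ia; rewrite lt_neqAle amin // andbT PU_neq // eq_sym.
have [lt|lt|E] := ltgtP (pos b) (pos b').
- exists (a, b'); rewrite /spans /= aPU b'PU alt // (adjI q'U) //=.
  by apply/set0Pn; exists b; rewrite inE bPU alt.
- exists (a, b); rewrite /spans /= aPU bPU alt // (adjI qU) //=.
  by apply/set0Pn; exists b'; rewrite inE b'PU alt.
- by have := PU_neq bPU b'PU bb'; rewrite E eqxx.
Qed.

Section face.
Variables a b : V.
Hypotheses (ab : spans (a, b))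
  (abmin : forall cd, spans cd -> (#|btw a b| <= #|btw cd.1 cd.2|)%N).

Let aPU : a \in PU. Proof. by have /and5P[] := ab. Qed.
Let bPU : b \in PU. Proof. by have /and5P[] := ab. Qed.
Let altb : pos a < pos b. Proof. by have /and5P[] := ab. Qed.

Definition face_set := [set k in PU | pos a <= pos k <= pos b].
Definition face_seq := sort (fun x y => pos x <= pos y) (enum face_set).
Definition vtx i := nth a face_seq i.
Definition face_len := (size face_seq).-1.

Lemma mem_face_seq k : (k \in face_seq) = (k \in face_set).
Proof. by rewrite mem_sort mem_enum. Qed.

Lemma vtx_face i : (i < size face_seq)%N -> vtx i \in face_set.
Proof. by move=> ilt; rewrite -mem_face_seq mem_nth. Qed.

Lemma face_vtx k : k \in face_set -> exists2 i, (i < size face_seq)%N & k = vtx i.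
Proof. by rewrite -mem_face_seq => /(nthP a)[i ilt <-]; exists i. Qed.

Lemma vtx_PU i : (i < size face_seq)%N -> vtx i \in PU.
Proof. by move=> /vtx_face; rewrite inE => /andP[]. Qed.

Lemma vtx_lt i j : (i < j)%N -> (j < size face_seq)%N -> pos (vtx i) < pos (vtx j).
Proof.
move=> ij jlt; have ilt := ltn_trans ij jlt.
have st : sorted (fun x y => pos x <= pos y) face_seq.
  by apply: sort_sorted => x y; exact: le_total.
have tr : transitive (fun x y : V => pos x <= pos y) by move=> y x z; exact: le_trans.
rewrite lt_neqAle (sorted_ltn_nth tr a st i j ilt jlt ij) andbT PU_neq ?vtx_PU //.
by rewrite nth_uniq ?sort_uniq ?enum_uniq // neq_ltn ij.
Qed.

Lemma vtx_ltE i j :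
  (i < size face_seq)%N -> (j < size face_seq)%N -> pos (vtx i) < pos (vtx j) -> (i < j)%N.
Proof.
move=> ilt jlt lt; rewrite ltnNge leq_eqVlt; apply/negP => /predU1P[E|ji].
  by rewrite E ltxx in lt.
by have := lt_trans lt (vtx_lt ji ilt); rewrite ltxx.
Qed.

Lemma vtx_inj i j :
  (i < size face_seq)%N -> (j < size face_seq)%N -> vtx i = vtx j -> i = j.
Proof.
move=> ilt jlt /eqP; rewrite nth_uniq ?sort_uniq ?enum_uniq // => /eqP //.
Qed.

Lemma a_face : a \in face_set. Proof. by rewrite inE aPU lexx ltW. Qed.
Lemma b_face : b \in face_set. Proof. by rewrite inE bPU lexx ltW. Qed.

Lemma face_size : [/\ (2 <= face_len)%N, size face_seq = face_len.+1, vtx 0 = a & vtx face_len = b].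
Proof.
have [k] : exists k, k \in btw a b by apply/set0Pn; have /and5P[] := ab.
rewrite inE => /and3P[kPU ak kb].
have kr : k \in face_set by rewrite inE kPU !ltW.
have [i ilt ia] := face_vtx a_face; have [j jlt jb] := face_vtx b_face.
have [l llt lk] := face_vtx kr.
have il : (i < l)%N by apply: vtx_ltE; rewrite // -ia -lk.
have lj : (l < j)%N by apply: vtx_ltE; rewrite // -jb -lk.
have sE : size face_seq = face_len.+1 by rewrite /face_len prednK //; lia.
have r t : (t < size face_seq)%N -> pos a <= pos (vtx t) <= pos b.
  by move=> /vtx_face; rewrite inE => /andP[].
split=> //; first by lia.
- suff -> : 0%N = i by [].
  apply/esym/eqP; rewrite -leqn0 leqNgt; apply/negP => i0.
  have s0 : (0 < size face_seq)%N by lia.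
  by have := vtx_lt i0 ilt; rewrite -ia ltNge; have /andP[-> _] := r 0%N s0.
- suff -> : face_len = j by [].
  have lenlt : (face_len < size face_seq)%N by lia.
  apply/eqP; rewrite eqn_leq andbC; apply/andP; split; first lia.
  rewrite leqNgt; apply/negP => jlen.
  by have := vtx_lt jlen lenlt; rewrite -jb ltNge; have /andP[_ ->] := r face_len lenlt.
Qed.

Let len2 : (2 <= face_len)%N. Proof. by have [] := face_size. Qed.
Let szE : size face_seq = face_len.+1. Proof. by have [] := face_size. Qed.
Let vtx0 : vtx 0 = a. Proof. by have [] := face_size. Qed.
Let vtxl : vtx face_len = b. Proof. by have [] := face_size. Qed.

Lemma vtx_btw i : (0 < i < face_len)%N -> vtx i \in btw a b.
Proof.
move=> /andP[i0 il]; rewrite inE vtx_PU ?szE; last lia.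
by rewrite -vtx0 -vtxl !vtx_lt ?szE //; lia.
Qed.

(** Such an edge would span some vertex, but fewer vertices than the edge from [a] to [b], as
    one of its ends lies strictly inside. *)
Lemma no_span (i j k : nat) :
  (i < k)%N -> (k < j)%N -> (j <= face_len)%N -> (0 < i)%N || (j < face_len)%N ->
  adj (vtx i) (vtx j) -> False.
Proof.
move=> ik kj jl ij adjij; have kl : (k < size face_seq)%N by rewrite szE; lia.
have jlt : (j < size face_seq)%N by rewrite szE.
have ilt : (i < size face_seq)%N by rewrite szE; lia.
have sp : spans (vtx i, vtx j).
  apply/and5P; split=> //=; [exact: vtx_PU|exact: vtx_PU|exact: vtx_lt (ltn_trans ik kj) jlt|].
  apply/set0Pn; exists (vtx k); rewrite inE vtx_PU //=.
  by rewrite vtx_lt // vtx_lt.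
have := abmin sp; rewrite leqNgt => /negP; apply; apply: proper_card.
have lei : pos a <= pos (vtx i) by have := vtx_face ilt; rewrite inE => /and3P[].
have lej : pos (vtx j) <= pos b by have := vtx_face jlt; rewrite inE => /and3P[].
apply/properP; split.
  apply/fintype.subsetP => x; rewrite !inE => /and3P[-> ix xj] /=.
  by rewrite (le_lt_trans lei ix) (lt_le_trans xj lej).
case/orP: ij => [i0|jlen].
  exists (vtx i); first by apply: vtx_btw; lia.
  by rewrite inE ltxx andbF.
exists (vtx j); first by apply: vtx_btw; lia.
by rewrite inE ltxx !andbF.
Qed.

(** An edge that leaves the range would cross the edge from [a] to [b], and an edge that skips
    a vertex is excluded by minimality. *)
Lemma inner_nbr i q l :
  (0 < i < face_len)%N -> q \in U -> e q (vtx i) -> l \in PU -> l != vtx i ->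
  e q l -> l = vtx i.-1 \/ l = vtx i.+1.
Proof.
move=> il qU qi lPU li ql.
have ilt : (i < size face_seq)%N by rewrite szE; lia.
have [q0 /and3P[q0U q0a q0b]] : exists q, [&& q \in U, e q a & e q b].
  by apply/existsP; have /and5P[] := ab.
have := vtx_btw il; rewrite inE => /and3P[iPU ai ib].
have lr : l \in face_set.
  rewrite inE lPU /= !leNgt; apply/andP; split; apply/negP => lt.
    exact: (cross (PU_P lPU) (PU_P aPU) (PU_P iPU) (PU_P bPU) lt ai ib ql qi q0a q0b).
  exact: (cross (PU_P aPU) (PU_P iPU) (PU_P bPU) (PU_P lPU) ai ib lt q0a q0b qi ql).
have [j jlt lj] := face_vtx lr; rewrite {}lj in lPU li ql lr *.
have ji : j != i by apply: contra li => /eqP ->.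
have [jlti|ilej] := ltnP j i.
  left; congr vtx; apply/eqP/negPn/negP => jE.
  have [h1 h2 h3 h4] : [/\ j < i.-1, i.-1 < i, i <= face_len & (0 < j) || (i < face_len)]%N.
    by clear - il jE jlti; split; lia.
  exact: no_span h1 h2 h3 h4 (adjI qU ql qi).
right; congr vtx; apply/eqP/negPn/negP => jE.
have [h1 h2 h3 h4] : [/\ i < i.+1, i.+1 < j, j <= face_len & (0 < i) || (j < face_len)]%N.
  by clear - il jE ilej jlt ji szE; split; lia.
exact: no_span h1 h2 h3 h4 (adjI qU qi ql).
Qed.

Lemma inner_adj i : (0 < i < face_len)%N -> adj (vtx i) (vtx i.-1) /\ adj (vtx i) (vtx i.+1).
Proof.
move=> il; have iPU : vtx i \in PU by apply: vtx_PU; rewrite szE; lia.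
have [q [q' [l [l' [[qU q'U lPU l'PU] [qi ql q'i q'l' [li l'i ll']]]]]]] := two_ends iPU.
have := inner_nbr il qU qi lPU li ql; have := inner_nbr il q'U q'i l'PU l'i q'l'.
move=> [E'|E'] [E|E]; rewrite E E' in ll' ql q'l'; rewrite ?eqxx // in ll'.
- by split; [exact: adjI q'U q'i q'l'|exact: adjI qU qi ql].
- by split; [exact: adjI qU qi ql|exact: adjI q'U q'i q'l'].
Qed.

(** The vertices of the face in cyclic order, so that its last edge runs from [vtx face_len]
    back to [vtx 0]. *)
Definition vtx' i := if i == face_len.+1 then vtx 0 else vtx i.

Lemma vtx'E i : (i <= face_len)%N -> vtx' i = vtx i.
Proof. by move=> il; rewrite /vtx' (_ : (i == face_len.+1) = false) //; apply/eqP; lia. Qed.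

Lemma face_adj i : (i <= face_len)%N -> adj (vtx i) (vtx' i.+1).
Proof.
rewrite leq_eqVlt => /predU1P[->|il].
  by rewrite /vtx' eqxx vtx0 vtxl; apply: adjC; have /and5P[] := ab.
rewrite vtx'E //; have [->|i0] := posnP i.
  by apply: adjC; have [] := @inner_adj 1 len2.
by have [] := @inner_adj i; [rewrite i0|].
Qed.

Definition edg i := odflt a [pick q | [&& q \in U, e q (vtx i) & e q (vtx' i.+1)]].

Lemma edgP i : (i <= face_len)%N -> [/\ edg i \in U, e (edg i) (vtx i) & e (edg i) (vtx' i.+1)].
Proof.
move=> /face_adj /existsP[q qP]; rewrite /edg; case: pickP => [q' /and3P[]//|/(_ q)].
by rewrite qP.
Qed.

Lemma vtx'_last : vtx' face_len.+1 = vtx 0. Proof. by rewrite /vtx' eqxx. Qed.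

Lemma vtx'_PU i : (i <= face_len.+1)%N -> vtx' i \in PU.
Proof.
move=> il; rewrite /vtx'; case: eqP => E; first by rewrite vtx_PU ?szE.
by rewrite vtx_PU // szE; clear - il E; lia.
Qed.

Lemma vtxE i j : (i <= face_len)%N -> (j <= face_len)%N -> (vtx i = vtx j) -> i = j.
Proof. by move=> il jl; apply: vtx_inj; rewrite szE. Qed.

Lemma edg_notin i : (i <= face_len)%N -> edg i \notin P.
Proof.
by move=> il; have [_ ei _] := edgP il; apply: nbrP ei _; apply/PU_P/vtx_PU; rewrite szE.
Qed.

Lemma edg_neq i j : (i < j)%N -> (j <= face_len)%N -> edg i <> edg j.
Proof.
move=> ij jl E; have il : (i < face_len)%N by exact: leq_trans ij jl.
have [_ qi qi'] := edgP (ltnW il); have [_ qj qj'] := edgP jl.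
rewrite vtx'E // in qi'; rewrite -E in qj qj'.
have vP t : (t <= face_len)%N -> vtx t \in P by move=> tl; apply/PU_P/vtx_PU; rewrite szE.
have v'P : vtx' j.+1 \in P by exact/PU_P/vtx'_PU.
have jE : i.+1 = j.
  have [/vtxE|/vtxE|/vtxE] := deg2 (vP _ (ltnW il)) (vP _ il) (vP _ jl) qi qi' qj.
  - by move=> /(_ (ltnW il) il); clear; lia.
  - by move=> /(_ (ltnW il) jl); clear - ij; lia.
  - exact.
have dj : vtx' j.+1 = if j == face_len then vtx 0 else vtx j.+1.
  by rewrite /vtx' eqSS; case: eqP.
have [/vtxE| |] := deg2 (vP _ (ltnW il)) (vP _ il) v'P qi qi' qj'.
- by move=> /(_ (ltnW il) il); clear; lia.
- rewrite dj; case: eqP => [jlen|jlen] /vtxE.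
    by move=> /(_ (ltnW il) (leq0n _)); move: len2; rewrite -jlen -jE => + i0; rewrite i0.
  by move=> /(_ (ltnW il)); clear - jE jl jlen; lia.
- rewrite dj; case: eqP => [jlen|jlen] /vtxE.
  by move=> /(_ il (leq0n _)).
by move=> /(_ il); clear - jE jl jlen; lia.
Qed.

Lemma edg_inj i j : (i <= face_len)%N -> (j <= face_len)%N -> edg i = edg j -> i = j.
Proof.
by move=> il jl E; case: (ltngtP i j) => // lt; [case: (edg_neq lt jl)|case: (edg_neq lt il)].
Qed.

Lemma edg_nbr i z : (i <= face_len)%N -> e (edg i) z -> z = vtx i \/ z = vtx' i.+1.
Proof.
move=> il iz; have [_ ei ei'] := edgP il.
have vP : vtx i \in P by apply/PU_P/vtx_PU; rewrite szE.
have v'P : vtx' i.+1 \in P by exact/PU_P/vtx'_PU.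
have [E|->|->] := deg2 vP v'P (nbrQ iz (edg_notin il)) ei ei' iz; [|by left|by right].
exfalso; move: E; rewrite /vtx' eqSS; case: eqP => [->|ilen] /vtxE.
  by move=> /(_ (leqnn _) (leq0n _)) l0; have := len2; rewrite l0.
by move=> /(_ il); clear - il ilen; lia.
Qed.

Lemma vtx_nbr i z :
  (0 < i < face_len)%N -> z \in U -> e (vtx i) z -> z = edg i.-1 \/ z = edg i.
Proof.
move=> il zU; rewrite e_sym => zi.
have iPU : vtx i \in PU by apply: vtx_PU; rewrite szE; clear - il; lia.
have [l [lPU li zl]] := other_end zU (PU_P iPU) zi.
have [E|E] := inner_nbr il zU zi lPU li zl; rewrite E in zl lPU li; [left|right].
  have il1 : (i.-1 <= face_len)%N by clear - il; lia.
  have [eU e1 e2] := edgP il1.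
  rewrite prednK in e2; last by have /andP[] := il.
  rewrite vtx'E in e2; last by clear - il; lia.
  by apply: (edge_uniq zU eU iPU lPU _ zi zl e2 e1); rewrite eq_sym.
have il1 : (i <= face_len)%N by clear - il; lia.
have [eU e1 e2] := edgP il1.
rewrite vtx'E in e2; last by clear - il; lia.
by apply: (edge_uniq zU eU iPU lPU _ zi zl e1 e2); rewrite eq_sym.
Qed.

Definition cyc j := if odd j then edg j./2 else vtx j./2.

Lemma cyc_even t : cyc (2 * t) = vtx t.
Proof. by rewrite /cyc mul2n odd_double doubleK. Qed.

Lemma cyc_odd t : cyc (2 * t + 1) = edg t.
Proof. by rewrite /cyc mul2n addn1 /= odd_double /= uphalf_double. Qed.

Lemma half_cases j : exists t, (j = 2 * t \/ j = 2 * t + 1)%N.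
Proof. exists (j %/ 2)%N; lia. Qed.

Hypothesis IH : forall U' : {set V}, U' \proper U -> decomposable (indep e U').

(** The vertices strictly inside the face only have their two neighbours along the face, so the
    face is a cycle of the graph that branches at its two extreme vertices only. *)
Lemma decomposable_face : decomposable (indep e U).
Proof.
have vU t : (t <= face_len)%N -> vtx t \in U by move=> tl; apply/PU_U/vtx_PU; rewrite szE.
have vP t : (t <= face_len)%N -> vtx t \in P by move=> tl; apply/PU_P/vtx_PU; rewrite szE.
have cP t : (t <= 2 * face_len + 1)%N -> (cyc t \in P) = ~~ odd t.
  move=> tl; have [i [tE|tE]] := half_cases t; rewrite tE.
    by rewrite cyc_even vP ?oddM //; clear - tl tE; lia.
  rewrite cyc_odd oddD oddM /=; apply: negbTE; apply: edg_notin; clear - tl tE; lia.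
apply: (@decomposable_cycle _ e e_sym e_irr U cyc face_len len2 _ _ _ _ _ _ IH).
- move=> i j il jl E; have := congr1 (fun x => x \in P) E; rewrite !cP //.
  have odd0 t : odd (2 * t) = false by rewrite oddM.
  have odd1 t : odd (2 * t + 1) = true by rewrite oddD oddM.
  have [s [iE|iE]] := half_cases i; have [t [jE|jE]] := half_cases j; subst i j;
    rewrite ?odd0 ?odd1 // => _; move: E; rewrite ?cyc_even ?cyc_odd.
    by move=> /vtxE ->//; [clear - il|clear - jl]; lia.
  by move=> /edg_inj -> //; [clear - il|clear - jl]; lia.
- move=> i il; have [t [iE|iE]] := half_cases i; rewrite iE ?cyc_even ?cyc_odd.
    by apply: vU; clear - iE il; lia.
  by have [|] := @edgP t; first by clear - iE il; lia.
- move=> i il; have [t [iE|iE]] := half_cases i; rewrite iE.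
    have tl : (t <= face_len)%N by clear - iE il; lia.
    rewrite -[(2 * t).+1]addn1 cyc_even cyc_odd e_sym.
    by have [] := edgP tl.
  have tl : (t < face_len)%N by clear - iE il; lia.
  have -> : (2 * t + 1).+1 = (2 * t.+1)%N by clear; lia.
  rewrite cyc_odd cyc_even -vtx'E //.
  by have [] := edgP (ltnW tl).
- move=> z zU; rewrite cyc_odd cyc_even => /(edg_nbr (leqnn _)).
  by rewrite vtx'_last.
- move=> i z il zU; have [t [iE|iE]] := half_cases i.
    have tl : (0 < t < face_len)%N by clear - il iE; lia.
    have -> : i.-1 = (2 * t.-1 + 1)%N by clear - tl iE; lia.
    have -> : i.+1 = (2 * t + 1)%N by clear - iE; lia.
    by rewrite iE !cyc_odd cyc_even; exact: vtx_nbr.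
  have tl : (t < face_len)%N by clear - il iE; lia.
  have -> : i.-1 = (2 * t)%N by clear - iE; lia.
  have -> : i.+1 = (2 * t.+1)%N by clear - iE; lia.
  rewrite iE cyc_odd !cyc_even => /(edg_nbr (ltnW tl)).
  by rewrite vtx'E.
- move=> i il; apply: nadj; rewrite !cP //= ?negbK //.
  by clear - il; lia.
Qed.

End face.
End core.

(** Isolated vertices, leaves and dominated vertices are dealt with first. In their absence
    the outerplanar graph is simple with all degrees at least two, hence has a face in which
    only two vertices, adjacent in the face, may have larger degree. *)
Theorem decomposable_outerplanar U : decomposable (indep e U).
Proof.
have [n] := ubnP #|U|; elim: n U => // n IHn U Un.
have IH (U' : {set V}) : U' \proper U -> decomposable (indep e U').
  by move=> /proper_card lt; apply: IHn; exact: leq_trans lt Un.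
have [[x [xU xz]]|noiso] := pselect (exists x, x \in U /\ forall z, z \in U -> ~~ e x z).
  exact: decomposable_cone (isolated_cone e_sym e_irr xU xz).
have [[x [z [xU zU xz xt]]]|noleaf] := pselect (exists x z,
    [/\ x \in U, z \in U, e x z & forall t, t \in U -> e x t -> t = z]).
  have xNz : x != z by apply: contraTneq xz => ->; rewrite e_irr.
  apply: (decomposable_leaf e_sym e_irr xU zU xNz xt); apply: IH; first exact: properD1.
  by apply: sub_proper_trans (properD1 zU); exact: away_sub.
have [[x [y D]]|nodom] := pselect (exists x y, dominates e U x y).
  apply: decomposable_reduces (dominates_reduces e_sym e_irr D) _; apply: IH.
  by case: D => _ yU _ _ _; exact: properD1.
have [->|/set0Pn[x xU]] := eqVneq U finset.set0.
  by rewrite indep_empty; exact: decomposable_empty.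
have branch y : y \in U -> exists z z', [/\ z \in U, z' \in U, z != z', e y z & e y z'].
  move=> yU; apply: contrapT => H.
  have [z [zU yz]] : exists z, z \in U /\ e y z.
    apply: contrapT => H'; apply: noiso; exists y; split=> // z zU.
    by apply/negP => yz; apply: H'; exists z.
  apply: noleaf; exists y, z; split=> // t tU yt; apply: contrapT => /eqP tz.
  by apply: H; exists t, z.
have {}nodom y z : ~ dominates e U y z by move=> D; apply: nodom; exists y, z.
have [ab0 sp0] := exists_spans branch nodom xU.
(* An edge spanning as few vertices as possible bounds a face. *)
pose ab := [arg min_(i < ab0 | spans U i) #|btw U i.1 i.2|]%N.
have [sp abmin] : spans U ab /\
    forall cd, spans U cd -> (#|btw U ab.1 ab.2| <= #|btw U cd.1 cd.2|)%N.
  by rewrite /ab; case: arg_minnP.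
apply: (@decomposable_face U branch nodom ab.1 ab.2 _ abmin IH).
by case: ab sp {abmin}.
Qed.

End outerplanar.

Local Close Scope set_scope.

(** * From chord diagrams to outerplanar graphs *)

Section plane.
Variable R : realType.
Implicit Types (a b c x y z w u : 'rV[R]_2) (s t r : R).

Definition cx z : R := z ord0 ord0.
Definition cy z : R := z ord0 ord_max.
Definition nsq z : R := cx z ^+ 2 + cy z ^+ 2.
Definition comb t z w := (1 - t) *: z + t *: w.

Lemma sum2E z : \sum_(i < 2) z ord0 i ^+ 2 = nsq z.
Proof.
rewrite !big_ord_recl big_ord0 addr0 /nsq /cx /cy.
by congr (_ + (z _ _) ^+ 2); exact: val_inj.
Qed.

Lemma plane_eq z w : cx z = cx w -> cy z = cy w -> z = w.
Proof.
move=> zx zy; apply/rowP => -[[|[|//]] i].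
  by have -> : Ordinal i = ord0 by exact: val_inj.
by have -> : Ordinal i = ord_max by exact: val_inj.
Qed.

Lemma cx_comb t z w : cx (comb t z w) = (1 - t) * cx z + t * cx w.
Proof. by rewrite /cx !mxE. Qed.
Lemma cy_comb t z w : cy (comb t z w) = (1 - t) * cy z + t * cy w.
Proof. by rewrite /cy !mxE. Qed.

(** Twice the signed area of the triangle. *)
Definition orient a b c : R := (cx b - cx a) * (cy c - cy a) - (cy b - cy a) * (cx c - cx a).

Lemma orient_rot a b c : orient a b c = orient b c a.
Proof. by rewrite /orient; ring. Qed.

Lemma orient_swap a b c : orient a b c = - orient a c b.
Proof. by rewrite /orient; ring. Qed.

Lemma orient_opp a b c : orient a b c = - orient b a c.
Proof. by rewrite /orient; ring. Qed.

Lemma orient_comb a b t z w : orient a b (comb t z w) = (1 - t) * orient a b z + t * orient a b w.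
Proof. by rewrite /orient cx_comb cy_comb; ring. Qed.

Lemma orient_l a b : orient a b a = 0. Proof. by rewrite /orient; ring. Qed.
Lemma orient_r a b : orient a b b = 0. Proof. by rewrite /orient; ring. Qed.

Lemma nsq_comb t z w : 0 <= t -> t <= 1 -> nsq z <= 1 -> nsq w <= 1 -> nsq (comb t z w) <= 1.
Proof.
move=> t0 t1; rewrite /nsq cx_comb cy_comb.
move: (cx z) (cy z) (cx w) (cy w) => zx zy wx wy z1 w1.
have -> : ((1 - t) * zx + t * wx) ^+ 2 + ((1 - t) * zy + t * wy) ^+ 2 =
   (1 - t) * (zx ^+ 2 + zy ^+ 2) + t * (wx ^+ 2 + wy ^+ 2)
   - t * (1 - t) * ((zx - wx) ^+ 2 + (zy - wy) ^+ 2) by ring.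
have h1 : 0 <= t * (1 - t) * ((zx - wx) ^+ 2 + (zy - wy) ^+ 2).
  by apply: mulr_ge0; [apply: mulr_ge0 => //; lra|apply: addr_ge0; exact: sqr_ge0].
move: (_ + _) (_ + _) z1 w1 h1 => p q p1 q1; move: (t * _ * _) => h h0; nra.
Qed.

Lemma nsq_chord t z w : 0 < t -> t < 1 -> nsq z = 1 -> nsq w = 1 -> nsq (comb t z w) <= 1.
Proof. by move=> t0 t1 z1 w1; apply: nsq_comb; rewrite ?z1 ?w1 //; exact: ltW. Qed.

(** Write z as a + t (b - a). Its squared norm is 1 - t (1 - t) times the squared
    length of b - a, so z is in the disk exactly when t is in [0, 1]. *)
Lemma on_chord a b z : nsq a = 1 -> nsq b = 1 -> a <> b -> orient a b z = 0 -> nsq z <= 1 ->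
  exists t, [/\ 0 <= t, t <= 1 & z = comb t a b].
Proof.
move=> a1 b1 ab o0 z1.
pose dx := cx b - cx a; pose dy := cy b - cy a; pose n := dx ^+ 2 + dy ^+ 2.
have n0 : 0 < n.
  rewrite lt_neqAle addr_ge0 ?sqr_ge0 // andbT eq_sym; apply/eqP => /eqP.
  rewrite paddr_eq0 ?sqr_ge0 // !sqrf_eq0 !subr_eq0 => /andP[/eqP bx /eqP by_].
  exact/ab/plane_eq.
pose t := ((cx z - cx a) * dx + (cy z - cy a) * dy) / n.
have tn : t * n = (cx z - cx a) * dx + (cy z - cy a) * dy by rewrite divfK // lt0r_neq0.
have o : dx * (cy z - cy a) = dy * (cx z - cx a) by apply/eqP; rewrite -subr_eq0; apply/eqP.
have zx : cx z = cx a + t * dx.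
  apply/(mulIf (lt0r_neq0 n0)); rewrite mulrDl mulrAC tn /n.
  suff : (cx z - cx a) * (dy ^+ 2) = (cy z - cy a) * dy * dx by move=> E; lra.
  rewrite [RHS](_ : _ = dx * (cy z - cy a) * dy); last by ring.
  by rewrite o; ring.
have zy : cy z = cy a + t * dy.
  apply/(mulIf (lt0r_neq0 n0)); rewrite mulrDl mulrAC tn /n.
  suff : (cy z - cy a) * (dx ^+ 2) = (cx z - cx a) * dx * dy by move=> E; lra.
  rewrite [RHS](_ : _ = dy * (cx z - cx a) * dx); last by ring.
  by rewrite -o; ring.
exists t.
have nz : nsq z = 1 - t * (1 - t) * n.
  have h : 2 * (cx a * dx + cy a * dy) + n = 0.
    have : nsq b - nsq a = 0 by rewrite a1 b1 subrr.
    by rewrite /nsq /n /dx /dy => <-; ring.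
  have -> : nsq z = nsq a + t * (2 * (cx a * dx + cy a * dy)) + t ^+ 2 * n.
    by rewrite /nsq zx zy /n; ring.
  have -> : 2 * (cx a * dx + cy a * dy) = - n by lra.
  by rewrite a1; ring.
have tt : 0 <= t * (1 - t) by rewrite -(pmulr_lge0 _ n0); move: nz z1 => ->; lra.
split; [nra|nra|].
by apply: plane_eq; rewrite ?cx_comb ?cy_comb ?zx ?zy /dx /dy; ring.
Qed.

Lemma on_circle a b z : nsq a = 1 -> nsq b = 1 -> a <> b -> orient a b z = 0 -> nsq z = 1 ->
  z = a \/ z = b.
Proof.
move=> a1 b1 ab o0 z1; have [|t [t0 t1 zE]] := on_chord a1 b1 ab o0; first by rewrite z1.
have : t * (1 - t) * ((cx b - cx a) ^+ 2 + (cy b - cy a) ^+ 2) = 0.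
  have : (1 - t) * nsq a + t * nsq b - nsq z = 0 by rewrite a1 b1 z1; ring.
  by rewrite zE /nsq cx_comb cy_comb => <-; ring.
move/eqP; rewrite !mulf_eq0 => /orP[/orP[/eqP t0'|]|].
- by left; rewrite zE t0'; apply: plane_eq; rewrite ?cx_comb ?cy_comb; ring.
- rewrite subr_eq0 => /eqP t1'.
  by right; rewrite zE -t1'; apply: plane_eq; rewrite ?cx_comb ?cy_comb; ring.
- rewrite paddr_eq0 ?sqr_ge0 // !sqrf_eq0 !subr_eq0 => /andP[/eqP bx /eqP by_].
  by case: ab; apply: plane_eq.
Qed.

Lemma zero_between s r : s < 0 -> 0 < r -> exists t, [/\ 0 < t, t < 1 & (1 - t) * s + t * r = 0].
Proof.
move=> s0 r0; have d0 : 0 < r - s by lra.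
exists (- s / (r - s)); split.
- by rewrite divr_gt0 // oppr_gt0.
- by rewrite ltr_pdivrMr //; lra.
- by field; rewrite lt0r_neq0.
Qed.

(** Stereographic coordinate from the point (-1, 0). *)
Definition stereo z : R := cy z / (1 + cx z).

Lemma stereoE z : nsq z = 1 -> cx z != -1 ->
  cx z = (1 - stereo z ^+ 2) / (1 + stereo z ^+ 2) /\ cy z = 2 * stereo z / (1 + stereo z ^+ 2).
Proof.
move=> z1 zx; have x0 : 1 + cx z != 0 by apply: contra zx => /eqP E; apply/eqP; lra.
have yx : cy z ^+ 2 = (1 - cx z) * (1 + cx z).
  by have := z1; rewrite /nsq => h; rewrite -subr_sqr expr1n -h; ring.
have t2 : stereo z ^+ 2 = (1 - cx z) / (1 + cx z) by rewrite /stereo expr_div_n yx; field.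
rewrite t2 /stereo; have e : 1 + (1 - cx z) / (1 + cx z) = 2 / (1 + cx z) by field.
by rewrite e; split; field.
Qed.

Lemma stereo_inj z w : nsq z = 1 -> cx z != -1 -> nsq w = 1 -> cx w != -1 ->
  stereo z = stereo w -> z = w.
Proof.
move=> z1 zx w1 wx E; have [zX zY] := stereoE z1 zx; have [wX wY] := stereoE w1 wx.
by apply: plane_eq; rewrite ?zX ?zY ?wX ?wY E.
Qed.

(** In stereographic coordinates p < q < r the orientation is a positive multiple of
    (q - p) (r - p) (r - q). *)
Lemma orient_stereo a b c : nsq a = 1 -> cx a != -1 -> nsq b = 1 -> cx b != -1 ->
  nsq c = 1 -> cx c != -1 -> stereo a < stereo b -> stereo b < stereo c -> 0 < orient a b c.
Proof.
move=> a1 ax b1 bx c1 ccx; have [aX aY] := stereoE a1 ax; have [bX bY] := stereoE b1 bx.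
have [cX cY] := stereoE c1 ccx; rewrite /orient aX aY bX bY cX cY.
move: (stereo a) (stereo b) (stereo c) => p q r pq qr.
have h (t : R) : 0 < 1 + t ^+ 2 by rewrite ltr_pwDl // sqr_ge0.
set X := (X in 0 < X).
have -> : X = 4 * ((q - p) * (r - p) * (r - q)) / ((1 + p ^+ 2) * (1 + q ^+ 2) * (1 + r ^+ 2)).
  by rewrite /X; field; rewrite !lt0r_neq0.
apply: divr_gt0; last by rewrite !mulr_gt0.
by rewrite !mulr_gt0 // subr_gt0 //; exact: lt_trans qr.
Qed.

End plane.

Section diagrams.
Variables (R : realType) (V : finType) (D : chord_diagram R V) (P : {set V}).
Hypothesis bip : bipartition (circle_graph D) P.
Implicit Types (p q u v : V) (b : bool) (z w : 'rV[R]_2) (t : R).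
Local Notation ed p b := (chord_end D (p, b)).

Lemma nsq_end p b : nsq (ed p b) = 1.
Proof. by rewrite -sum2E; exact: (chord_end_circle D (p, b)). Qed.

Lemma end_inj p p' b b' : ed p b = ed p' b' -> p = p' /\ b = b'.
Proof. by move/(chord_end_inj) => []. Qed.

Lemma ends_neq p : ed p false <> ed p true.
Proof. by move/end_inj => []. Qed.

Lemma chordP p z : chord D p z <->
  exists t, [/\ 0 <= t, t <= 1 & z = comb t (ed p false) (ed p true)].
Proof.
split=> [[t /=]|[t [t0 t1 ->]]]; last by exists t => //=; rewrite in_itv /= t0.
by rewrite in_itv /= => /andP[t0 t1] <-; exists t.
Qed.

Lemma chord_ed p b : chord D p (ed p b).
Proof.
by apply/chordP; case: b; [exists 1|exists 0]; split=> //;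
  apply: plane_eq; rewrite ?cx_comb ?cy_comb; ring.
Qed.

Lemma circle_graph_sym : symmetric (circle_graph D).
Proof. by move=> u v; rewrite /circle_graph eq_sym classical_sets.setIC. Qed.

Lemma circle_graph_irr : irreflexive (circle_graph D).
Proof. by move=> u; rewrite /circle_graph eqxx. Qed.

Lemma crossing_adjacent u v : u != v -> orient (ed u false) (ed u true) (ed v false) < 0 ->
  0 < orient (ed u false) (ed u true) (ed v true) -> circle_graph D u v.
Proof.
move=> uv v0 v1; rewrite /circle_graph uv /=; apply/asboolP.
have [t [t0 t1 E]] := zero_between v0 v1.
exists (comb t (ed v false) (ed v true)); split.
  apply/chordP; apply: on_chord (nsq_end _ _) (nsq_end _ _) (@ends_neq u) _ _.
    by rewrite orient_comb.
  by apply: (nsq_chord t0 t1); exact: nsq_end.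
by apply/chordP; exists t; rewrite !ltW.
Qed.

Lemma crossing_adjacent' u v b : u != v -> orient (ed u false) (ed u true) (ed v b) < 0 ->
  0 < orient (ed u false) (ed u true) (ed v (~~ b)) -> circle_graph D u v.
Proof.
case: b => //= uv v1 v0; last exact: crossing_adjacent.
rewrite /circle_graph uv /=; apply/asboolP.
have [t [t0 t1 E]] := zero_between v1 v0.
exists (comb t (ed v true) (ed v false)); split.
  apply/chordP; apply: on_chord (nsq_end _ _) (nsq_end _ _) (@ends_neq u) _ _.
    by rewrite orient_comb.
  by apply: (nsq_chord t0 t1); exact: nsq_end.
apply/chordP; exists (1 - t); split; [lra|lra|].
by apply: plane_eq; rewrite ?cx_comb ?cy_comb; ring.
Qed.

Lemma orient_end p z : nsq z = 1 -> orient (ed p false) (ed p true) z = 0 -> exists b, z = ed p b.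
Proof.
move=> z1 o; have [->|->] := on_circle (nsq_end p false) (nsq_end p true) (@ends_neq p) o z1.
  by exists false.
by exists true.
Qed.

Section sides.
Variable x : 'rV[R]_2.
Hypotheses (Cx : chords_complement D P x)
  (face : forall v, v \in P ->
    (chord D v `<=` closure (connected_component (chords_complement D P) x))%classic).

(** The affine function that vanishes on the line of [p] and is positive at [x]. *)
Definition side p z : R :=
  orient (ed p false) (ed p true) z * orient (ed p false) (ed p true) x.

Lemma side_comb p t z w : side p (comb t z w) = (1 - t) * side p z + t * side p w.
Proof. by rewrite /side orient_comb; ring. Qed.

Lemma side_end p b : side p (ed p b) = 0.
Proof. by rewrite /side; case: b; rewrite ?orient_l ?orient_r mul0r. Qed.

Lemma complement_side p z : p \in P -> chords_complement D P z ->
  orient (ed p false) (ed p true) z <> 0.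
Proof.
move=> pP [z1 zP] o; apply: zP; exists p => //=; apply/chordP.
apply: on_chord (nsq_end _ _) (nsq_end _ _) (@ends_neq p) o _.
by move: z1; rewrite /open_disk /= sum2E => /ltW.
Qed.

Lemma side_x p : p \in P -> 0 < side p x.
Proof.
move=> pP; rewrite /side -expr2 exprn_even_gt0 //=.
exact/eqP/complement_side.
Qed.

Lemma side_cont p : continuous (side p).
Proof.
have cc i : continuous (fun z : 'rV[R]_2 => z ord0 i) by exact: coord_continuous.
apply: contM; last exact: cont_cst.
apply: contB; apply: contM; do ? exact: cont_cst.
  by apply: contB; [exact: cc|exact: cont_cst].
by apply: contB; [exact: cc|exact: cont_cst].
Qed.

(** On the component of [x] the function is continuous without zero, hence of constant sign. *)
Lemma component_side p z : p \in P ->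
  connected_component (chords_complement D P) x z -> 0 < side p z.
Proof.
move=> pP [C [Cx' CC Cc] Cz].
have cI : connected (side p @` C)%classic.
  by apply: connected_continuous_connected => //; apply: within_cont; exact: side_cont.
have iI : is_interval (side p @` C)%classic by exact/connected_intervalP.
rewrite ltNge; apply/negP => z0.
have [w Cw w0] : (side p @` C)%classic 0.
  apply: (iI (side p z) (side p x)); [by exists z|by exists x|].
  by rewrite z0 ltW // side_x.
have := w0; rewrite /side => /eqP; rewrite mulf_eq0 => /orP[/eqP|/eqP].
  exact: complement_side (CC _ Cw).
exact: complement_side Cx.
Qed.

Lemma side_ge0 p p' b : p \in P -> p' \in P -> 0 <= side p (ed p' b).
Proof.
move=> pP p'P; have /= := face p'P (chord_ed p' b).
have cl : closed [set z | 0 <= side p z]%classic.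
  exact: ((continuous_closedP _).1 (@side_cont p) [set r | r >= 0]%classic (@closed_ge R 0)).
move=> h; apply: cl; apply: closure_subset h => z /(component_side pP); exact: ltW.
Qed.

Lemma side_other p p' b : p \in P -> p' \in P -> p != p' -> 0 < side p (ed p' b).
Proof.
move=> pP p'P pp'; rewrite lt_neqAle side_ge0 // andbT eq_sym; apply/negP.
rewrite /side mulf_eq0 => /orP[/eqP/(orient_end (nsq_end _ _))[b' /end_inj[E _]]|/eqP].
  by rewrite E eqxx in pp'.
exact: complement_side Cx.
Qed.

Lemma side0 p z : p \in P -> nsq z = 1 -> side p z = 0 -> exists b, z = ed p b.
Proof.
move=> pP z1 /eqP; rewrite mulf_eq0 => /orP[/eqP|/eqP]; first exact: orient_end.
by move/complement_side => /(_ pP Cx).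
Qed.

(** Let z be cut off by both p and p'. The segment from z to an end of p crosses the line
    of p', at a point that is on the chord p' and beyond the line of p; but p' lies on the side
    of x. *)
Lemma caps_disjoint p p' z : p \in P -> p' \in P -> p != p' -> nsq z = 1 ->
  side p z <= 0 -> 0 < side p' z.
Proof.
move=> pP p'P pp' z1 sz; rewrite ltNge; apply/negP => sz'.
have p'p : p' != p by rewrite eq_sym.
have sz0 : side p z < 0.
  rewrite lt_neqAle sz andbT; apply/eqP => /(side0 pP z1)[b zE].
  by have := side_other b p'P pP p'p; rewrite -zE ltNge sz'.
have sz0' : side p' z < 0.
  rewrite lt_neqAle sz' andbT; apply/eqP => /(side0 p'P z1)[b zE].
  by have := side_other b pP p'P pp'; rewrite -zE ltNge sz.
have [t [t0 t1 E]] := zero_between sz0' (side_other false p'P pP p'p).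
have o : orient (ed p' false) (ed p' true) (comb t z (ed p false)) = 0.
  move: E; rewrite -side_comb /side => /eqP; rewrite mulf_eq0 => /orP[/eqP //|/eqP].
  by move/complement_side => /(_ p'P Cx).
have [|s [s0 s1 sE]] := on_chord (nsq_end _ _) (nsq_end _ _) (@ends_neq p') o.
  by apply: (nsq_chord t0 t1) => //; exact: nsq_end.
have : side p (comb t z (ed p false)) = (1 - t) * side p z.
  by rewrite side_comb side_end mulr0 addr0.
rewrite sE side_comb.
have := side_other false pP p'P pp'; have := side_other true pP p'P pp'.
move: (side p z) sz0 (side p _) (side p _) => a a0 c d; nra.
Qed.

Lemma adjacent_cap p q : p \in P -> circle_graph D q p -> exists b, side p (ed q b) < 0.
Proof.
move=> pP qp; have /andP[qNp /asboolP[z [zq zp]]] := qp.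
have z0 : side p z = 0.
  by move/chordP: zp => [t [_ _ ->]]; rewrite side_comb !side_end !mulr0 addr0.
have N0 b : side p (ed q b) <> 0.
  by move=> /(side0 pP (nsq_end _ _))[b' /end_inj[E _]]; rewrite E eqxx in qNp.
move/chordP: zq => [t [t0 t1 zE]]; move: z0; rewrite zE side_comb => E.
apply: contrapT => H.
have pos b : 0 < side p (ed q b).
  rewrite ltNge le_eqVlt; apply/negP => /predU1P[/N0 //|lt].
  by apply: H; exists b.
have := pos true; have := pos false; move: (side p _) (side p _) E => a c; nra.
Qed.

(** Otherwise the line through y and y' meets the segment from z to u, inside the disk,
    hence on the chord from y to y'. But the former segment lies on the far side of p and
    the latter on the side of x. *)
Lemma same_orient p (z u y y' : 'rV[R]_2) : p \in P ->
  nsq z = 1 -> nsq u = 1 -> nsq y = 1 -> nsq y' = 1 ->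
  y <> y' -> side p z <= 0 -> side p u <= 0 -> 0 < side p y -> 0 < side p y' ->
  0 < orient y y' z -> 0 < orient y y' u.
Proof.
move=> pP z1 u1 y1 y'1 yy' sz su sy sy' oz; rewrite ltNge le_eqVlt; apply/negP => /predU1P[ou|ou].
  by have [E|E] := on_circle y1 y'1 yy' ou u1; [have := sy|have := sy']; rewrite -E ltNge su.
have [t [t0 t1]] := zero_between ou oz; rewrite -orient_comb => o.
have [|s [s0 s1 sE]] := on_chord y1 y'1 yy' o; first exact: (nsq_chord t0 t1).
have : side p (comb t u z) = (1 - s) * side p y + s * side p y' by rewrite sE side_comb.
rewrite side_comb => E.
have h1 : (1 - t) * side p u + t * side p z <= 0.
  by move: (side p u) (side p z) su sz {E} => f g f0 g0; nra.
have h2 : 0 < (1 - s) * side p y + s * side p y'.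
  by move: (side p y) (side p y') sy sy' {E} => f g f0 g0; nra.
by rewrite E leNgt h2 in h1.
Qed.

(** An end of [p] at which the stereographic coordinate is defined. *)
Definition mark p := ed p (cx (ed p false) == -1).

Lemma mark_stereo p : cx (mark p) != -1.
Proof.
rewrite /mark; case: (eqVneq (cx (ed p false)) (-1)) => // e0; apply/eqP => e1.
have cy0 b : cx (ed p b) = -1 -> cy (ed p b) = 0.
  move=> e; have := nsq_end p b; rewrite /nsq e sqrrN expr1n => /eqP.
  by rewrite -subr_eq0 addrC addKr sqrf_eq0 => /eqP.
by apply: (@ends_neq p); apply: plane_eq; rewrite ?e0 ?e1 ?cy0.
Qed.

Definition pos p : R := stereo (mark p).

Lemma pos_inj : injective pos.
Proof.
move=> p p' /stereo_inj E; have := E (nsq_end _ _) (mark_stereo _) (nsq_end _ _) (mark_stereo _).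
by move/end_inj => [].
Qed.

Lemma side_mark p : side p (mark p) <= 0.
Proof. by rewrite side_end. Qed.

(** Each neighbour of [q] in [P] cuts off an end of [q], and the arcs cut off are disjoint. *)
Lemma neighbour_degree (q a b c : V) : a \in P -> b \in P -> c \in P ->
  circle_graph D q a -> circle_graph D q b -> circle_graph D q c -> [\/ a = b, a = c | b = c].
Proof.
move=> aP bP cP /(adjacent_cap aP)[i ai] /(adjacent_cap bP)[j bj] /(adjacent_cap cP)[k ck].
have key p p' l : p \in P -> p' \in P -> side p (ed q l) < 0 -> side p' (ed q l) < 0 -> p = p'.
  move=> pP p'P pl p'l; apply/eqP/negPn/negP => pp'.
  by have := caps_disjoint pP p'P pp' (nsq_end _ _) (ltW pl); rewrite ltNge (ltW p'l).
have [ij|ij] := eqVneq i j; first by constructor 1; apply: (key _ _ i) => //; rewrite ij.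
have [ik|ik] := eqVneq i k; first by constructor 2; apply: (key _ _ i) => //; rewrite ik.
constructor 3; apply: (key _ _ j) => //; suff -> : j = k by [].
by case: i j k ij ik {ai bj ck} => [] [] [].
Qed.

Lemma opposite_caps q p p' : p \in P -> p' \in P -> p != p' ->
  circle_graph D q p -> circle_graph D q p' ->
  exists i, side p (ed q i) < 0 /\ side p' (ed q (~~ i)) < 0.
Proof.
move=> pP p'P pp' /(adjacent_cap pP)[i si] /(adjacent_cap p'P)[j sj]; exists i; split=> //.
suff -> : ~~ i = j by [].
have : i != j.
  apply/negP => /eqP E; have := caps_disjoint pP p'P pp' (nsq_end q i) (ltW si).
  by rewrite {1}E ltNge (ltW sj).
by case: i j {si sj} => [] [].
Qed.

(** The ends of q and q' lie on the arcs cut off by a, b, c and d, in this cyclic order, so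
    q and q' cross; but no two chords outside [P] do. *)
Lemma no_crossing (q q' a b c d : V) : a \in P -> b \in P -> c \in P -> d \in P ->
  pos a < pos b -> pos b < pos c -> pos c < pos d ->
  circle_graph D q a -> circle_graph D q c -> circle_graph D q' b -> circle_graph D q' d -> False.
Proof.
move=> aP bP cP dP ab bc cd qa qc q'b q'd.
have neq p p' : pos p < pos p' -> p != p' by apply: contraTneq => ->; rewrite ltxx.
have [i [ai ci]] := opposite_caps aP cP (neq _ _ (lt_trans ab bc)) qa qc.
have [j [bj dj]] := opposite_caps bP dP (neq _ _ (lt_trans bc cd)) q'b q'd.
have bip_notin u v : v \in P -> circle_graph D u v -> u \notin P.
  by move=> vP /bip; rewrite vP; case: (u \in P).
have qP := bip_notin _ _ aP qa; have q'P := bip_notin _ _ bP q'b.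
have dis p p' z : p \in P -> p' \in P -> p != p' -> nsq z = 1 -> side p z <= 0 -> 0 < side p' z.
  exact: caps_disjoint.
have [na nb] := (neq _ _ ab, neq _ _ bc); have nc := neq _ _ cd.
have nac := neq _ _ (lt_trans ab bc); have nbd := neq _ _ (lt_trans bc cd).
have nad := neq _ _ (lt_trans (lt_trans ab bc) cd).
have distinct p p' z w : p \in P -> p' \in P -> p != p' -> nsq z = 1 ->
    side p z <= 0 -> side p' w <= 0 -> z <> w.
  by move=> pP p'P pp' z1 pz p'w E; have := dis _ _ z pP p'P pp' z1 pz; rewrite E ltNge p'w.
have n1 p l := nsq_end p l.
(* The orientation of three points on distinct arcs does not depend on the points. *)
have move1 p1 p2 p3 z1 z2 z3 w1 : p1 \in P -> p2 \in P -> p3 \in P ->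
    p1 != p2 -> p1 != p3 -> p2 != p3 ->
    nsq z1 = 1 -> nsq z2 = 1 -> nsq z3 = 1 -> nsq w1 = 1 ->
    side p1 z1 <= 0 -> side p2 z2 <= 0 -> side p3 z3 <= 0 -> side p1 w1 <= 0 ->
    0 < orient z1 z2 z3 -> 0 < orient w1 z2 z3.
  move=> P1 P2 P3 n12 n13 n23 Z1 Z2 Z3 W1 s1 s2 s3 t1.
  rewrite orient_rot [X in _ -> 0 < X]orient_rot.
  apply: (same_orient P1) => //; first exact: (distinct p2 p3).
    by apply: (dis p2) => //; rewrite eq_sym.
  by apply: (dis p3) => //; rewrite eq_sym.
have move3 p1 p2 p3 z1 z2 z3 w1 w2 w3 : p1 \in P -> p2 \in P -> p3 \in P ->
    p1 != p2 -> p1 != p3 -> p2 != p3 ->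
    nsq z1 = 1 -> nsq z2 = 1 -> nsq z3 = 1 -> nsq w1 = 1 -> nsq w2 = 1 -> nsq w3 = 1 ->
    side p1 z1 <= 0 -> side p2 z2 <= 0 -> side p3 z3 <= 0 ->
    side p1 w1 <= 0 -> side p2 w2 <= 0 -> side p3 w3 <= 0 ->
    0 < orient z1 z2 z3 -> 0 < orient w1 w2 w3.
  move=> P1 P2 P3 n12 n13 n23 Z1 Z2 Z3 W1 W2 W3 s1 s2 s3 t1 t2 t3 o.
  have {}o := move1 p1 p2 p3 z1 z2 z3 w1 P1 P2 P3 n12 n13 n23 Z1 Z2 Z3 W1 s1 s2 s3 t1 o.
  rewrite orient_rot in o; rewrite orient_rot.
  have n21 : p2 != p1 by rewrite eq_sym.
  have n31 : p3 != p1 by rewrite eq_sym.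
  have n32 : p3 != p2 by rewrite eq_sym.
  have {}o := move1 p2 p3 p1 z2 z3 w1 w2 P2 P3 P1 n23 n21 n31 Z2 Z3 W1 W2 s2 s3 t1 t2 o.
  rewrite orient_rot in o; rewrite orient_rot.
  exact: move1 p3 p1 p2 z3 w1 w2 w3 P3 P1 P2 n31 n32 n12 Z3 W1 W2 W3 s3 t1 t2 t3 o.
have m1 p : nsq (mark p) = 1 by exact: nsq_end.
have o1 : 0 < orient (ed q i) (ed q' j) (ed q (~~ i)).
  apply: (move3 a b c (mark a) (mark b) (mark c)) => //; try exact: ltW; try exact: side_mark.
  by apply: orient_stereo => //; exact: mark_stereo.
have o2 : 0 < orient (ed q i) (ed q (~~ i)) (ed q' (~~ j)).
  apply: (move3 a c d (mark a) (mark c) (mark d)) => //; try exact: ltW; try exact: side_mark.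
  by apply: orient_stereo => //; try exact: mark_stereo; exact: lt_trans bc.
have qq' : q != q'.
  apply/eqP => E; have qb : circle_graph D q b by rewrite E.
  have [E2|E2|E2] := neighbour_degree aP bP cP qa qb qc.
  - by rewrite E2 eqxx in na.
  - by rewrite E2 eqxx in nac.
  - by rewrite E2 eqxx in nb.
suff /bip : circle_graph D q q' by rewrite (negPf qP) (negPf q'P).
rewrite orient_swap oppr_gt0 in o1.
case: (i) o1 o2 => /= o1 o2; last exact: (crossing_adjacent' qq' o1 o2).
apply: (@crossing_adjacent' q q' (~~ j)) => //.
- by rewrite orient_opp oppr_lt0.
- by rewrite negbK orient_opp oppr_gt0.
Qed.

End sides.
End diagrams.

Lemma no_nested_decomposable (R : realType) (V : finType) (D : chord_diagram R V) (P : {set V}) :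
  bipartition (circle_graph D) P -> no_nested_chords D P ->
  decomposable (independence_complex (circle_graph D)).
Proof.
move=> bip [x Cx face]; rewrite -indepT.
apply: (@decomposable_outerplanar R V (circle_graph D) P (pos D)) => //.
- exact: circle_graph_sym.
- exact: circle_graph_irr.
- by move=> p p' _ _; exact: pos_inj.
- exact: neighbour_degree Cx face.
- exact: no_crossing Cx face.
Qed.

Theorem theorem5p2 (R : realType) (V : finType) (e : rel V)
    (He : non_nested_circle_graph R e) :
  exists2 W : topologicalType, wedge_of_spheres R W
    & homotopy_equivalent R (realization R (independence_complex e)) W.
Proof.
have [D [P bip nested] eD] := He.
have eE : e = circle_graph D by apply/funext => u; apply/funext => v; exact: eD.
have dI : dclosed (independence_complex e) by rewrite -indepT; exact: indep_dclosed.
have GI : decomposable (independence_complex e).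
  rewrite eE; case: nested => nested; first exact: no_nested_decomposable bip nested.
  apply: no_nested_decomposable nested => u v /bip.
  by rewrite !finset.in_setC; case: (u \in P); case: (v \in P).
by have [W [wW _ _ KW]] := spherical_decomposable R GI dI; exists W.
Qed.
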